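(* Let $n\ge2$. Given $1\le l\le n-1$, any harmonic map $\varphi:S^2\to\mathbb{R}P^{2n-1}$ in the class $(\zeta_l,\sigma_{\varrho,l})$ is given by $$\varphi=R\cap(A\oplus\overline A)^\perp,$$ where $R$ is a constant $(2l+1)$-dimensional subspace of $\mathbb R^{2n}$ and $A$ is a holomorphic isotropic subbundle of $S^2\times R$ (meaning of $S^2\times R^{\mathbb C}$) of rank $l$ satisfying $\partial A\subseteq\overline A^\perp$. The corresponding extended solutions have uniton number $2$ with respect to the standard representation of $SO(2n)$.
   Context: Lie-theoretic data for $G=SO(2n)$. $\mathbb R^{2n}$ has its standard inner product, extended complex-bilinearly to $\mathbb C^{2n}$ as $\langle\cdot,\cdot\rangle$; $\{u_1,\dots,u_n,\overline u_1,\dots,\overline u_n\}$ is a basis of $\mathbb C^{2n}$ with $\langle u_i,u_j\rangle=0$, $\langle u_i,\overline u_j\rangle=\delta_{ij}$. $E_i\in\mathfrak{so}(2n)$ is given by $E_iu_i=\mathrm iu_i$, $E_i\overline u_i=-\mathrm i\overline u_i$ and zero on the other basis vectors; $\mathfrak t=\mathrm{span}_{\mathbb R}\{E_i\}$, and with $L_i(E_j)=\mathrm i\delta_{ij}$ the positive roots are $L_i\pm L_j$, $i<j$. For $1\le i\le n-1$ put $\zeta_i=E_1+\dots+E_i$. $V_0$ is the real line spanned by $e_n=(u_n+\overline u_n)/\sqrt2$, $s_0=\pi_{V_0}-\pi_{V_0}^\perp$, $\sigma_\varrho=\mathrm{Ad}(s_0)$ (the fundamental outer involution), and $\sigma_{\varrho,l}=\mathrm{Ad}(\exp\pi\zeta_l)\circ\sigma_\varrho$.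 Loops. $\Omega G$: smooth based loops in $G$; $\Omega_{\mathrm{alg}}G$: those that are Laurent polynomials in $\lambda$; $\Lambda^+_{\mathrm{alg}}G^{\mathbb C}$: algebraic loops in $G^{\mathbb C}$ extending holomorphically to $|\lambda|<1$. By the Iwasawa decomposition each loop in $G^{\mathbb C}$ is uniquely $\gamma_R\gamma_+$ with $\gamma_R\in\Omega G$ and $\gamma_+$ extending holomorphically to the disc in $G^{\mathbb C}$; $h\cdot g:=(hg)_R$. With $\gamma_\zeta(\lambda)=\exp(-\mathrm i\ln(\lambda)\zeta)$ set $U_\zeta(G)=\Lambda^+_{\mathrm{alg}}G^{\mathbb C}\cdot\gamma_\zeta$. For an involution $\tau$ of $G$, $T_\tau(\gamma)(\lambda)=\tau(\gamma(-\lambda)\gamma(-1)^{-1})$, $\Omega^\tau G$ is its fixed set, $U^\tau_\zeta(G)=U_\zeta(G)\cap\Omega^\tau G$; $P^\tau=\{g\in G\mid\tau(g)=g^{-1}\}$, $P^\tau_\zeta$ is the component of $P^\tau$ containing $\exp\pi\zeta$, and $P^\tau_e$ the component containing $e$. A smooth map $\Phi:S^2\to\Omega G$ is an extended solution if $\Phi_\lambda^{-1}d\Phi_\lambda=\tfrac12(1-\lambda^{-1})\alpha'+\tfrac12(1-\lambda)\alpha''$ for a $\mathfrak g$-valued 1-form $\alpha=\alpha'+\alpha''$ (type decomposition). If $\Phi=\sum_{i=r}^s A_i\lambda^i$ in the standard representation, with $A_r,A_s\not\equiv0$, its uniton number with respect to that representation is $s-r$. Classes. $\mathbb RP^{2n-1}=SO(2n)/S(O(1)O(2n-1))$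 with base point $V_0$. One has $P^{\sigma_{\varrho,l}}_{\zeta_l}=\exp(\pi\zeta_l)P^{\sigma_\varrho}_e$, identified with $\mathbb RP^{2n-1}$ via $g\cdot V_0\mapsto\exp(\pi\zeta_l)\,g\,\sigma_\varrho(g^{-1})$. A harmonic map $\varphi:S^2\to\mathbb RP^{2n-1}$ is in the class $(\zeta_l,\sigma_{\varrho,l})$ if, up to isometry and under this identification, $\varphi=\Phi_{-1}$ for some extended solution $\Phi:S^2\to\Omega_{\mathrm{alg}}G$ with $\Phi(S^2\setminus D)\subset U^{\sigma_{\varrho,l}}_{\zeta_l}(SO(2n))$ for a discrete set $D$; such $\Phi$ are the ''corresponding extended solutions''. Bundles. A subbundle is isotropic if $\langle\cdot,\cdot\rangle$ vanishes on it; $\perp$ is the Hermitian orthogonal complement; $\partial A\subseteq B$ means that $\partial s/\partial z$ is a section of $B$ for every local section $s$ of $A$ and local complex coordinate $z$. A map into $\mathbb RP^{2n-1}$ is viewed as a real line subbundle of $S^2\times\mathbb R^{2n}$. *)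

(* Defs.v *)
(* The reals are an arbitrary realType R and the complex numbers are R[i].
   Vectors of R^{2n} and C^{2n} are columns indexed by 'I_(n + n). *)
From HB Require Import structures.
From mathcomp Require Export all_boot all_order all_algebra.
From mathcomp Require Export complex.
From mathcomp Require Export all_classical all_reals all_analysis.
From mathcomp Require Import ring.

Export Order.TTheory GRing.Theory Num.Theory numFieldNormedType.Exports.

Set Implicit Arguments.
Unset Strict Implicit.
Unset Printing Implicit Defensive.

Local Open Scope classical_set_scope.
Local Open Scope ring_scope.

Definition ci {R : realType} : R[i] := Complex 0 1.

Definition cmx {R : realType} {m k : nat} (A : 'M[R]_(m, k)) : 'M[R[i]]_(m, k) :=
  map_mx (real_complex R) A.

Definition conjmx {R : realType} {m k : nat} (A : 'M[R[i]]_(m, k)) :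
  'M[R[i]]_(m, k) := map_mx conjc A.

Definition remx {R : realType} {m k : nat} (A : 'M[R[i]]_(m, k)) : 'M[R]_(m, k) :=
  map_mx (@complex.Re R) A.

Definition immx {R : realType} {m k : nat} (A : 'M[R[i]]_(m, k)) : 'M[R]_(m, k) :=
  map_mx (@complex.Im R) A.

Section Calculus.
Context {R : realType}.

Definition basis_rv {m : nat} (k : 'I_m) : 'rV[R]_m := delta_mx 0 k.

Definition iterD {m : nat} (vs : seq 'rV[R]_m.+1) (f : 'rV[R]_m.+1 -> R) :
  'rV[R]_m.+1 -> R := foldr (fun v g x => 'D_v g x) f vs.

(* C^infinity on an open set U: every iterated directional derivative is
   Frechet differentiable (hence continuous) at every point of U. *)
Definition smooth_on {m : nat} (U : set 'rV[R]_m.+1) (f : 'rV[R]_m.+1 -> R) : Prop :=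
  forall (vs : seq 'rV[R]_m.+1) (x : 'rV[R]_m.+1), U x -> differentiable (iterD vs f) x.

Definition mx_smooth_on {m a b : nat} (U : set 'rV[R]_m.+1)
    (F : 'rV[R]_m.+1 -> 'M[R]_(a, b)) : Prop :=
  forall i j, smooth_on U (fun x => F x i j).

Definition cmx_smooth_on {m a b : nat} (U : set 'rV[R]_m.+1)
    (F : 'rV[R]_m.+1 -> 'M[R[i]]_(a, b)) : Prop :=
  mx_smooth_on U (fun x => remx (F x)) /\ mx_smooth_on U (fun x => immx (F x)).

(* The coordinate of p : 'rV_2 is z = p_0 + i p_1. *)
Definition zcoord (p : 'rV[R]_2) : R[i] := Complex (p 0 0) (p 0 1).

Definition mx_partial {a b : nat} (k : 'I_2) (F : 'rV[R]_2 -> 'M[R[i]]_(a, b))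
    (p : 'rV[R]_2) : 'M[R[i]]_(a, b) :=
  \matrix_(i, j) Complex ('D_(basis_rv k) (fun q => complex.Re (F q i j)) p)
                         ('D_(basis_rv k) (fun q => complex.Im (F q i j)) p).

Definition mx_dz {a b : nat} (F : 'rV[R]_2 -> 'M[R[i]]_(a, b)) (p : 'rV[R]_2) :
    'M[R[i]]_(a, b) :=
  2^-1 *: (mx_partial 0 F p - ci *: mx_partial 1 F p).

Definition mx_dzbar {a b : nat} (F : 'rV[R]_2 -> 'M[R[i]]_(a, b)) (p : 'rV[R]_2) :
    'M[R[i]]_(a, b) :=
  2^-1 *: (mx_partial 0 F p + ci *: mx_partial 1 F p).

Definition mx_laplacian {a b : nat} (F : 'rV[R]_2 -> 'M[R]_(a, b)) (p : 'rV[R]_2) :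
    'M[R]_(a, b) :=
  \matrix_(i, j) \sum_(k < 2) iterD [:: basis_rv k; basis_rv k] (fun q => F q i j) p.

Definition holomorphic_on {a b : nat} (U : set 'rV[R]_2)
    (F : 'rV[R]_2 -> 'M[R[i]]_(a, b)) : Prop :=
  cmx_smooth_on U F /\ forall p, U p -> mx_dzbar F p = 0.

(* e^{it} *)
Definition circ (t : R) : R[i] := Complex (cos t) (sin t).

Definition expmx {m : nat} (X : 'M[R]_m) : 'M[R]_m :=
  \matrix_(i, j) limn (series (fun k : nat => (X ^+ k) i j / k`!%:R)).

End Calculus.

Section Sphere.
Context {R : realType}.

Definition S2 : Type := {x : 'rV[R]_3 | \sum_(k < 3) x 0 k ^+ 2 == 1}.

Definition stereo_vec (b : bool) (p : 'rV[R]_2) : 'rV[R]_3 :=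
  let r2 := p 0 0 ^+ 2 + p 0 1 ^+ 2 in
  \row_(k < 3) ([:: 2 * p 0 0; (-1) ^+ b * (2 * p 0 1); (-1) ^+ b * (r2 - 1)]`_k
                / (1 + r2)).

Lemma stereo_vecP (b : bool) (p : 'rV[R]_2) :
  \sum_(k < 3) stereo_vec b p 0 k ^+ 2 == 1.
Proof.
rewrite !big_ord_recl big_ord0 !mxE /=.
set x := p 0 0; set y := p 0 1.
have d0 : 1 + (x ^+ 2 + y ^+ 2) != 0.
  by rewrite gt_eqF // ltr_pwDl // addr_ge0 // sqr_ge0.
apply/eqP; case: b; rewrite ?expr0 ?expr1; field; exact: d0.
Qed.

(* Inverse stereographic projection from the north pole (b = false), and from
   the south pole precomposed with complex conjugation (b = true).  On the
   overlap the two coordinates are related by w = 1/z, so that these charts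
   form a holomorphic atlas of S^2 = CP^1. *)
Definition chart (b : bool) (p : 'rV[R]_2) : S2 :=
  exist _ (stereo_vec b p) (stereo_vecP b p).

(* D is discrete in the subspace topology of the sphere. *)
Definition discrete_in_S2 (D : set S2) : Prop :=
  forall z : S2, D z -> isolated [set val w | w in D] (val z).

End Sphere.
Arguments S2 : clear implicits.

Definition SO {K : comNzRingType} {m : nat} (g : 'M[K]_m) : Prop :=
  g *m g^T = 1%:M /\ \det g = 1.

Definition so {K : comNzRingType} {m : nat} (X : 'M[K]_m) : Prop := X^T = - X.

Section LieData.
Context {R : realType} {n : nat}.

Definition bil (v w : 'cV[R[i]]_(n + n)) : R[i] := (v^T *m w) 0 0.

Definition herm (v w : 'cV[R[i]]_(n + n)) : R[i] := bil v (conjmx w).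

(* u_j = (e_j - i f_j) / sqrt 2, where (e_1, .., e_n, f_1, .., f_n) is the
   standard basis of R^{2n}. *)
Definition u (j : 'I_n) : 'cV[R[i]]_(n + n) :=
  ((Num.sqrt 2)^-1 : R)%:C%C *:
    (delta_mx (lshift n j) 0 - ci *: delta_mx (rshift n j) 0).

Definition ubar (j : 'I_n) : 'cV[R[i]]_(n + n) := conjmx (u j).

(* E_j e_j = f_j and E_j f_j = - e_j *)
Definition E (j : 'I_n) : 'M[R]_(n + n) :=
  delta_mx (rshift n j) (lshift n j) - delta_mx (lshift n j) (rshift n j).

Definition zeta (l : nat) : 'M[R]_(n + n) := \sum_(j < n | (j < l)%N) E j.

(* The vector written e_n with 1-based indices. *)
Definition e_last : 'cV[R]_(n + n) := \col_k (k == n.-1 :> nat)%:R.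

Definition V0 : {vspace 'cV[R]_(n + n)} := <[e_last]>%VS.

Definition piV0 : 'M[R]_(n + n) := e_last *m e_last^T.

Definition s0 : 'M[R]_(n + n) := piV0 - (1%:M - piV0).

Definition sigma_rho (g : 'M[R]_(n + n)) : 'M[R]_(n + n) := s0 *m g *m invmx s0.

Definition exp_pi_zeta (l : nat) : 'M[R]_(n + n) := expmx (pi *: zeta l).

Definition sigma_rho_l (l : nat) (g : 'M[R]_(n + n)) : 'M[R]_(n + n) :=
  exp_pi_zeta l *m sigma_rho g *m invmx (exp_pi_zeta l).

Lemma ci2 : ci * ci = -1 :> R[i].
Proof. by rewrite /ci; simpc. Qed.

Lemma sqrt2V : ((Num.sqrt 2)^-1 : R)%:C%C ^+ 2 = 2^-1 :> R[i].
Proof. by rewrite -rmorphXn /= exprVn sqr_sqrtr ?ler0n // fmorphV rmorph_nat. Qed.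

Lemma ubarE (j : 'I_n) : ubar j = ((Num.sqrt 2)^-1 : R)%:C%C *:
    (delta_mx (lshift n j) 0 + ci *: delta_mx (rshift n j) 0).
Proof.
apply/matrixP => a b; rewrite !mxE rmorphM rmorphB rmorphM /= !conjc_nat oppr0.
by congr (_ * (_ + _)); rewrite -mulNr; congr (_ * _); rewrite /ci; simpc.
Qed.

Lemma trmx_scale (m k : nat) (c : R[i]) (A : 'M[R[i]]_(m, k)) : (c *: A)^T = c *: A^T.
Proof. by apply/matrixP => i j; rewrite !mxE. Qed.

Lemma bilE (c d : R[i]) (j k : 'I_n) :
  bil (delta_mx (lshift n j) 0 + c *: delta_mx (rshift n j) 0)
      (delta_mx (lshift n k) 0 + d *: delta_mx (rshift n k) 0)
  = (1 + c * d) * (j == k)%:R.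
Proof.
rewrite /bil [(_ + _)^T]linearD /= trmx_scale !trmx_delta mulmxDl !mulmxDr.
rewrite -!scalemxAl -!scalemxAr !mul_delta_mx_cond.
rewrite !eq_lshift !eq_rshift !eq_lrshift !eq_rlshift !mxE /=.
by case: (j == k); rewrite ?mulr1n ?mulr0n !mxE /= ?mulr0n ?mulr1n; ring.
Qed.

Lemma bilZ (c : R[i]) v w : bil (c *: v) (c *: w) = c ^+ 2 * bil v w.
Proof. by rewrite /bil trmx_scale -scalemxAl -scalemxAr !mxE mulrA expr2. Qed.

Lemma bil_u_u (j k : 'I_n) : bil (u j) (u k) = 0.
Proof. by rewrite /u bilZ -!scaleNr bilE mulrNN ci2 subrr mul0r mulr0. Qed.

Lemma bil_u_ubar (j k : 'I_n) : bil (u j) (ubar k) = (j == k)%:R.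
Proof.
by rewrite ubarE /u bilZ -!scaleNr bilE mulNr ci2 sqrt2V opprK mulrA mulVf ?mul1r ?pnatr_eq0.
Qed.

Lemma E_u (i j : 'I_n) : cmx (E i) *m u j = (i == j)%:R *: (ci *: u j).
Proof.
rewrite /cmx /E /u map_mxB !map_delta_mx -scalemxAr mulmxBl !mulmxBr -!scalemxAr.
rewrite !mul_delta_mx_cond !eq_lshift !eq_rshift !eq_lrshift !eq_rlshift.
rewrite !mulr0n !scaler0 sub0r subr0.
have [<-|_] := eqVneq; last by rewrite !mulr0n !scaler0 oppr0 subr0 scaler0 scale0r.
rewrite !mulr1n scale1r scalerA mulrC -scalerA; congr (_ *: _).
by rewrite scalerBr scalerA ci2 scaleN1r !opprK addrC.
Qed.

Lemma e_lastE (j : 'I_n) : j = n.-1 :> nat ->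
  cmx e_last = ((Num.sqrt 2)^-1 : R)%:C%C *: (u j + ubar j).
Proof.
move=> jn; rewrite ubarE /u -scalerDr addrACA addNr addr0 scalerA -expr2 sqrt2V.
rewrite -mulr2n -[delta_mx _ _ *+ 2]scaler_nat scalerA mulVf ?pnatr_eq0 // scale1r.
apply/matrixP => a b; rewrite !mxE rmorph_nat ord1 andbT.
by congr ((_ : bool)%:R); rewrite -jn.
Qed.

End LieData.

(* A loop is a function of lambda in R[i] of which only the restriction to the
   unit circle matters; loops in SO(2n) are real-matrix valued, loops in the
   complexification are complex-matrix valued. *)
Section Loops.
Context {R : realType} {n : nat}.

Definition loop_smooth (g : R[i] -> 'M[R[i]]_(n + n)) : Prop :=
  cmx_smooth_on setT (fun t : 'rV[R]_1 => g (circ (t 0 0))).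

Definition OmegaG (g : R[i] -> 'M[R]_(n + n)) : Prop :=
  [/\ forall lam : R[i], `|lam| = 1 -> SO (g lam),
      g 1 = 1%:M
    & loop_smooth (fun lam => cmx (g lam))].

(* sum_{i = r}^{r + m} A_i lambda^i, where A k stands for A_{r + k} *)
Definition laurent (r : int) (m : nat) (A : nat -> 'M[R[i]]_(n + n)) (lam : R[i]) :
    'M[R[i]]_(n + n) :=
  \sum_(k < m.+1) lam ^ (r + k%:Z) *: A k.

Definition algebraic (g : R[i] -> 'M[R[i]]_(n + n)) : Prop :=
  exists (r : int) (m : nat) (A : nat -> 'M[R[i]]_(n + n)),
    forall lam : R[i], `|lam| = 1 -> g lam = laurent r m A lam.

Definition OmegaAlgG (g : R[i] -> 'M[R]_(n + n)) : Prop :=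
  OmegaG g /\ algebraic (fun lam => cmx (g lam)).

Definition extends_to_disc (g : R[i] -> 'M[R[i]]_(n + n)) : Prop :=
  exists F : R[i] -> 'M[R[i]]_(n + n),
  [/\ forall lam : R[i], `|lam| = 1 -> F lam = g lam,
      forall lam : R[i], `|lam| <= 1 -> SO (F lam),
      forall i j,
        {within [set p : 'rV[R]_2 | p 0 0 ^+ 2 + p 0 1 ^+ 2 <= 1],
          continuous (fun p => complex.Re (F (zcoord p) i j))} /\
        {within [set p : 'rV[R]_2 | p 0 0 ^+ 2 + p 0 1 ^+ 2 <= 1],
          continuous (fun p => complex.Im (F (zcoord p) i j))}
    & holomorphic_on [set p : 'rV[R]_2 | p 0 0 ^+ 2 + p 0 1 ^+ 2 < 1]
        (fun p => F (zcoord p))].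

(* smooth loops in SO(2n, C) extending holomorphically to |lambda| < 1 *)
Definition LambdaPlus (g : R[i] -> 'M[R[i]]_(n + n)) : Prop :=
  [/\ forall lam : R[i], `|lam| = 1 -> SO (g lam),
      loop_smooth g
    & extends_to_disc g].

Definition LambdaPlusAlg (g : R[i] -> 'M[R[i]]_(n + n)) : Prop :=
  LambdaPlus g /\ algebraic g.

(* g is the based factor (h gamma_zeta)_R of the Iwasawa decomposition
   h gamma_zeta = g gplus for some h in LambdaPlusAlg.  At lambda = e^{it},
   gamma_zeta(lambda) = exp(- i ln(lambda) zeta) = exp(t zeta). *)
Definition U_zeta (l : nat) (g : R[i] -> 'M[R]_(n + n)) : Prop :=
  OmegaG g /\
  exists h gplus : R[i] -> 'M[R[i]]_(n + n),
    [/\ LambdaPlusAlg h, LambdaPlus gplus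
      & forall t : R,
          h (circ t) *m cmx (expmx (t *: zeta l)) = cmx (g (circ t)) *m gplus (circ t)].

Definition T_tau (tau : 'M[R]_(n + n) -> 'M[R]_(n + n))
    (g : R[i] -> 'M[R]_(n + n)) (lam : R[i]) : 'M[R]_(n + n) :=
  tau (g (- lam) *m invmx (g (- 1))).

Definition OmegaTauG (tau : 'M[R]_(n + n) -> 'M[R]_(n + n))
    (g : R[i] -> 'M[R]_(n + n)) : Prop :=
  OmegaG g /\ forall lam : R[i], `|lam| = 1 -> T_tau tau g lam = g lam.

Definition U_zeta_sigma (l : nat) (g : R[i] -> 'M[R]_(n + n)) : Prop :=
  U_zeta l g /\ OmegaTauG (sigma_rho_l l) g.

(* In each chart the real 1-form alpha is ax dx + ay dy, so that
   alpha' = (ax - i ay)/2 dz and alpha'' = (ax + i ay)/2 dzbar.  The local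
   forms agree on the overlap of the charts because alpha' and alpha'' are
   determined by Phi at lambda = -1. *)
Definition extended_solution (Phi : S2 R -> R[i] -> 'M[R]_(n + n)) : Prop :=
  [/\ forall z, OmegaG (Phi z),
      forall b, mx_smooth_on setT (fun x : 'rV[R]_3 =>
        Phi (chart b (\row_(k < 2) x 0 (widen_ord (leqnSn 2) k))) (circ (x 0 ord_max)))
    & forall b, exists ax ay : 'rV[R]_2 -> 'M[R]_(n + n),
        (forall p, so (ax p) /\ so (ay p)) /\
        forall (lam : R[i]) (p : 'rV[R]_2), `|lam| = 1 ->
          let F := fun q => cmx (Phi (chart b q) lam) in
          invmx (F p) *m mx_dz F p
            = (2^-1 * (1 - lam^-1)) *: (2^-1 *: (cmx (ax p) - ci *: cmx (ay p))) /\
          invmx (F p) *m mx_dzbar F p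
            = (2^-1 * (1 - lam)) *: (2^-1 *: (cmx (ax p) + ci *: cmx (ay p)))].

(* Phi = sum_{i = r}^{r + m} A_i lambda^i with A_r and A_{r + m} not
   identically zero *)
Definition uniton_number (Phi : S2 R -> R[i] -> 'M[R]_(n + n)) (m : nat) : Prop :=
  exists (r : int) (A : nat -> S2 R -> 'M[R[i]]_(n + n)),
    [/\ forall z (lam : R[i]), `|lam| = 1 ->
          cmx (Phi z lam) = laurent r m (fun k => A k z) lam,
        exists z, A 0%N z != 0
      & exists z, A m z != 0].

End Loops.

Section Projective.
Context {R : realType} {n : nat}.

(* RP^{2n-1} as the set of lines of R^{2n} *)
Definition RP : Type := {L : {vspace 'cV[R]_(n + n)} | \dim L == 1%N}.

Definition line (L : RP) : {vspace 'cV[R]_(n + n)} := val L.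

Definition mxact (g : 'M[R]_(n + n)) (V : {vspace 'cV[R]_(n + n)}) :
    {vspace 'cV[R]_(n + n)} :=
  (linfun (mulmx g : 'cV[R]_(n + n) -> 'cV[R]_(n + n)) @: V)%VS.

(* Since the unit sphere is a Riemannian covering of RP^{2n-1} and harmonicity
   on a surface is conformally invariant, phi is harmonic iff its local unit
   lifts f in the charts satisfy (Delta f)^T = 0, where ^T is the component
   tangent to the sphere. *)
Definition harmonic_map (phi : S2 R -> RP) : Prop :=
  forall (b : bool) (p : 'rV[R]_2),
  exists (U : set 'rV[R]_2) (f : 'rV[R]_2 -> 'cV[R]_(n + n)),
    [/\ open U, U p, mx_smooth_on U f
      & forall q, U q ->
        [/\ (f q)^T *m f q = 1%:M,
            line (phi (chart b q)) = <[f q]>%VS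
          & mx_laplacian f q - f q *m ((f q)^T *m mx_laplacian f q) = 0]].

(* M corresponds to the line V under
   g . V_0 |-> exp(pi zeta_l) g sigma_rho(g^-1). *)
Definition identified (l : nat) (V : {vspace 'cV[R]_(n + n)}) (M : 'M[R]_(n + n)) : Prop :=
  exists g : 'M[R]_(n + n),
    [/\ SO g, V = mxact g V0
      & M = exp_pi_zeta l *m g *m sigma_rho (invmx g)].

(* The isometries of RP^{2n-1} are the maps induced by O(2n). *)
Definition corresponding (l : nat) (phi : S2 R -> RP)
    (Phi : S2 R -> R[i] -> 'M[R]_(n + n)) : Prop :=
  [/\ extended_solution Phi,
      forall z, OmegaAlgG (Phi z),
      exists D : set (S2 R),
        discrete_in_S2 D /\ forall z, ~ D z -> U_zeta_sigma l (Phi z)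
    & exists k : 'M[R]_(n + n), k *m k^T = 1%:M /\
        forall z, identified l (mxact k (line (phi z))) (Phi z (- 1))].

Definition in_class (l : nat) (phi : S2 R -> RP) : Prop :=
  exists Phi, corresponding l phi Phi.

End Projective.
Arguments RP : clear implicits.

Section Bundles.
Context {R : realType} {n : nat}.

Definition hperp (X : set 'cV[R[i]]_(n + n)) : set 'cV[R[i]]_(n + n) :=
  [set v | forall w, X w -> herm v w = 0].

Definition conj_set (X : set 'cV[R[i]]_(n + n)) : set 'cV[R[i]]_(n + n) :=
  [set conjmx v | v in X].

Definition sum_set (X Y : set 'cV[R[i]]_(n + n)) : set 'cV[R[i]]_(n + n) :=
  [set v + w | v in X & w in Y].

Definition complexify (W : {vspace 'cV[R]_(n + n)}) : set 'cV[R[i]]_(n + n) :=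
  [set v | remx v \in W /\ immx v \in W].

(* holomorphic rank-l subbundle of the trivial bundle with fibre C^{2n}: it has
   a holomorphic frame near every point *)
Definition holomorphic_subbundle (l : nat) (A : S2 R -> {vspace 'cV[R[i]]_(n + n)}) : Prop :=
  (forall z, \dim (A z) = l) /\
  forall (b : bool) (p : 'rV[R]_2),
  exists (U : set 'rV[R]_2) (s : 'I_l -> 'rV[R]_2 -> 'cV[R[i]]_(n + n)),
    [/\ open U, U p, forall k, holomorphic_on U (s k)
      & forall q, U q -> A (chart b q) = <<[seq s k q | k : 'I_l]>>%VS].

Definition isotropic (A : S2 R -> {vspace 'cV[R[i]]_(n + n)}) : Prop :=
  forall z v w, v \in A z -> w \in A z -> bil v w = 0.

(* A is included in the fibrewise set B after d/dz.  It is enough to use the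
   coordinates of the two charts, d/dz changing by a nonzero factor under a
   change of complex coordinate. *)
Definition partial_sub (A : S2 R -> {vspace 'cV[R[i]]_(n + n)})
    (B : S2 R -> set 'cV[R[i]]_(n + n)) : Prop :=
  forall (b : bool) (U : set 'rV[R]_2) (s : 'rV[R]_2 -> 'cV[R[i]]_(n + n)),
    open U -> cmx_smooth_on U s -> (forall q, U q -> s q \in A (chart b q)) ->
    forall q, U q -> B (chart b q) (mx_dz s q).

End Bundles.

(* Main.v *)
Require Import Defs.
From mathcomp Require Import ring lra.
From mathcomp Require spectral.

Set Implicit Arguments.
Unset Strict Implicit.
Unset Printing Implicit Defensive.

Local Open Scope classical_set_scope.
Local Open Scope ring_scope.

(** Why the theorem holds.

    Away from the discrete set, write the loop g = Phi(z) by the factorization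
    h gamma_zeta = g g_+. The loops h, lambda gamma_zeta and g_+ extend to the
    disc, so lambda g does too; as g is a real Laurent polynomial,
    g = P / lambda + Q + lambda conj(P), and P has at most the rank l of the
    value of lambda gamma_zeta at 0 (loop_fourier). The analytic input is that a
    Laurent polynomial on the circle with an extension to the disc has no
    negative powers (disc_algebra_laurent). It rests on the maximum principle,
    hence on the symmetry of second derivatives.

    The fixed point condition for sigma_(rho,l), which is conjugation by the
    involution S = exp(pi zeta) s_0, together with the trace of g(-1) S, a
    reflection fixing a line, shows that P S is a contraction of rank at most l
    with Re tr(P S) = l. Such a matrix is a Hermitian projection, and it follows
    that P itself is a Hermitian projection of rank l with S P = P and
    P conj(P) = 0 (symmetric_loop_rigidity). These conditions are closed, so they
    hold at the points of the discrete set as well (normal_form_everywhere). In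
    particular the uniton number is 2.

    At lambda = -1 one reads off that, up to the isometry in the definition of
    the class, the projection onto the line phi(z) is (1 + S)/2 - P - conj(P).
    So R is the fixed space of S, of dimension 2l + 1, and A is the image of P.
    Isotropy of A is P conj(P) = 0. The coefficients of the extended solution
    equation give P dbar P = dbar P and P^T d P = 0 (polar_coef_flat). The first
    makes A holomorphic (projection_holomorphic_frame), the second is the
    inclusion of the derivative of A in the orthogonal complement of its
    conjugate. *)

(** * Smooth real functions of several variables *)

(** Differentiability depends on the germ only; needed since derivation rules
    hold on an open set and not everywhere. *)
Lemma near_eq_differentiable (K : numFieldType) (V W : normedModType K)
    (f g : V -> W) (x : V) :
  (\near x, f x = g x) -> differentiable f x -> differentiable g x.
Proof.
move=> fg df; have gx : f x = g x by exact: nbhs_singleton fg.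
have ge : g \o shift x = cst (g x) + 'd f x +o_ 0 id.
  apply/eqaddoP => _/posnumP[e]; near=> h.
  rewrite [X in `|X|](_ : _ = (f \o shift x - (cst (f x) + 'd f x)) h); last first.
    rewrite /= !fctE gx; congr (_ - _); apply/esym.
    near: h; move: fg; rewrite (near_shift 0) /=.
    by apply: filterS => y /=; rewrite subr0.
  near: h; have /diff_locally/eqaddoP := df; exact.
apply/diff_locallyP.
have -> : 'd g x = 'd f x :> (V -> W).
  by apply: diff_unique => //; exact: diff_continuous.
by split=> //; exact: diff_continuous.
Unshelve. all: by end_near. Qed.

Section SmoothReal.
Context {R : realType} {m : nat}.
Implicit Types (U : set 'rV[R]_m.+1) (f g : 'rV[R]_m.+1 -> R).

(** Smoothness cut off at order k: the closure properties of smooth functions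
    go by induction on k, each derivation rule losing one order. *)
Definition smooth_upto (k : nat) U f : Prop :=
  forall vs : seq 'rV[R]_m.+1, (size vs <= k)%N ->
  forall x, U x -> differentiable (iterD vs f) x.

Lemma smooth_onP U f : smooth_on U f <-> forall k, smooth_upto k U f.
Proof.
split=> [sf k vs _ x Ux|sf vs x Ux]; first exact: sf.
exact: (sf (size vs) vs).
Qed.

Lemma smooth_upto0 U f : smooth_upto 0 U f <-> (forall x, U x -> differentiable f x).
Proof.
split=> [sf x Ux|sf [|//] _ x Ux]; last exact: sf.
exact: (sf [::]).
Qed.

Lemma iterD_rcons (vs : seq 'rV[R]_m.+1) v f :
  iterD (rcons vs v) f = iterD vs (fun x => 'D_v f x).
Proof. by rewrite /iterD foldr_rcons. Qed.

Lemma smooth_uptoS k U f : smooth_upto k.+1 U f <->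
  (forall x, U x -> differentiable f x) /\
  forall v, smooth_upto k U (fun x => 'D_v f x).
Proof.
split=> [sf|[df sf] vs].
  split=> [x Ux|v vs vsk x Ux]; first exact: (sf [::]).
  by rewrite -iterD_rcons; apply: sf => //; rewrite size_rcons.
case/lastP: vs => [_ x Ux|vs v]; first exact: df.
by rewrite size_rcons => vsk x Ux; rewrite iterD_rcons; apply: sf.
Qed.

Lemma smooth_uptoW k U f : smooth_upto k.+1 U f -> smooth_upto k U f.
Proof. by move=> sf vs vsk; apply: sf; exact: leqW. Qed.

Lemma smooth_upto_ext k U f g : open U -> (forall x, U x -> f x = g x) ->
  smooth_upto k U f -> smooth_upto k U g.
Proof.
move=> oU; elim: k f g => [|k IH] f g fg.
  rewrite !smooth_upto0 => df x Ux; apply: near_eq_differentiable (df x Ux).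
  by apply: filterS fg _; exact: open_nbhs_nbhs.
rewrite !smooth_uptoS => -[df sf]; split=> [x Ux|v].
  apply: near_eq_differentiable (df x Ux).
  by apply: filterS fg _; exact: open_nbhs_nbhs.
apply: IH (sf v) => x Ux; apply: near_eq_derive.
by apply: filterS fg _; exact: open_nbhs_nbhs.
Qed.

Lemma smooth_upto_cst k U c : smooth_upto k U (cst c).
Proof.
elim: k c => [|k IH] c; first by apply/smooth_upto0.
apply/smooth_uptoS; split=> // v.
by rewrite (_ : (fun x => _) = cst 0) //; apply/funext => x; rewrite derive_cst.
Qed.

Lemma smooth_uptoD k U f g : open U ->
  smooth_upto k U f -> smooth_upto k U g -> smooth_upto k U (f + g).
Proof.
move=> oU; elim: k f g => [|k IH] f g.
  by rewrite !smooth_upto0 => df dg x Ux; apply: differentiableD; [exact: df|exact: dg].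
move=> /smooth_uptoS[df sf] /smooth_uptoS[dg sg].
apply/smooth_uptoS; split=> [x Ux|v].
  by apply: differentiableD; [exact: df|exact: dg].
apply: smooth_upto_ext (IH _ _ (sf v) (sg v)) => // x Ux.
by rewrite fctE deriveD //; apply: diff_derivable; [exact: df|exact: dg].
Qed.

Lemma smooth_uptoM k U f g : open U ->
  smooth_upto k U f -> smooth_upto k U g -> smooth_upto k U (f * g).
Proof.
move=> oU; elim: k f g => [|k IH] f g.
  by rewrite !smooth_upto0 => df dg x Ux; apply: differentiableM; [exact: df|exact: dg].
move=> sf sg.
have [df df'] := (smooth_uptoS _ _ _).1 sf; have [dg dg'] := (smooth_uptoS _ _ _).1 sg.
apply/smooth_uptoS; split=> [x Ux|v].
  by apply: differentiableM; [exact: df|exact: dg].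
apply: smooth_upto_ext (smooth_uptoD oU (IH _ _ (smooth_uptoW sf) (dg' v))
   (IH _ _ (smooth_uptoW sg) (df' v))) => // x Ux.
by rewrite !fctE deriveM //; apply: diff_derivable; [exact: df|exact: dg].
Qed.

Lemma smooth_uptoV k U f : open U -> (forall x, U x -> f x != 0) ->
  smooth_upto k U f -> smooth_upto k U (fun x => (f x)^-1).
Proof.
move=> oU f0; elim: k => [|k IH].
  by rewrite !smooth_upto0 => df x Ux; apply: differentiableV; [exact: df|exact: f0].
move=> sf; have [df df'] := (smooth_uptoS _ _ _).1 sf.
apply/smooth_uptoS; split=> [x Ux|v].
  by apply: differentiableV; [exact: df|exact: f0].
have sV := IH (smooth_uptoW sf).
apply: smooth_upto_ext (smooth_uptoM oU (@smooth_upto_cst _ _ (-1))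
   (smooth_uptoM oU (smooth_uptoM oU sV sV) (df' v))) => // x Ux.
rewrite !fctE deriveV; [|exact: f0|exact/diff_derivable/df].
by rewrite /= mulN1r scaleNr -invfM -expr2.
Qed.

Lemma smooth_on_ext U f g : open U -> (forall x, U x -> f x = g x) ->
  smooth_on U f -> smooth_on U g.
Proof. by move=> oU fg /smooth_onP sf; apply/smooth_onP => k; apply: smooth_upto_ext fg _. Qed.

Lemma smooth_on_cst U c : smooth_on U (cst c).
Proof. by apply/smooth_onP => k; exact: smooth_upto_cst. Qed.

Lemma smooth_onD U f g : open U ->
  smooth_on U f -> smooth_on U g -> smooth_on U (fun x => f x + g x).
Proof.
by move=> oU /smooth_onP sf /smooth_onP sg; apply/smooth_onP => k; exact: smooth_uptoD.
Qed.

Lemma smooth_onM U f g : open U ->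
  smooth_on U f -> smooth_on U g -> smooth_on U (fun x => f x * g x).
Proof.
by move=> oU /smooth_onP sf /smooth_onP sg; apply/smooth_onP => k; exact: smooth_uptoM.
Qed.

Lemma smooth_onN U f : open U -> smooth_on U f -> smooth_on U (fun x => - f x).
Proof.
move=> oU sf; apply: smooth_on_ext (smooth_onM oU (@smooth_on_cst U (-1)) sf) => // x _.
by rewrite /= mulN1r.
Qed.

Lemma smooth_onB U f g : open U ->
  smooth_on U f -> smooth_on U g -> smooth_on U (fun x => f x - g x).
Proof. by move=> oU sf sg; apply: smooth_onD => //; exact: smooth_onN. Qed.

Lemma smooth_onV U f : open U -> (forall x, U x -> f x != 0) ->
  smooth_on U f -> smooth_on U (fun x => (f x)^-1).
Proof. by move=> oU f0 /smooth_onP sf; apply/smooth_onP => k; exact: smooth_uptoV. Qed.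

Lemma smooth_on_derive U f v : smooth_on U f -> smooth_on U (fun x => 'D_v f x).
Proof. by move=> sf vs x Ux; rewrite -iterD_rcons; exact: sf. Qed.

Lemma smooth_on_differentiable U f x : smooth_on U f -> U x -> differentiable f x.
Proof. by move=> sf; exact: (sf [::]). Qed.

Lemma derive_coord (x v : 'rV[R]_m.+1) (j : 'I_m.+1) :
  'D_v (fun y : 'rV[R]_m.+1 => y 0 j) x = v 0 j.
Proof.
have := @derive_mx R _ _ _ id x v (@derivable_id _ _ x v).
by rewrite derive_id => /matrixP/(_ 0 j); rewrite mxE => ->.
Qed.

Lemma smooth_on_coord U (j : 'I_m.+1) : smooth_on U (fun x => x 0 j).
Proof.
apply/smooth_onP => -[|k]; first by apply/smooth_upto0 => x _; exact: differentiable_coord.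
apply/smooth_uptoS; split=> [x _|v]; first exact: differentiable_coord.
rewrite (_ : (fun x => _) = cst (v 0 j)); first exact: smooth_upto_cst.
by apply/funext => x; rewrite derive_coord.
Qed.

Lemma smooth_onS U V f : V `<=` U -> smooth_on U f -> smooth_on V f.
Proof. by move=> VU sf vs x /VU; exact: sf. Qed.

End SmoothReal.

Section MatrixContinuity.
Context {R : realFieldType}.

Lemma cvg_mxP {T : Type} {m n : nat} (F : set_system T) (M : T -> 'M[R]_(m, n))
    (l : 'M[R]_(m, n)) : Filter F ->
  (forall i j, (fun x => M x i j) @ F --> l i j) -> M @ F --> l.
Proof.
move=> FF cM; apply/cvgrPdist_le => /= e e0.
near=> x.
rewrite /Num.Def.normr /= mx_normrE (bigmax_le _ (ltW e0)) //= => i _.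
rewrite !mxE /=.
move: i; near: x; apply: filter_forall => /= i.
by have /cvgrPdist_le := cM i.1 i.2; exact.
Unshelve. all: by end_near. Qed.

Lemma mulmxr_continuous {p m n : nat} (M : 'M[R]_(m, n)) :
  continuous (fun A : 'M[R]_(p, m) => A *m M).
Proof.
move=> A; apply: (cvg_mxP (F := nbhs A) (nbhs_filter A)) => i j; rewrite mxE.
under eq_fun do rewrite mxE.
apply: cvg_big => [|k _]; first exact: add_continuous.
by apply: cvgM; [exact: coord_continuous|exact: cvg_cst].
Qed.

End MatrixContinuity.

Section SmoothComp.
Context {R : realType} {m k : nat}.

(** Directional derivatives commute with an affine substitution, up to
    transporting the directions by its linear part. *)
Lemma smooth_on_affine (U : set 'rV[R]_m.+1) (V : set 'rV[R]_k.+1)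
    (M : 'M[R]_(m.+1, k.+1)) (c : 'rV[R]_k.+1) (f : 'rV[R]_k.+1 -> R) :
  (forall x, U x -> V (x *m M + c)) ->
  smooth_on V f -> smooth_on U (fun x => f (x *m M + c)).
Proof.
move=> UV sf.
have dL x : differentiable (fun x : 'rV[R]_m.+1 => x *m M + c) x.
  apply: differentiableD => //.
  exact: (@linear_differentiable R _ _ (mulmxr M) x (@mulmxr_continuous R 1 _ _ M)).
have df f' x : smooth_on V f' -> U x -> differentiable (fun x => f' (x *m M + c)) x.
  move=> sf' Ux; apply: (@differentiable_comp _ _ _ _ (fun x => x *m M + c) f') => //.
  exact/(smooth_on_differentiable sf')/UV.
suff E f' : forall vs x, iterD vs (fun x => f' (x *m M + c)) x =
    iterD [seq v *m M | v <- vs] f' (x *m M + c).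
  move=> vs x Ux; rewrite (funext (E f vs)).
  apply: (df (iterD [seq v *m M | v <- vs] f)) => // ws y Vy.
  have -> : iterD ws (iterD [seq v *m M | v <- vs] f)
      = iterD (ws ++ [seq v *m M | v <- vs]) f by rewrite /iterD foldr_cat.
  exact: sf.
elim=> [//|v vs IH] x /=; rewrite (funext IH).
rewrite /derive (_ : (fun h => _) = (fun h : R => h^-1 *: (iterD [seq v *m M | v <- vs] f' (h *: (v *m M) + (x *m M + c)) - iterD [seq v *m M | v <- vs] f' (x *m M + c)))) //; apply/funext => h /=.
by rewrite mulmxDl -scalemxAl addrA.
Qed.

End SmoothComp.

(** * Smooth complex functions and Wirtinger derivatives *)

Section Wirtinger.
Context {R : realType}.
Local Notation C := R[i].
Local Notation plane := 'rV[R]_2.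
Implicit Types (U : set plane) (f g : plane -> C) (p q : plane).

Lemma ReD (x y : C) : complex.Re (x + y) = complex.Re x + complex.Re y.
Proof. by case: x; case: y. Qed.
Lemma ImD (x y : C) : complex.Im (x + y) = complex.Im x + complex.Im y.
Proof. by case: x; case: y. Qed.
Lemma ReM (x y : C) :
  complex.Re (x * y) = complex.Re x * complex.Re y - complex.Im x * complex.Im y.
Proof. by case: x; case: y. Qed.
Lemma ImM (x y : C) :
  complex.Im (x * y) = complex.Re x * complex.Im y + complex.Im x * complex.Re y.
Proof. by case: x => a b; case: y => c d /=. Qed.
Lemma complex_eqP (x y : C) :
  complex.Re x = complex.Re y -> complex.Im x = complex.Im y -> x = y.
Proof. by case: x => a b; case: y => c d /= -> ->. Qed.

Definition csmooth U f : Prop :=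
  smooth_on U (fun q => complex.Re (f q)) /\ smooth_on U (fun q => complex.Im (f q)).

Definition cdiff f p : Prop :=
  differentiable (fun q => complex.Re (f q)) p /\
  differentiable (fun q => complex.Im (f q)) p.

Lemma csmooth_cdiff U f p : csmooth U f -> U p -> cdiff f p.
Proof. by move=> [sr si] Up; split; apply: smooth_on_differentiable Up. Qed.

Lemma csmooth_ext U f g : open U -> (forall q, U q -> f q = g q) ->
  csmooth U f -> csmooth U g.
Proof.
move=> oU fg [sr si].
by split; [apply: smooth_on_ext sr|apply: smooth_on_ext si] => // q Uq; rewrite fg.
Qed.

Lemma csmoothS U V f : V `<=` U -> csmooth U f -> csmooth V f.
Proof. by move=> VU [sr si]; split; apply: smooth_onS VU _. Qed.

Lemma csmooth_cst U (c : C) : csmooth U (fun=> c).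
Proof. by split; exact: smooth_on_cst. Qed.

Lemma csmoothD U f g : open U -> csmooth U f -> csmooth U g ->
  csmooth U (fun q => f q + g q).
Proof.
move=> oU [fr fi] [gr gi]; split.
  by under eq_fun do rewrite ReD; exact: smooth_onD.
by under eq_fun do rewrite ImD; exact: smooth_onD.
Qed.

Lemma csmoothM U f g : open U -> csmooth U f -> csmooth U g ->
  csmooth U (fun q => f q * g q).
Proof.
move=> oU [fr fi] [gr gi]; split.
  by under eq_fun do rewrite ReM; apply: smooth_onB => //; apply: smooth_onM.
by under eq_fun do rewrite ImM; apply: smooth_onD => //; apply: smooth_onM.
Qed.

Lemma csmoothV U f : open U -> (forall q, U q -> f q != 0) ->
  csmooth U f -> csmooth U (fun q => (f q)^-1).
Proof.
move=> oU f0 [fr fi].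
pose N q := complex.Re (f q) ^+ 2 + complex.Im (f q) ^+ 2.
have N0 q : U q -> N q != 0.
  move=> /f0; apply: contra; rewrite paddr_eq0 ?sqr_ge0 // !sqrf_eq0.
  by case: (f q) => a b /= /andP[/eqP -> /eqP ->].
have sN : smooth_on U N.
  by rewrite /N; apply: smooth_onD => //; under eq_fun do rewrite expr2; exact: smooth_onM.
have sNV := smooth_onV oU N0 sN.
split.
  rewrite (_ : (fun q => _) = (fun q => complex.Re (f q) * (N q)^-1)); first exact: smooth_onM.
  by apply/funext => q; rewrite /N; case: (f q).
rewrite (_ : (fun q => _) = (fun q => - (complex.Im (f q) * (N q)^-1))).
  by apply: smooth_onN => //; exact: smooth_onM.
by apply/funext => q; rewrite /N; case: (f q) => a b /=.
Qed.

Lemma csmooth_sum U (I : Type) (r : seq I) (P : pred I) (F : I -> plane -> C) :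
  open U -> (forall i, csmooth U (F i)) ->
  csmooth U (fun q => \sum_(i <- r | P i) F i q).
Proof.
move=> oU sF; elim: r => [|i r IH].
  by under eq_fun do rewrite big_nil; exact: csmooth_cst.
under eq_fun do rewrite big_cons; case: (P i) => //.
exact: csmoothD.
Qed.

Lemma csmooth_prod U (I : Type) (r : seq I) (P : pred I) (F : I -> plane -> C) :
  open U -> (forall i, csmooth U (F i)) ->
  csmooth U (fun q => \prod_(i <- r | P i) F i q).
Proof.
move=> oU sF; elim: r => [|i r IH].
  by under eq_fun do rewrite big_nil; exact: csmooth_cst.
under eq_fun do rewrite big_cons; case: (P i) => //.
exact: csmoothM.
Qed.

Definition cpartial (k : 'I_2) f p : C :=
  Complex ('D_(basis_rv k) (fun q => complex.Re (f q)) p)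
          ('D_(basis_rv k) (fun q => complex.Im (f q)) p).

(** For c = - i and c = i these are d/dz and d/dzbar; both are derivations for
    the same reason, hence the parameter. *)
Definition wirt (c : C) f p : C := 2^-1 * (cpartial 0 f p + c * cpartial 1 f p).

Lemma cpartial_ext k f g p : (\near p, f p = g p) -> cpartial k f p = cpartial k g p.
Proof.
move=> fg; congr Complex; apply: near_eq_derive; near=> q; congr (_ _); near: q; exact: fg.
Unshelve. all: by end_near. Qed.

Lemma cpartialD k f g p : cdiff f p -> cdiff g p ->
  cpartial k (fun q => f q + g q) p = cpartial k f p + cpartial k g p.
Proof.
move=> [fr fi] [gr gi]; rewrite /cpartial; simpc.
rewrite (funext (fun q => ReD (f q) (g q))) (funext (fun q => ImD (f q) (g q))).
by rewrite !deriveD //; apply: diff_derivable.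
Qed.

Lemma cpartialM k f g p : cdiff f p -> cdiff g p ->
  cpartial k (fun q => f q * g q) p = cpartial k f p * g p + f p * cpartial k g p.
Proof.
move=> [fr fi] [gr gi]; rewrite /cpartial.
rewrite (funext (fun q => ReM (f q) (g q))) (funext (fun q => ImM (f q) (g q))).
have D := @diff_derivable R plane R.
rewrite deriveB; [|by apply: derivableM; apply: D..].
rewrite deriveD; [|by apply: derivableM; apply: D..].
rewrite !deriveM; try exact: D.
move: ('D_ _ (fun q => complex.Re (f q)) p) ('D_ _ (fun q => complex.Im (f q)) p).
move: ('D_ _ (fun q => complex.Re (g q)) p) ('D_ _ (fun q => complex.Im (g q)) p).
case: (f p) => a b; case: (g p) => c d; rewrite /GRing.scale /= => s t u v; simpc.
by congr Complex; ring.
Qed.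

Lemma cpartial_cst k (c : C) p : cpartial k (fun=> c) p = 0.
Proof. by rewrite /cpartial !derive_cst. Qed.

Lemma cdiffD f g p : cdiff f p -> cdiff g p -> cdiff (fun q => f q + g q) p.
Proof.
move=> [fr fi] [gr gi]; split.
  by under eq_fun do rewrite ReD; exact: differentiableD.
by under eq_fun do rewrite ImD; exact: differentiableD.
Qed.

Lemma cdiffM f g p : cdiff f p -> cdiff g p -> cdiff (fun q => f q * g q) p.
Proof.
move=> [fr fi] [gr gi]; split.
  by under eq_fun do rewrite ReM; apply: differentiableB; apply: differentiableM.
by under eq_fun do rewrite ImM; apply: differentiableD; apply: differentiableM.
Qed.

Lemma cdiff_cst (c : C) p : cdiff (fun=> c) p.
Proof. by split; exact: differentiable_cst. Qed.

Lemma wirt_ext c f g p : (\near p, f p = g p) -> wirt c f p = wirt c g p.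
Proof. by move=> fg; rewrite /wirt !(cpartial_ext _ fg). Qed.

Lemma wirtD c f g p : cdiff f p -> cdiff g p ->
  wirt c (fun q => f q + g q) p = wirt c f p + wirt c g p.
Proof.
move=> df dg; rewrite /wirt !cpartialD //.
by move: (cpartial _ _ _) (cpartial _ _ _) (cpartial _ _ _) (cpartial _ _ _) => s t u v; ring.
Qed.

Lemma wirtM c f g p : cdiff f p -> cdiff g p ->
  wirt c (fun q => f q * g q) p = wirt c f p * g p + f p * wirt c g p.
Proof.
move=> df dg; rewrite /wirt !cpartialM //.
move: (f p) (g p) (cpartial _ _ _) (cpartial _ _ _) (cpartial _ _ _) (cpartial _ _ _).
by move=> x y s t u v; ring.
Qed.

Lemma wirt_cst c (d : C) p : wirt c (fun=> d) p = 0.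
Proof. by rewrite /wirt !cpartial_cst mulr0 addr0 mulr0. Qed.

Lemma cdiff_sum (I : Type) (r : seq I) (F : I -> plane -> C) p :
  (forall i, cdiff (F i) p) -> cdiff (fun q => \sum_(i <- r) F i q) p.
Proof.
move=> dF; elim: r => [|i r IH].
  by under eq_fun do rewrite big_nil; exact: cdiff_cst.
by under eq_fun do rewrite big_cons; exact: cdiffD.
Qed.

Lemma wirt_sum c (I : Type) (r : seq I) (F : I -> plane -> C) p :
  (forall i, cdiff (F i) p) ->
  wirt c (fun q => \sum_(i <- r) F i q) p = \sum_(i <- r) wirt c (F i) p.
Proof.
move=> dF; elim: r => [|i r IH].
  by under eq_fun do rewrite big_nil; rewrite wirt_cst big_nil.
under eq_fun do rewrite big_cons; rewrite wirtD ?IH ?big_cons //.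
exact: cdiff_sum.
Qed.

Section Matrices.
Context {a b : nat}.
Implicit Types F G : plane -> 'M[C]_(a, b).

Definition mxcsmooth U F : Prop := forall i j, csmooth U (fun q => F q i j).
Definition mxcdiff F p : Prop := forall i j, cdiff (fun q => F q i j) p.
Definition mxwirt c F p : 'M[C]_(a, b) := \matrix_(i, j) wirt c (fun q => F q i j) p.

Lemma mxcsmoothP U F : cmx_smooth_on U F <-> mxcsmooth U F.
Proof.
split=> [[sr si] i j|sF].
  split.
    by have := sr i j; under eq_fun do rewrite mxE.
  by have := si i j; under eq_fun do rewrite mxE.
split=> i j; under eq_fun do rewrite mxE; by case: (sF i j).
Qed.

Lemma mx_dzE F p : mx_dz F p = mxwirt (- ci) F p.
Proof. by apply/matrixP => i j; rewrite !mxE /wirt mulNr. Qed.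

Lemma mx_dzbarE F p : mx_dzbar F p = mxwirt ci F p.
Proof. by apply/matrixP => i j; rewrite !mxE /wirt. Qed.

Lemma mxcsmooth_diff U F p : mxcsmooth U F -> U p -> mxcdiff F p.
Proof. by move=> sF Up i j; apply: csmooth_cdiff Up. Qed.

Lemma mxcsmooth_ext U F G : open U -> (forall q, U q -> F q = G q) ->
  mxcsmooth U F -> mxcsmooth U G.
Proof. by move=> oU FG sF i j; apply: csmooth_ext (sF i j) => // q Uq; rewrite FG. Qed.

Lemma mxcsmooth_cst U (A : 'M[C]_(a, b)) : mxcsmooth U (fun=> A).
Proof. by move=> i j; exact: csmooth_cst. Qed.

Lemma mxcsmoothZ U f F : open U -> csmooth U f -> mxcsmooth U F ->
  mxcsmooth U (fun q => f q *: F q).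
Proof. by move=> oU sf sF i j; under eq_fun do rewrite mxE; exact: csmoothM. Qed.

Lemma mxcsmoothD U F G : open U -> mxcsmooth U F -> mxcsmooth U G ->
  mxcsmooth U (fun q => F q + G q).
Proof. by move=> oU sF sG i j; under eq_fun do rewrite mxE; exact: csmoothD. Qed.

Lemma mxcdiff_cst (A : 'M[C]_(a, b)) p : mxcdiff (fun=> A) p.
Proof. by move=> i j; exact: cdiff_cst. Qed.

Lemma mxcdiffZ (d : C) F p : mxcdiff F p -> mxcdiff (fun q => d *: F q) p.
Proof.
move=> dF i j; under eq_fun do rewrite mxE; apply: cdiffM => //; exact: cdiff_cst.
Qed.

Lemma mxcdiffD F G p : mxcdiff F p -> mxcdiff G p -> mxcdiff (fun q => F q + G q) p.
Proof. by move=> dF dG i j; under eq_fun do rewrite mxE; apply: cdiffD. Qed.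

Lemma mxwirt_ext c F G p : (\near p, F p = G p) -> mxwirt c F p = mxwirt c G p.
Proof.
move=> FG; apply/matrixP => i j; rewrite !mxE; apply: wirt_ext.
by apply: filterS FG => q ->.
Qed.

Lemma mxwirt_cst c (A : 'M[C]_(a, b)) p : mxwirt c (fun=> A) p = 0.
Proof. by apply/matrixP => i j; rewrite !mxE wirt_cst. Qed.

Lemma mxwirtZ c (d : C) F p : mxcdiff F p ->
  mxwirt c (fun q => d *: F q) p = d *: mxwirt c F p.
Proof.
move=> dF; apply/matrixP => i j; rewrite !mxE.
rewrite (funext (fun q => mxE _ (fun i j => d * F q i j) i j)).
by rewrite wirtM ?wirt_cst ?mul0r ?add0r //; exact: cdiff_cst.
Qed.

Lemma mxwirtD c F G p : mxcdiff F p -> mxcdiff G p ->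
  mxwirt c (fun q => F q + G q) p = mxwirt c F p + mxwirt c G p.
Proof.
move=> dF dG; apply/matrixP => i j; rewrite !mxE -wirtD //.
by rewrite (funext (fun q => mxE _ (fun i j => F q i j + G q i j) i j)).
Qed.

End Matrices.

Section MatrixProducts.
Context {a b d : nat}.
Implicit Types (F : plane -> 'M[C]_(a, b)) (G : plane -> 'M[C]_(b, d)).

Lemma mxcsmoothM U F G : open U -> mxcsmooth U F -> mxcsmooth U G ->
  mxcsmooth U (fun q => F q *m G q).
Proof.
move=> oU sF sG i j; under eq_fun do rewrite mxE.
by apply: csmooth_sum => // k; exact: csmoothM.
Qed.

Lemma mxcdiffM F G p : mxcdiff F p -> mxcdiff G p -> mxcdiff (fun q => F q *m G q) p.
Proof.
move=> dF dG i j; under eq_fun do rewrite mxE.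
by apply: cdiff_sum => k; exact: cdiffM.
Qed.

Lemma mxwirtM c F G p : mxcdiff F p -> mxcdiff G p ->
  mxwirt c (fun q => F q *m G q) p = mxwirt c F p *m G p + F p *m mxwirt c G p.
Proof.
move=> dF dG; apply/matrixP => i j; rewrite !mxE -big_split /=.
rewrite (funext (fun q => mxE _ (fun i j => \sum_k F q i k * G q k j) i j)).
rewrite wirt_sum => [|k]; last exact: cdiffM.
by apply: eq_bigr => k _; rewrite wirtM // !mxE.
Qed.

End MatrixProducts.

Lemma csmooth_det U k (F : plane -> 'M[C]_k) : open U -> mxcsmooth U F ->
  csmooth U (fun q => \det (F q)).
Proof.
move=> oU sF; apply: csmooth_sum => // s; apply: csmoothM => //.
  exact: csmooth_cst.
exact: csmooth_prod.
Qed.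

(** Cramer's rule: the inverse is the adjugate over the determinant. *)
Lemma mxcsmooth_invmx U k (F : plane -> 'M[C]_k) : open U ->
  (forall q, U q -> F q \in unitmx) -> mxcsmooth U F ->
  mxcsmooth U (fun q => invmx (F q)).
Proof.
move=> oU uF sF.
have sadj : mxcsmooth U (fun q => \adj (F q)).
  move=> i j; under eq_fun do rewrite mxE.
  apply: csmoothM => //; first exact: csmooth_cst.
  apply: csmooth_det => // c d.
  by under eq_fun do rewrite !mxE; exact: sF.
apply: (mxcsmooth_ext oU (F := fun q => (\det (F q))^-1 *: \adj (F q))).
- by move=> q Uq; rewrite /invmx uF.
- apply: mxcsmoothZ => //; apply: csmoothV => //; last exact: csmooth_det.
Qed.

End Wirtinger.

(** * Symmetry of second derivatives and the maximum principle *)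

Section Schwarz.
Context {R : realType} {m : nat}.
Implicit Types (U : set 'rV[R]_m.+1) (f : 'rV[R]_m.+1 -> R) (p v w : 'rV[R]_m.+1).

Lemma is_derive_line f p v (s : R) : differentiable f (p + s *: v) ->
  is_derive s 1 (fun s : R => f (p + s *: v)) ('D_v f (p + s *: v)).
Proof.
move=> df; have dv := @diff_derivable _ _ _ f _ v df.
have E : (fun h : R => h^-1 *: (((fun s : R => f (p + s *: v)) \o shift s) (h *: 1) -
     f (p + s *: v))) =
  (fun h => h^-1 *: ((f \o shift (p + s *: v)) (h *: v) - f (p + s *: v))).
  apply/funext => h /=; congr (_ *: (f _ - _)).
  by rewrite /= [h *: 1]mulr1 scalerDl addrCA.
by split; rewrite /derivable /derive E.
Qed.

Lemma MVT_line f p v (t : R) : 0 < t ->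
  (forall s, 0 <= s <= t -> differentiable f (p + s *: v)) ->
  exists2 s, 0 <= s <= t & f (p + t *: v) - f p = t * 'D_v f (p + s *: v).
Proof.
move=> t0 df.
have [|s|s st E] := @MVT_segment R (fun s => f (p + s *: v)) (fun s => 'D_v f (p + s *: v))
  0 t (ltW t0).
- move=> s; rewrite in_itv /= => /andP[s0 st]; apply: is_derive_line.
  by apply: df; rewrite (ltW s0) (ltW st).
- apply: derivable_within_continuous => s' /=; rewrite in_itv /= => st'.
  by have [] := is_derive_line (df _ st').
- exists s; first by move: st; rewrite in_itv.
  by move: E; rewrite scale0r addr0 subr0 mulrC.
Qed.

Definition second_diff f p v w (t : R) :=
  f (p + t *: v + t *: w) - f (p + t *: v) - (f (p + t *: w) - f p).

Lemma second_diffC f p v w t : second_diff f p v w t = second_diff f p w v t.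
Proof. by rewrite /second_diff [p + t *: w + t *: v]addrAC; ring. Qed.

(** Two applications of the mean value theorem express the second difference
    by one mixed derivative; by symmetry it is also expressed by the other one. *)
Lemma second_diffE U f p v w t : open U -> smooth_on U f -> 0 < t ->
  (forall s s', 0 <= s <= t -> 0 <= s' <= t -> U (p + s *: v + s' *: w)) ->
  exists s s', [/\ 0 <= s <= t, 0 <= s' <= t &
    second_diff f p v w t = t * (t * 'D_w (fun x => 'D_v f x) (p + s *: v + s' *: w))].
Proof.
move=> oU sf t0 inU.
have tt : 0 <= t <= t by rewrite lexx ltW.
have oo : 0 <= (0 : R) <= t by rewrite lexx ltW.
have df x : U x -> differentiable f x by apply: smooth_on_differentiable.
pose W s' := p + s' *: w.
have shiftd s s' : p + s *: v + s' *: w = W s' + s *: v by rewrite /W addrAC.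
have dfw s' x : U (x + s' *: w) -> differentiable (fun x => f (x + s' *: w)) x.
  move=> Ux; apply: (@differentiable_comp _ _ _ _ (fun x => x + s' *: w) f) => //.
  exact: df.
pose g x := f (x + t *: w) - f x.
have [|s st Es] := @MVT_line g p v t t0.
  move=> s st; apply: differentiableB.
    by apply: dfw; apply: inU.
  by apply: df; have := inU _ _ st oo; rewrite scale0r addr0.
have [|s' st' Es'] := @MVT_line (fun x => 'D_v f x) (p + s *: v) w t t0.
  move=> s' st'; apply: (@smooth_on_differentiable _ _ U); last exact: inU.
  exact: smooth_on_derive.
exists s, s'; split=> //; rewrite -Es' /second_diff -/(g _) -/(g p) Es; congr (_ * _).
have Ux : U (p + s *: v) by have := inU _ _ st oo; rewrite scale0r addr0.
have Uxw : U (p + s *: v + t *: w) by apply: inU.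
rewrite deriveB; [|exact/diff_derivable/dfw|exact/diff_derivable/df].
have E : (fun h : R => h^-1 *: (((fun x => f (x + t *: w)) \o shift (p + s *: v)) (h *: v) -
     f (p + s *: v + t *: w))) =
  (fun h => h^-1 *: ((f \o shift (p + s *: v + t *: w)) (h *: v) - f (p + s *: v + t *: w))).
  by apply/funext => h /=; rewrite -[h *: v + _ + _]addrA.
by rewrite /derive E.
Qed.

(** Both mixed derivatives are limits of the same second difference divided
    by t^2. *)
Lemma derive_commute U f p v w : open U -> smooth_on U f -> U p ->
  'D_w (fun x => 'D_v f x) p = 'D_v (fun x => 'D_w f x) p.
Proof.
move=> oU sf Up.
pose G x := 'D_w (fun x => 'D_v f x) x; pose H x := 'D_v (fun x => 'D_w f x) x.
rewrite -/(G p) -/(H p).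
have sm v' w' : smooth_on U (fun x => 'D_w' (fun x => 'D_v' f x) x).
  by do 2![apply: smooth_on_derive].
have cG : {for p, continuous G}.
  by apply: differentiable_continuous; apply: smooth_on_differentiable Up; exact: sm.
have cH : {for p, continuous H}.
  by apply: differentiable_continuous; apply: smooth_on_differentiable Up; exact: sm.
apply/eqP; rewrite -subr_eq0 -normr_le0; apply/ler_addgt0Pl => e e0; rewrite addr0.
have e20 : 0 < e / 2 by rewrite divr_gt0.
have nU : nbhs p U by apply: open_nbhs_nbhs.
have /cvgrPdist_lt/(_ _ e20) nG := cG.
have /cvgrPdist_lt/(_ _ e20) nH := cH.
have [d /= d0 dU] := (nbhs_ballP _ _).1 (filterI nU (filterI nG nH)).
(* the parallelogram spanned by t v and t w stays in the ball of radius d *)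
pose t := d / (`|v| + `|w| + 1) / 2.
have n0 : 0 < `|v| + `|w| + 1 by rewrite ltr_wpDl // addr_ge0.
have t0 : 0 < t by rewrite !divr_gt0.
have inB s s' : 0 <= s <= t -> 0 <= s' <= t -> ball p d (p + s *: v + s' *: w).
  move=> /andP[s0 st] /andP[s0' st']; rewrite -ball_normE /= -addrA opprD addNKr normrN.
  apply: (le_lt_trans (ler_normD _ _)); rewrite !normrZ !ger0_norm //.
  apply: (@le_lt_trans _ _ (t * (`|v| + `|w| + 1))).
    rewrite mulrDr mulr1 mulrDr -[leLHS]addr0 lerD ?(ltW t0) //.
    by rewrite lerD // ler_wpM2r.
  rewrite /t mulrAC divfK ?gt_eqF // ltr_pdivrMr // ltr_pMr // ltr1n.
  done.
have [|s [s' [st st' E1]]] := @second_diffE U f p v w t oU sf t0.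
  by move=> s s' st st'; have [] := dU _ (inB _ _ st st').
have [|r [r' [rt rt' E2]]] := @second_diffE U f p w v t oU sf t0.
  by move=> r r' rt rt'; rewrite addrAC; have [] := dU _ (inB _ _ rt' rt).
move: E2; rewrite second_diffC E1 => /(mulfI (lt0r_neq0 t0))/(mulfI (lt0r_neq0 t0)) E.
have [_ [hG _]] := dU _ (inB _ _ st st').
have := inB _ _ rt' rt; rewrite addrAC => /dU[_ [_ hH]].
have EGH : G (p + s *: v + s' *: w) = H (p + r *: w + r' *: v) := E.
move: hG hH; rewrite EGH => hG hH; rewrite [e]splitr; apply: ltW.
apply: (le_lt_trans (ler_distD (H (p + r *: w + r' *: v)) _ _)).
by apply: ltrD; [exact: hG|rewrite distrC; exact: hH].
Qed.

End Schwarz.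

Section MaximumPrinciple.
Context {R : realType}.
Local Notation plane := 'rV[R]_2.
Implicit Types (p q : plane) (u : plane -> R).

(** If L were positive then g1 would be positive just to the right of 0, where
    g would exceed its maximum by the mean value theorem. *)
Lemma second_derivative_test (g g1 : R -> R) (d L : R) : 0 < d ->
  (forall s : R, `|s| < d -> is_derive s 1 g (g1 s)) -> is_derive (0 : R) 1 g1 L ->
  (forall s, `|s| < d -> g s <= g 0) -> L <= 0.
Proof.
move=> d0 dg dg1 gmax; rewrite leNgt; apply/negP => L0.
have z0 : `|0 : R| < d by rewrite normr0.
have inn s : s \in `]-d, d[ -> `|s| < d by rewrite in_itv /= ltr_norml.
have g10 : g1 0 = 0.
  have dN : - d <= d by rewrite (le_trans _ (ltW d0)) // oppr_le0 ltW.
  have zin : 0 \in `]-d, d[ by rewrite in_itv /= oppr_lt0 d0.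
  have dgi s : s \in `]-d, d[ -> derivable g s 1 by move=> /inn /dg[].
  have gm s : s \in `]-d, d[ -> g s <= g 0 by move=> /inn; exact: gmax.
  have [_ E1] := derive1_at_max dN dgi zin gm.
  by have [_ E2] := dg _ z0; rewrite -E2 E1.
have [] := dg1; rewrite /derivable => cv; rewrite /derive => lv.
have : h^-1 *: ((g1 \o shift 0) (h *: 1) - g1 0) @[h --> 0^'] --> L.
  by rewrite -lv.
move=> /cvgrPdist_lt/(_ _ L0)[e /= e0 he].
pose t := Num.min d e / 2.
have t0 : 0 < t by rewrite divr_gt0 // lt_min d0.
have tm : t < Num.min d e by rewrite ltr_pdivrMr // ltr_pMr ?ltr1n // lt_min d0.
have [td te] : t < d /\ t < e by apply/andP; rewrite -lt_min.
have pos s : 0 < s < t -> 0 < g1 s.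
  move=> /andP[s0 st]; have := he s.
  rewrite /= g10 subr0 /GRing.scale /= mulr1 addr0 sub0r normrN gtr0_norm //.
  move=> /(_ (lt_trans st te)) /(_ (lt0r_neq0 s0)).
  rewrite ltr_norml => /andP[_]; rewrite ltrBlDr -ltrBlDl subrr.
  by rewrite pmulr_rgt0 // invr_gt0.
have dgi s : s \in `]0, t[ -> is_derive s 1 g (g1 s).
  by rewrite in_itv /= => /andP[s0 st]; apply: dg; rewrite gtr0_norm // (lt_trans st).
have [|s] := @MVT R g g1 0 t t0 dgi.
  apply: derivable_within_continuous => s /=; rewrite in_itv /= => /andP[s0 st].
  by have [] := dg s; rewrite ?ger0_norm // (le_lt_trans st).
rewrite in_itv /= subr0 => st E.
have : g t <= g 0 by apply: gmax; rewrite gtr0_norm.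
by rewrite -subr_le0 E leNgt mulr_gt0 // pos.
Qed.

Definition sq_norm p := p 0 0 ^+ 2 + p 0 1 ^+ 2.
Definition odisc : set plane := [set p | sq_norm p < 1].
Definition cdisc : set plane := [set p | sq_norm p <= 1].

Lemma coord2_continuous (j : 'I_2) : continuous (fun p : plane => p 0 j).
Proof. exact: coord_continuous. Qed.

Lemma sq_norm_continuous : continuous sq_norm.
Proof.
rewrite (_ : sq_norm = fun p => p 0 0 * p 0 0 + p 0 1 * p 0 1).
  move=> p; apply: (@continuousD _ _ _ (fun p => p 0 0 * p 0 0) (fun p => p 0 1 * p 0 1)).
    by apply: (@continuousM _ _ (fun p => p 0 0) (fun p => p 0 0)); exact: coord2_continuous.
  by apply: (@continuousM _ _ (fun p => p 0 1) (fun p => p 0 1)); exact: coord2_continuous.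
by apply/funext => p; rewrite /sq_norm !expr2.
Qed.

Lemma open_odisc : open odisc.
Proof.
apply: (@open_comp _ _ sq_norm [set x | x < 1]); last exact: open_lt.
by move=> x _; exact: sq_norm_continuous.
Qed.

Lemma compact_cdisc : compact cdisc.
Proof.
apply: bounded_closed_compact.
  exists 1; split; first exact: num_real.
  move=> M M1 p; rewrite /cdisc /= => p1.
  rewrite [leLHS]/Num.Def.normr /= mx_normrE; apply/bigmax_leP.
  split; first by rewrite (le_trans ler01) // ltW.
  move=> [i j] _ /=; rewrite (le_trans _ (ltW M1)) // -(expr_le1 (n := 2)) // real_normK ?num_real //.
  rewrite (le_trans _ p1) // /sq_norm ord1.
  have [->|->] : j = 0 \/ j = 1.
    by case: j => [[|[|//]] jj]; [left|right]; exact/val_inj.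
  - by rewrite lerDl sqr_ge0.
  - by rewrite lerDr sqr_ge0.
apply: (@closed_comp _ _ sq_norm [set x | x <= 1]); last exact: closed_le.
by move=> x _; exact: sq_norm_continuous.
Qed.

Lemma sq_norm_line p (k : 'I_2) (s : R) :
  sq_norm (p + s *: basis_rv k) = sq_norm p + 2 * s * p 0 k + s ^+ 2.
Proof.
rewrite /sq_norm !mxE /=.
have [->|->] : k = 0 \/ k = 1 by case: k => [[|[|//]] jj]; [left|right]; exact/val_inj.
  by rewrite /=; ring.
by rewrite /=; ring.
Qed.

(** Were u positive somewhere, u + e (|p|^2 - 1) would have a positive maximum
    for small e > 0, necessarily inside the disc; there both second derivatives
    would be nonpositive, while their sum is 4 e. *)
Lemma harmonic_max u :
  {within cdisc, continuous u} -> smooth_on odisc u ->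
  (forall p, odisc p -> 'D_(basis_rv 0) (fun x => 'D_(basis_rv 0) u x) p
     + 'D_(basis_rv 1) (fun x => 'D_(basis_rv 1) u x) p = 0) ->
  (forall p, sq_norm p = 1 -> u p <= 0) ->
  forall p, cdisc p -> u p <= 0.
Proof.
move=> cu su lap bd p0 p0c; rewrite leNgt; apply/negP => c0.
pose e := u p0 / 2; have e0 : 0 < e by rewrite divr_gt0.
pose w p := u p + e * (sq_norm p - 1).
have cw : {within cdisc, continuous w}.
  move=> x; apply: cvgD; first exact: cu.
  apply: cvgM; first exact: cvg_cst.
  apply: cvgB; last exact: cvg_cst.
  by apply: continuous_subspaceT; exact: sq_norm_continuous.
have [m mc mmax] := EVT_max_rV (ex_intro _ p0 p0c) compact_cdisc cw.
have wm : 0 < w m.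
  apply: lt_le_trans (mmax p0 (mem_set p0c)); rewrite /w /e.
  have : 0 <= sq_norm p0 by rewrite addr_ge0 ?sqr_ge0.
  by move: c0; nra.
have mo : odisc m.
  move/set_mem: mc; rewrite /cdisc /odisc /= le_eqVlt => /orP[/eqP m1|//].
  by move: wm; rewrite /w m1 subrr mulr0 addr0 ltNge bd.
have /nbhs_ballP[d /= d0 dU] : nbhs m odisc by apply: open_nbhs_nbhs; split; [exact: open_odisc|].
have inU k (s : R) : `|s| < d -> odisc (m + s *: basis_rv k).
  move=> sd; apply: dU; rewrite -ball_normE /= opprD addNKr normrN normrZ.
  apply: le_lt_trans sd; rewrite ler_piMr // [leLHS]/Num.Def.normr /= mx_normrE.
  apply/bigmax_leP; split=> // -[i j] _ /=; rewrite mxE.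
  by case: (_ && _); rewrite ?normr1 ?normr0.
have test k : 'D_(basis_rv k) (fun x => 'D_(basis_rv k) u x) m + 2 * e <= 0.
  set L := 'D_ _ _ _.
  pose D x := 'D_(basis_rv k) u x.
  pose g s := u (m + s *: basis_rv k) + e * (2 * m 0 k * s + s * s).
  pose g1 s := D (m + s *: basis_rv k) + e * (2 * m 0 k + (s + s)).
  apply: (@second_derivative_test g g1 d) => // [s sd||s sd].
  - have du : is_derive s 1 (fun s : R => u (m + s *: basis_rv k)) (D (m + s *: basis_rv k)).
      by apply: is_derive_line; apply: smooth_on_differentiable (inU k s sd).
    apply: is_derive_eq.
    by rewrite /GRing.scale /= /g1; ring.
  - have du : is_derive (0:R) 1 (fun s : R => D (m + s *: basis_rv k)) L.
      rewrite /L -[m in 'D_ _ _ m]addr0 -[X in m + X](scale0r (basis_rv k)).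
      apply: is_derive_line; rewrite scale0r addr0.
      by apply: smooth_on_differentiable (mo); exact: smooth_on_derive.
    apply: is_derive_eq.
    by rewrite /GRing.scale /=; ring.
  - have := mmax (m + s *: basis_rv k).
    rewrite inE => /(_ (ltW (inU k s sd))).
    rewrite /w /g sq_norm_line scale0r addr0; lra.
have := lerD (test 0) (test 1); rewrite addrACA lap // add0r; move: e0; lra.
Qed.

End MaximumPrinciple.

(** * The disc algebra *)

Section DiscAlgebra.
Context {R : realType}.
Local Notation C := R[i].
Local Notation plane := 'rV[R]_2.
Implicit Types (p q : plane) (f g : plane -> C).

(** The Cauchy--Riemann equations. *)
Lemma wirt_i_eq0 f p : wirt ci f p = 0 ->
  'D_(basis_rv 0) (fun q => complex.Re (f q)) p =
    'D_(basis_rv 1) (fun q => complex.Im (f q)) p /\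
  'D_(basis_rv 0) (fun q => complex.Im (f q)) p =
    - 'D_(basis_rv 1) (fun q => complex.Re (f q)) p.
Proof.
rewrite /wirt => /eqP; rewrite mulf_eq0 invr_eq0 pnatr_eq0 /= => /eqP.
rewrite /cpartial /ci; simpc => -[/eqP]; rewrite subr_eq0 => /eqP -> /eqP.
by rewrite addr_eq0 => /eqP ->.
Qed.

Definition disc_algebra f : Prop :=
  [/\ csmooth odisc f, forall p, odisc p -> wirt ci f p = 0,
      {within cdisc, continuous (fun p => complex.Re (f p))}
    & {within cdisc, continuous (fun p => complex.Im (f p))}].

Lemma disc_algebra_cst (c : C) : disc_algebra (fun=> c).
Proof.
split; [exact: csmooth_cst|by move=> p _; exact: wirt_cst|..].
  by move=> x; exact: cvg_cst.
by move=> x; exact: cvg_cst.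
Qed.

Lemma disc_algebraD f g : disc_algebra f -> disc_algebra g ->
  disc_algebra (fun p => f p + g p).
Proof.
move=> [sf hf rf jf] [sg hg rg jg]; split.
- exact: csmoothD open_odisc _ _.
- move=> p op; rewrite wirtD ?hf ?hg ?addr0 //; exact: csmooth_cdiff op.
- by under eq_fun do rewrite ReD; move=> x; apply: cvgD; [exact: rf|exact: rg].
- by under eq_fun do rewrite ImD; move=> x; apply: cvgD; [exact: jf|exact: jg].
Qed.

Lemma disc_algebraM f g : disc_algebra f -> disc_algebra g ->
  disc_algebra (fun p => f p * g p).
Proof.
move=> [sf hf rf jf] [sg hg rg jg]; split.
- exact: csmoothM open_odisc _ _.
- move=> p op; rewrite wirtM ?hf ?hg ?mul0r ?mulr0 ?addr0 //; exact: csmooth_cdiff op.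
- under eq_fun do rewrite ReM; move=> x.
  by apply: cvgB; apply: cvgM; [exact: rf|exact: rg|exact: jf|exact: jg].
- under eq_fun do rewrite ImM; move=> x.
  by apply: cvgD; apply: cvgM; [exact: rf|exact: jg|exact: jf|exact: rg].
Qed.

Lemma disc_algebra_z : disc_algebra zcoord.
Proof.
split.
- by split; exact: smooth_on_coord.
- move=> p _; by rewrite /wirt /cpartial /zcoord /= !derive_coord !mxE /= /ci; simpc.
- by apply: continuous_subspaceT => x; exact: coord_continuous.
- by apply: continuous_subspaceT => x; exact: coord_continuous.
Qed.

Lemma disc_algebraZ (c : C) f : disc_algebra f -> disc_algebra (fun p => c * f p).
Proof. by move=> ?; apply: disc_algebraM => //; exact: disc_algebra_cst. Qed.

Lemma disc_algebraX f n : disc_algebra f -> disc_algebra (fun p => f p ^+ n).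
Proof.
move=> hf; elim: n => [|n IH].
  by under eq_fun do rewrite expr0; exact: disc_algebra_cst.
by under eq_fun do rewrite exprS; exact: disc_algebraM.
Qed.

Lemma disc_algebra_sum (I : Type) (r : seq I) (F : I -> plane -> C) :
  (forall i, disc_algebra (F i)) -> disc_algebra (fun p => \sum_(i <- r) F i p).
Proof.
move=> hF; elim: r => [|i r IH].
  by under eq_fun do rewrite big_nil; exact: disc_algebra_cst.
by under eq_fun do rewrite big_cons; exact: disc_algebraD.
Qed.

Lemma disc_algebra_horner (P : {poly C}) : disc_algebra (fun p => P.[zcoord p]).
Proof.
under eq_fun do rewrite horner_coef.
apply: disc_algebra_sum => i; apply: disc_algebraZ; apply: disc_algebraX.
exact: disc_algebra_z.
Qed.

(** By the Cauchy--Riemann equations the Laplacian of Re f is the difference of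
    the two mixed derivatives of Im f, so Re f is harmonic. *)
Lemma disc_algebra_Re_le0 f : disc_algebra f -> (forall p, sq_norm p = 1 -> f p = 0) ->
  forall p, cdisc p -> complex.Re (f p) <= 0.
Proof.
move=> [[sr si] hf rf jf] bd; apply: harmonic_max => // [p op|p p1]; last by rewrite bd.
pose u q := complex.Re (f q); pose v q := complex.Im (f q).
have nearO : \near p, odisc p by apply: open_nbhs_nbhs; split=> //; exact: open_odisc.
have E0 : 'D_(basis_rv 0) (fun x => 'D_(basis_rv 0) u x) p =
          'D_(basis_rv 0) (fun x => 'D_(basis_rv 1) v x) p.
  by apply: near_eq_derive; apply: filterS nearO => q /hf /wirt_i_eq0[].
have E1 : 'D_(basis_rv 1) (fun x => 'D_(basis_rv 1) u x) p =
          'D_(basis_rv 1) (fun x => - 'D_(basis_rv 0) v x) p.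
  apply: near_eq_derive; apply: filterS nearO => q /hf /wirt_i_eq0[_].
  by rewrite -/u -/v => ->; rewrite opprK.
rewrite E0 E1 deriveN; last first.
  by apply/diff_derivable/(smooth_on_differentiable _ op); exact: smooth_on_derive.
by rewrite (derive_commute _ _ open_odisc si op) subrr.
Qed.

(** Applied to f, - f, i f and - i f, the maximum principle bounds the real and
    imaginary parts of f from both sides. *)
Lemma disc_algebra_eq0 f : disc_algebra f -> (forall p, sq_norm p = 1 -> f p = 0) ->
  forall p, cdisc p -> f p = 0.
Proof.
move=> hf bd p cp.
have H (c : C) : complex.Re (c * f p) <= 0.
  apply: (disc_algebra_Re_le0 (disc_algebraZ c hf)) => // q q1.
  by rewrite bd ?mulr0.
have := H 1; have := H (-1); have := H ci; have := H (- ci); rewrite /ci.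
case: (f p) => a b; simpc => /= h1 h2 h3 h4.
by congr Complex; apply/eqP; rewrite eq_le; apply/andP; split; lra.
Qed.

(** A limiting argument along the horizontal line through p. *)
Lemma eq0_of_punctured (h : plane -> R) p : {for p, continuous h} ->
  (\forall q \near p, q <> p -> h q = 0) -> h p = 0.
Proof.
move=> ch h0; apply/eqP; rewrite -normr_le0; apply/ler_addgt0Pl => e e0; rewrite addr0.
have : \forall q \near p, (q <> p -> h q = 0) /\ `|h p - h q| < e.
  by near=> q; split; near: q => //; move: ch => /cvgrPdist_lt; exact.
move=> /nbhs_ballP[d /= d0 dU].
pose q := p + (d / 2) *: basis_rv 0.
have d20 : 0 < d / 2 by rewrite divr_gt0.
have [|hq hp] := dU q.
  rewrite -ball_normE /= /q opprD addNKr normrN normrZ gtr0_norm //.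
  apply: (@le_lt_trans _ _ (d / 2)); last by rewrite ltr_pdivrMr // ltr_pMr // ltr1n.
  rewrite ler_piMr ?(ltW d20) // [leLHS]/Num.Def.normr /= mx_normrE.
  apply/bigmax_leP; split=> // -[i j] _ /=; rewrite mxE.
  by case: (_ && _); rewrite ?normr1 ?normr0.
rewrite hq in hp; first by rewrite subr0 in hp; exact: ltW.
rewrite /q => /matrixP/(_ 0 0); rewrite !mxE /= mulr1 => /eqP.
by rewrite addrC -subr_eq0 addrK gt_eqF.
Unshelve. all: by end_near. Qed.

Lemma zcoord_eq0 p : (zcoord p == 0) = (p == 0).
Proof.
apply/eqP/eqP => [[p0 p1]|->]; last by rewrite /zcoord !mxE.
apply/matrixP => i j; rewrite ord1 mxE.
by case: j => [[|[|//]] jj]; [rewrite -[RHS]p0|rewrite -[RHS]p1]; congr (p _ _); exact/val_inj.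
Qed.

(** Removable singularity at 0: a zero of the polynomial at 0 is divided out
    together with one factor z, and continuity at 0 restores the value there. *)
Lemma disc_algebra_div_z f (P : {poly C}) n : disc_algebra f ->
  (forall p, cdisc p -> zcoord p ^+ n * f p = P.[zcoord p]) ->
  exists Q : {poly C}, forall p, cdisc p -> f p = Q.[zcoord p].
Proof.
elim: n P => [|n IH] P hf E.
  by exists P => p cp; rewrite -E // expr0 mul1r.
have c0 : cdisc (0 : plane) by rewrite /cdisc /= /sq_norm !mxE expr0n addr0 ler01.
have P0 : root P 0.
  have := E 0 c0; rewrite (_ : zcoord 0 = 0); last by apply/eqP; rewrite zcoord_eq0.
  by rewrite expr0n mul0r => /esym/eqP.
have [Q PQ] := factor_theorem _ _ P0; rewrite subr0 in PQ.
apply: (IH Q hf) => p cp; apply/eqP; rewrite -subr_eq0; apply/eqP.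
pose g q := zcoord q ^+ n * f q + (- 1) * Q.[zcoord q].
have -> : zcoord p ^+ n * f p - Q.[zcoord p] = g p by rewrite /g mulN1r.
have gh : disc_algebra g.
  apply: disc_algebraD; first by apply: disc_algebraM => //; exact/disc_algebraX/disc_algebra_z.
  by apply: disc_algebraZ; exact: disc_algebra_horner.
have gn0 q : cdisc q -> q <> 0 -> g q = 0.
  move=> cq q0; apply: (@mulfI _ (zcoord q)); first by rewrite zcoord_eq0; apply/eqP.
  rewrite mulr0 /g mulrDr mulrA -exprS E // PQ hornerM hornerX; ring.
have [->|/eqP] := eqVneq p 0; last exact: gn0.
have [sg _ _ _] := gh.
have o0 : odisc (0 : plane) by rewrite /odisc /= /sq_norm !mxE expr0n addr0 ltr01.
have [dr di] := csmooth_cdiff sg o0.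
have nearC : \forall q \near (0 : plane), cdisc q.
  have : \forall q \near (0 : plane), odisc q by apply: open_nbhs_nbhs; split=> //; exact: open_odisc.
  by apply: filterS => q /ltW.
apply: complex_eqP.
  apply: (@eq0_of_punctured (fun q => complex.Re (g q)) 0); first exact: differentiable_continuous.
  by apply: filterS nearC => q cq q0; rewrite gn0.
apply: (@eq0_of_punctured (fun q => complex.Im (g q)) 0); first exact: differentiable_continuous.
by apply: filterS nearC => q cq q0; rewrite gn0.
Qed.

Lemma sq_norm_norm p : sq_norm p = 1 <-> `|zcoord p| = 1.
Proof.
rewrite normc_def /= -/(sq_norm p); split=> [->|]; first by rewrite sqrtr1.
have n0 : 0 <= sq_norm p by rewrite addr_ge0 ?sqr_ge0.
by case=> /(congr1 (fun x => x ^+ 2)); rewrite sqr_sqrtr // expr1n.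
Qed.

Lemma cdisc_norm p : cdisc p <-> `|zcoord p| <= 1.
Proof.
rewrite normc_def /= -/(sq_norm p) /cdisc /= lecR -[X in _ <-> Num.sqrt _ <= X]sqrtr1.
by rewrite ler_sqrt.
Qed.

(** This replaces the vanishing of negative Fourier coefficients: with N the
    order of the pole, z^N f and a polynomial agree on the circle, hence on the
    disc, and z^N can be divided out. *)
Lemma disc_algebra_laurent f (r : int) (m : nat) (a : nat -> C) : disc_algebra f ->
  (forall p, sq_norm p = 1 -> f p = \sum_(k < m.+1) zcoord p ^ (r + k%:Z) * a k) ->
  exists Q : {poly C}, forall p, cdisc p -> f p = Q.[zcoord p].
Proof.
move=> hf fE.
have [N [M NM]] : exists N M : nat, r = M%:Z - N%:Z.
  by case: r {fE} => k; [exists 0%N, k; rewrite subr0|exists k.+1, 0%N; rewrite NegzE sub0r].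
pose P : {poly C} := \sum_(k < m.+1) a k *: 'X^(M + k).
apply: (@disc_algebra_div_z f P N hf) => p cp; apply/eqP; rewrite -subr_eq0; apply/eqP.
pose g q := zcoord q ^+ N * f q + (- 1) * P.[zcoord q].
have -> : zcoord p ^+ N * f p - P.[zcoord p] = g p by rewrite /g mulN1r.
apply: disc_algebra_eq0 => // [|q q1].
  apply: disc_algebraD; first by apply: disc_algebraM => //; exact/disc_algebraX/disc_algebra_z.
  by apply: disc_algebraZ; exact: disc_algebra_horner.
have z0 : zcoord q != 0.
  by rewrite -normr_gt0; move/sq_norm_norm: q1 => ->; exact: ltr01.
rewrite /g fE // mulN1r /P horner_sum mulr_sumr -sumrB big1 // => k _.
rewrite hornerZ hornerXn mulrA NM -[_ ^+ N]/(zcoord q ^ N%:Z) -expfzDr //.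
by rewrite addrCA addrA addrNK -PoszD mulrC subrr.
Qed.

(** The polynomial also vanishes on the disc, where the points 1/(k+1) give more
    roots than its size. *)
Lemma poly_eq0_on_circle (P : {poly C}) :
  (forall z : C, `|z| = 1 -> P.[z] = 0) -> P = 0.
Proof.
move=> P0; apply/eqP/negP => /negP Pn0.
have Pd p : cdisc p -> P.[zcoord p] = 0.
  apply: (@disc_algebra_eq0 (fun q => P.[zcoord q])); first exact: disc_algebra_horner.
  by move=> q /sq_norm_norm; exact: P0.
pose pt (k : nat) : C := (k.+1%:R^-1 : R)%:C%C.
have := @max_poly_roots _ P (mkseq pt (size P)) Pn0.
rewrite size_mkseq ltnn => H; apply: notF; apply: H.
  apply/allP => _ /mapP[k _ ->]; apply/eqP.
  have -> : pt k = zcoord (\row_j [:: k.+1%:R^-1; 0]`_j) by rewrite /zcoord !mxE.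
  apply: Pd; rewrite /cdisc /= /sq_norm !mxE /= expr0n addr0.
  by rewrite expr_le1 // ?invr_ge0 // invf_le1 // ler1n.
apply/mkseq_uniq => j k /complexI /invr_inj /eqP; rewrite eqr_nat => /eqP [].
by [].
Qed.

End DiscAlgebra.

(** * Rigidity of Hermitian projections *)

Section MatrixAlgebra.
Context {R : realType}.
Local Notation C := R[i].

Lemma conjmxM a b c (A : 'M[C]_(a, b)) (B : 'M[C]_(b, c)) :
  conjmx (A *m B) = conjmx A *m conjmx B.
Proof. exact: map_mxM. Qed.
Lemma conjmxD a b (A B : 'M[C]_(a, b)) : conjmx (A + B) = conjmx A + conjmx B.
Proof. exact: map_mxD. Qed.
Lemma conjmxB a b (A B : 'M[C]_(a, b)) : conjmx (A - B) = conjmx A - conjmx B.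
Proof. exact: map_mxB. Qed.
Lemma conjmxZ a b (x : C) (A : 'M[C]_(a, b)) : conjmx (x *: A) = conjc x *: conjmx A.
Proof. exact: map_mxZ. Qed.
Lemma conjmxT a b (A : 'M[C]_(a, b)) : conjmx A^T = (conjmx A)^T.
Proof. by apply/matrixP => i j; rewrite !mxE. Qed.
Lemma conjmx1 a : conjmx (1%:M : 'M[C]_a) = 1%:M.
Proof. exact: map_mx1. Qed.
Lemma conjmx0 a b : conjmx (0 : 'M[C]_(a, b)) = 0.
Proof. exact: map_mx0. Qed.
Lemma conjmxK a b (A : 'M[C]_(a, b)) : conjmx (conjmx A) = A.
Proof. by apply/matrixP => i j; rewrite !mxE conjcK. Qed.
Lemma conj_cmx a b (A : 'M[R]_(a, b)) : conjmx (cmx A) = cmx A.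
Proof. by apply/matrixP => i j; rewrite !mxE conjc_real. Qed.

Lemma mxtrace_conj a (A : 'M[C]_a) : \tr (conjmx A) = conjc (\tr A).
Proof. by rewrite raddf_sum /mxtrace; apply: eq_bigr => i _; rewrite mxE. Qed.

Lemma trace_adj_sum a b (A : 'M[C]_(a, b)) :
  \tr (A *m (conjmx A)^T) = \sum_i \sum_j `|A i j| ^+ 2.
Proof.
rewrite /mxtrace; apply: eq_bigr => i _; rewrite mxE; apply: eq_bigr => j _.
by rewrite !mxE sqr_normc.
Qed.

Lemma trace_adj_ge0 a b (A : 'M[C]_(a, b)) : 0 <= \tr (A *m (conjmx A)^T).
Proof. by rewrite trace_adj_sum; do 2![apply: sumr_ge0 => ? _]; rewrite exprn_ge0. Qed.

Lemma trace_adj_eq0 a b (A : 'M[C]_(a, b)) : \tr (A *m (conjmx A)^T) <= 0 -> A = 0.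
Proof.
move=> A0; have /eqP : \tr (A *m (conjmx A)^T) = 0.
  by apply/eqP; rewrite eq_le A0 trace_adj_ge0.
rewrite trace_adj_sum psumr_eq0; last first.
  by move=> i _; apply: sumr_ge0 => j _; rewrite exprn_ge0.
move=> /allP A00; apply/matrixP => i j; rewrite mxE.
have := A00 i (mem_index_enum i); rewrite /= psumr_eq0; last by move=> k _; rewrite exprn_ge0.
by move=> /allP /(_ j (mem_index_enum j)) /=; rewrite sqrf_eq0 normr_eq0 => /eqP.
Qed.

Lemma idempotent_factor (F : fieldType) a (A : 'M[F]_a) : A *m A = A ->
  row_base A *m col_base A = 1%:M.
Proof.
move=> AA.
have [B BC] := row_fullP (col_base_full A).
have [D RD] := row_freeP (row_base_free A).
have E : col_base A *m row_base A *m (col_base A *m row_base A) = col_base A *m row_base A.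
  by rewrite !mulmx_base.
move: (col_base A) (row_base A) BC RD E => c r BC RD.
move=> /(congr1 (fun M => B *m M *m D)); rewrite !mulmxA BC mul1mx.
by rewrite -!mulmxA RD mulmx1.
Qed.

(** Over a rank factorization A = C D of an idempotent, D C is the identity. *)
Lemma idempotent_rank (F : fieldType) a (A : 'M[F]_a) : A *m A = A ->
  (\rank A)%:R = \tr A.
Proof.
move=> /idempotent_factor E.
have -> : \tr A = \tr (col_base A *m row_base A) by rewrite mulmx_base.
by rewrite mxtrace_mulC E mxtrace1.
Qed.

(** Gram--Schmidt: U^* U is the orthogonal projection onto the row space. *)
Lemma orthonormal_row_base a b (A : 'M[C]_(a, b)) :
  exists U : 'M[C]_(\rank A, b),
    U *m (conjmx U)^T = 1%:M /\ A = A *m ((conjmx U)^T *m U).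
Proof.
pose U := spectral.schmidt (row_base A).
have /spectral.unitarymxP UU : U \is spectral.unitarymx.
  by apply: spectral.schmidt_unitarymx; exact: rank_leq_col.
have UE : (conjmx U)^T = map_mx Num.conj U^T.
  by apply/matrixP => i j; rewrite !mxE.
exists U; rewrite UE; split=> //.
have : (A <= U)%MS by rewrite spectral.eqmx_schmidt_free ?row_base_free // eq_row_base.
move=> /submxP[D AD].
have : D *m U = D *m U *m (map_mx Num.conj U^T *m U).
  by rewrite -mulmxA (mulmxA U) UU mul1mx.
by rewrite -AD.
Qed.

(** Equality case of an inequality: with Pi the orthogonal projection onto the
    row space, of rank r <= l, the hypothesis makes X a contraction and
    |X - Pi|^2 = |X|^2 - 2 Re tr X + r <= 2 r - 2 l <= 0 in Hilbert--Schmidt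
    norm, so that X = Pi. The identity expressing that X is a contraction is the
    zeroth Fourier coefficient of unitarity of a loop with three terms. *)
Lemma contraction_trace_rigidity a l (X Y Z : 'M[C]_a) :
  (conjmx X)^T *m X + (conjmx Y)^T *m Y + (conjmx Z)^T *m Z = 1%:M ->
  (\rank X <= l)%N -> \tr X + conjc (\tr X) = (2 * l)%:R ->
  (conjmx X)^T = X /\ X *m X = X.
Proof.
move=> XYZ rX tX.
have [U [UU XU]] := orthonormal_row_base X.
set Us := (conjmx U)^T in UU XU; set Pi := Us *m U in XU.
have PiPi : Pi *m Pi = Pi by rewrite /Pi -mulmxA (mulmxA U) UU mul1mx.
have cUs : conjmx Us = U^T by rewrite /Us conjmxT conjmxK.
have PiH : (conjmx Pi)^T = Pi by rewrite /Pi conjmxM trmx_mul -/Us cUs trmxK.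
suff XPi : X = Pi by rewrite XPi.
apply/eqP; rewrite -subr_eq0; apply/eqP; apply: trace_adj_eq0.
pose Xs := (conjmx X)^T.
have cX M : (conjmx (M : 'M[C]_a) : 'M[C]_a)^T = (conjmx M)^T by [].
rewrite conjmxB linearB /= PiH -/Xs mulmxBl !mulmxBr PiPi.
have PiX : Pi *m Xs = Xs.
  by rewrite /Xs -{1}PiH -trmx_mul -conjmxM -XU.
rewrite -XU PiX.
rewrite [\tr _]raddfB /= [\tr (X *m Xs - X)]raddfB [\tr (Xs - Pi)]raddfB /=.
have tXs : \tr Xs = conjc (\tr X) by rewrite mxtrace_tr mxtrace_conj.
have tPi : \tr Pi = (\rank X)%:R by rewrite mxtrace_mulC UU mxtrace1.
rewrite tXs tPi.
have le1 : \tr (X *m Xs) <= (\rank X)%:R.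
  have -> : \tr (X *m Xs) = \tr (U *m (Xs *m X) *m Us).
    rewrite [RHS]mxtrace_mulC.
    have -> : Us *m (U *m (Xs *m X)) = Pi *m Xs *m X by rewrite !mulmxA.
    by rewrite PiX mxtrace_mulC.
  have -> : Xs *m X = 1%:M - (conjmx Y)^T *m Y - (conjmx Z)^T *m Z.
    by rewrite -XYZ -/Xs addrAC !addrK.
  rewrite !mulmxBr !mulmxBl !raddfB /= mulmx1 UU mxtrace1.
  have pos (M : 'M[C]_a) : 0 <= \tr (U *m ((conjmx M)^T *m M) *m Us).
    rewrite (_ : U *m _ *m Us = (U *m (conjmx M)^T) *m (conjmx (U *m (conjmx M)^T))^T).
      exact: trace_adj_ge0.
    by rewrite conjmxM conjmxT conjmxK trmx_mul trmxK -/Us !mulmxA.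
  by rewrite -addrA -opprD gerDl oppr_le0 addr_ge0.
have le2 : (\rank X)%:R <= l%:R :> C by rewrite ler_nat.
have -> : \tr (X *m Xs) - \tr X - (conjc (\tr X) - (\rank X)%:R)
  = \tr (X *m Xs) + (\rank X)%:R - (\tr X + conjc (\tr X)) by ring.
rewrite tX subr_le0 natrM mulr_natl mulr2n.
by apply: lerD => //; exact: le_trans le1 le2.
Qed.

(** P, Q and conj P are the Fourier coefficients of a real orthogonal loop, S is
    the involution that twists it, and s S is its value at -1. The sum rules give
    2 (X + conj X) = S - s for X = P S, so Re tr X = l, while X is a contraction of
    rank at most l: hence X is an orthogonal projection. The symmetry
    X s = - S X then becomes X S + S X = 2 X, which forces S X = X, and P = X. *)
Lemma symmetric_loop_rigidity a l (P Q S s : 'M[C]_a) :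
  conjmx S = S -> S^T = S -> S *m S = 1%:M -> s *m s = 1%:M ->
  P + Q + conjmx P = 1%:M -> Q - P - conjmx P = s *m S ->
  P *m P^T = 0 ->
  (conjmx P)^T *m P + (conjmx Q)^T *m Q + P^T *m conjmx P = 1%:M ->
  P = - (S *m P *m (S *m (s *m S))) ->
  (\rank P <= l)%N -> \tr S - \tr s = (4 * l)%:R ->
  [/\ (conjmx P)^T = P, P *m P = P, S *m P = P, P *m conjmx P = 0 &
      s = S - 2 *: (P + conjmx P)].
Proof.
move=> cS tS SS ss sum1 sumN PPt cons; rewrite !mulmxA => sym rP trS.
pose X := P *m S; pose Xc := conjmx P *m S.
have cX : conjmx X = Xc by rewrite conjmxM cS.
have XXc : 2 *: (X + Xc) = S - s.
  have H1 : S = X + Q *m S + Xc by rewrite -!mulmxDl sum1 mul1mx.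
  have H2 : s = Q *m S - X - Xc by rewrite -!mulmxBl sumN -mulmxA SS mulmx1.
  have G (A B D : 'M[C]_a) : 2 *: (A + D) = A + B + D - (B - A - D).
    by apply/matrixP => i j; rewrite !mxE; ring.
  by rewrite (G X (Q *m S) Xc) -H1 -H2.
have trX : \tr X + conjc (\tr X) = (2 * l)%:R.
  rewrite -mxtrace_conj cX -raddfD /=; apply: (@mulfI _ 2); first by rewrite pnatr_eq0.
  by rewrite -mxtraceZ XXc raddfB /= trS -natrM mulnA.
have [XH XX] : (conjmx X)^T = X /\ X *m X = X.
  apply: (@contraction_trace_rigidity a l X (Q *m S) Xc) => //; last first.
    exact: leq_trans (mxrankM_maxl _ _) rP.
  rewrite /Xc /X !conjmxM cS conjmxK !trmx_mul tS.
  have E (A B : 'M[C]_a) : S *m A *m (B *m S) = S *m (A *m B) *m S by rewrite !mulmxA.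
  by rewrite !E -!mulmxDl -!mulmxDr cons mulmx1 SS.
have XXc0 : X *m Xc = 0.
  have -> : Xc = X^T by rewrite -XH trmxK cX.
  by rewrite /X trmx_mul tS -mulmxA (mulmxA S) SS mul1mx PPt.
have sE : s = S - 2 *: (X + Xc) by rewrite XXc opprB addrC subrK.
have Xs : X *m s = - (S *m X).
  rewrite {1}/X {1}sym !mulNmx; congr (- _).
  by rewrite -(mulmxA _ S S) SS mulmx1 -(mulmxA _ s s) ss mulmx1 -mulmxA.
have comm : X *m S + S *m X = 2 *: X.
  have := Xs; rewrite sE mulmxBr -scalemxAr mulmxDr XX XXc0 addr0 => /eqP.
  by rewrite subr_eq addrC -subr_eq opprK => /eqP.
have L := congr1 (fun M => X *m M) comm; have Rr := congr1 (fun M => M *m X) comm.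
rewrite /= mulmxDr mulmxA XX -scalemxAr XX mulmxA in L.
rewrite /= mulmxDl -[S *m X *m X]mulmxA XX -scalemxAl XX in Rr.
have XS : X *m S = S *m X.
  have := L; rewrite -Rr addrC => /addrI; done.
have SX : S *m X = X.
  have := comm; rewrite XS -mulr2n -scaler_nat => /(scalerI _); apply.
  by rewrite pnatr_eq0.
have PX : P = X by rewrite -[P]mulmx1 -SS mulmxA -/X XS SX.
have PcXc : conjmx P = Xc by rewrite -cX -PX.
by move: XH; rewrite cX => XH; split; rewrite ?PcXc ?PX.
Qed.

End MatrixAlgebra.

(** * Lie-theoretic data *)

Section LieAlgebra.
Context {R : realType} {n : nat}.
Local Notation C := R[i].
Variable l : nat.
Hypothesis l_range : (1 <= l <= n.-1)%N.

Local Lemma n_gt0 : (0 < n)%N.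
Proof. by case/andP: l_range => l1 /(leq_trans l1) n1; rewrite (leq_trans n1) ?leq_pred. Qed.
Local Lemma l_le_n : (l <= n)%N.
Proof. by case/andP: l_range => _ h; rewrite (leq_trans h) // leq_pred. Qed.

(** The orthogonal projection onto the first l coordinate planes, on which
    zeta l is a complex structure. *)
Definition zproj : 'M[R]_(n + n) := block_mx (pid_mx l) 0 0 (pid_mx l).

Lemma zetaE : zeta l = block_mx 0 (- pid_mx l) (pid_mx l) 0 :> 'M[R]_(n + n).
Proof.
have key (i j : 'I_n) : \sum_(k < n | (k < l)%N) ((i == k) && (j == k))%:R =
    (pid_mx l : 'M[R]_n) i j.
  rewrite mxE; have [<-|ij] := eqVneq i j; last first.
    rewrite big1 => [|k _]; first by rewrite (_ : (i == j :> nat) = false) //; apply/negbTE.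
    by have [<-|//] := eqVneq i k; rewrite eq_sym (negbTE ij).
  have [il|il] := boolP (i < l)%N.
    rewrite (bigD1 i) //= !eqxx big1 ?addr0 // => k /andP[_ ki].
    by rewrite eq_sym (negbTE ki).
  rewrite big1 ?andbF // => k kl; have [ik|//] := eqVneq i k.
  by rewrite ik kl in il.
rewrite /zeta; apply/matrixP => i j; rewrite summxE.
rewrite -(fintype.splitK i) -(fintype.splitK j); case: (fintype.split i) => i'; case: (fintype.split j) => j' /=.
- rewrite block_mxEul mxE big1 // => k _.
  by rewrite !mxE !eq_lrshift !eq_lshift !andbF /= subr0.
- rewrite block_mxEur mxE -key -sumrN; apply: eq_bigr => k _.
  by rewrite !mxE !eq_lrshift ?eq_rlshift !eq_lshift !eq_rshift /= sub0r.
- rewrite block_mxEdl -key; apply: eq_bigr => k _.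
  by rewrite !mxE ?eq_lrshift ?eq_rlshift !eq_lshift !eq_rshift /= subr0.
- rewrite block_mxEdr mxE big1 // => k _.
  by rewrite !mxE ?eq_lrshift ?eq_rlshift /= ?andbF subr0.
Qed.

Let pidpid : (pid_mx l : 'M[R]_n) *m (pid_mx l : 'M[R]_n) = pid_mx l.
Proof. by rewrite pid_mx_id // l_le_n. Qed.

Lemma zproj_id : zproj *m zproj = zproj.
Proof. by rewrite mulmx_block !mul0mx !mulmx0 !addr0 !add0r pidpid. Qed.

Lemma zeta_zproj : zeta l *m zproj = zeta l.
Proof. by rewrite zetaE mulmx_block !mul0mx !mulmx0 !addr0 !add0r mulNmx pidpid. Qed.

Lemma zproj_zeta : zproj *m zeta l = zeta l.
Proof. by rewrite zetaE mulmx_block !mul0mx !mulmx0 !addr0 !add0r mulmxN pidpid. Qed.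

Lemma zeta_sq : zeta l *m zeta l = - zproj.
Proof.
rewrite zetaE mulmx_block !mul0mx !mulmx0 !addr0 !add0r mulmxN mulNmx pidpid.
by rewrite opp_block_mx !oppr0.
Qed.

Lemma zprojT : zproj^T = zproj.
Proof. by rewrite tr_block_mx !trmx0 !tr_pid_mx. Qed.

Lemma trace_pid : \tr (pid_mx l : 'M[R]_n) = l%:R.
Proof.
rewrite -idempotent_rank ?pidpid // rank_pid_mx //; exact: l_le_n.
Qed.

Lemma trace_zproj : \tr zproj = (2 * l)%:R.
Proof. by rewrite mxtrace_block trace_pid -natrD addnn -mul2n. Qed.

Lemma trace_zeta : \tr (zeta l : 'M[R]_(n + n)) = 0.
Proof. by rewrite zetaE mxtrace_block mxtrace0 addr0. Qed.

(** On the range of zproj, zeta squares to -1, so its powers are those of the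
    imaginary unit: the three coefficients are a Kronecker delta and the
    coefficients of the cosine and sine series. *)
Lemma zeta_expr (t : R) k : (t *: zeta l) ^+ k =
  (k == 0%N)%:R *: (1%:M - zproj) + ((~~ odd k)%:R * (-1) ^+ k./2 * t ^+ k) *: zproj
  + ((odd k)%:R * (-1) ^+ k.-1./2 * t ^+ k) *: zeta l.
Proof.
elim: k => [|k IH].
  by rewrite /= !(mulr0n, mulr1n, expr0, mul0r, mul1r, scale0r, scale1r) addr0 subrK.
rewrite exprS IH -!mulmxE !mulmxDr -!scalemxAl -!scalemxAr mulmxBr mulmx1.
rewrite zeta_zproj subrr scaler0 scaler0 add0r zeta_sq scalerN /=.
rewrite scale0r add0r negbK {IH}; case: (boolP (odd k)) => /= ok.
  rewrite !(mulr0n, mulr1n, mul0r, scale0r, scaler0, add0r, addr0, mul1r).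
  case: k ok => //= k ok; rewrite -scaleNr scalerA.
  by congr (_ *: _); rewrite !exprS; ring.
rewrite !(mulr0n, mulr1n, mul0r, scale0r, scaler0, oppr0, add0r, addr0, mul1r).
by rewrite scalerA exprS; congr (_ *: _); ring.
Qed.

Lemma expmx_zeta (t : R) :
  expmx (t *: zeta l) = 1%:M - zproj + cos t *: zproj + sin t *: zeta l :> 'M[R]_(n + n).
Proof.
apply/matrixP => i j; rewrite /expmx mxE.
set d := (1%:M - zproj) i j.
pose dl (k : nat) : R := (k == 0%N)%:R * d.
have E : (fun k : nat => ((t *: zeta l) ^+ k) i j / k`!%:R) =
    (fun k => dl k + (zproj i j * cos_coeff t k + zeta l i j * sin_coeff t k)).
  apply/funext => k; rewrite zeta_expr !mxE /cos_coeff /sin_coeff /dl /d !mxE /=.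
  rewrite !mulrDl addrA; congr (_ + _ + _).
  - by case: k => [|k] /=; rewrite ?fact0 ?divr1 ?mul0r.
  - by rewrite mulrAC mulrC !mulrA.
  - by rewrite mulrAC mulrC !mulrA.
rewrite E; apply: cvg_lim => //.
have cd : series dl @ \oo --> d.
  apply/cvg_ballP => e e0; near=> k.
  have k0 : (0 < k)%N by near: k; exists 1%N.
  rewrite /series /= -(prednK k0) big_nat_recl //= /dl /= mul1r big1 ?addr0.
    exact: ballxx.
  by move=> m _; rewrite mul0r.
have cc : series (cos_coeff t) @ \oo --> cos t.
  by rewrite cos.unlock; exact: is_cvg_series_cos_coeff.
have cs : series (sin_coeff t) @ \oo --> sin t.
  by rewrite sin.unlock; exact: is_cvg_series_sin_coeff.
rewrite (_ : series _ = fun k => series dl k + (zproj i j * series (cos_coeff t) k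
   + zeta l i j * series (sin_coeff t) k)); last first.
  apply/funext => k; rewrite /series /= !big_split /= -!mulr_sumr.
  by [].
rewrite [X in _ --> X](_ : _ = d + (zproj i j * cos t + zeta l i j * sin t)).
  by apply: cvgD => //; apply: cvgD; apply: cvgM => //; exact: cvg_cst.
by rewrite !mxE /d !mxE addrA; congr (_ + _ + _); rewrite mulrC.
Unshelve. all: by end_near. Qed.

Lemma exp_pi_zetaE : exp_pi_zeta l = 1%:M - 2 *: zproj :> 'M[R]_(n + n).
Proof.
rewrite /exp_pi_zeta expmx_zeta cospi sinpi scale0r addr0 scaleN1r.
by rewrite -addrA -opprD -mulr2n scaler_nat.
Qed.

(** The extension of lambda gamma_zeta(lambda) to all lambda: cos and sin are
    written by lambda and its inverse on the circle. *)
Definition lamgamma (lam : C) : 'M[C]_(n + n) :=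
  lam *: cmx (1%:M - zproj) + (2^-1 * (lam ^+ 2 + 1)) *: cmx zproj
  + (2^-1 * (lam ^+ 2 - 1) * - ci) *: cmx (zeta l).

Lemma cmxD a b (A B : 'M[R]_(a, b)) : cmx (A + B) = cmx A + cmx B.
Proof. exact: map_mxD. Qed.
Lemma cmxB a b (A B : 'M[R]_(a, b)) : cmx (A - B) = cmx A - cmx B.
Proof. exact: map_mxB. Qed.
Lemma cmxN a b (A : 'M[R]_(a, b)) : cmx (- A) = - cmx A.
Proof. exact: map_mxN. Qed.
Lemma cmxZ a b x (A : 'M[R]_(a, b)) : cmx (x *: A) = x%:C%C *: cmx A.
Proof. exact: map_mxZ. Qed.
Lemma cmxM a b c (A : 'M[R]_(a, b)) (B : 'M[R]_(b, c)) : cmx (A *m B) = cmx A *m cmx B.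
Proof. exact: map_mxM. Qed.
Lemma cmxT a b (A : 'M[R]_(a, b)) : cmx A^T = (cmx A)^T.
Proof. by apply/matrixP => i j; rewrite !mxE. Qed.
Lemma cmx1 a : cmx (1%:M : 'M[R]_a) = 1%:M.
Proof. exact: map_mx1. Qed.
Lemma cmx_inj a b : injective (@cmx R a b).
Proof. by move=> A B /matrixP AB; apply/matrixP => i j; have := AB i j; rewrite !mxE => -[]. Qed.

Lemma lamgamma_circ (t : R) :
  circ t *: cmx (expmx (t *: zeta l)) = lamgamma (circ t).
Proof.
have s2 : sin t * sin t = 1 - cos t * cos t by rewrite -!expr2 -(cos2Dsin2 t) addrAC subrr add0r.
have half (x y : C) : 2 * x = y -> x = 2^-1 * y.
  by move=> <-; rewrite mulrA mulVf ?pnatr_eq0 // mul1r.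
have Ec : circ t * (cos t)%:C%C = 2^-1 * (circ t ^+ 2 + 1).
  apply: half; rewrite -[2](rmorph_nat (real_complex R)) /circ expr2; simpc.
  by congr Complex; rewrite ?s2; ring.
have Es : circ t * (sin t)%:C%C = 2^-1 * (circ t ^+ 2 - 1) * - ci.
  rewrite -mulrA; apply: half.
  rewrite -[2](rmorph_nat (real_complex R)) /circ /ci expr2; simpc.
  by congr Complex; rewrite ?s2; ring.
by rewrite expmx_zeta /lamgamma !cmxD !cmxZ !scalerDr !scalerA Ec Es.
Qed.

(** At 0 this is the projection (zproj + i zeta)/2 onto the (-i)-eigenspace
    of zeta, whose trace is l. *)
Lemma lamgamma0_rank : (\rank (lamgamma 0%R) <= l)%N.
Proof.
have E : lamgamma 0 = 2^-1 *: (cmx zproj + ci *: cmx (zeta l)).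
  rewrite /lamgamma scale0r add0r expr0n /= add0r sub0r mulr1 scalerDr scalerA.
  by rewrite mulrN mulrN1 mulNr opprK.
have zz : cmx (zeta l) *m cmx (zeta l) = - cmx zproj.
  by rewrite -cmxM zeta_sq cmxN.
have id0 : lamgamma 0 *m lamgamma 0 = lamgamma 0.
  rewrite E -scalemxAl -scalemxAr mulmxDl !mulmxDr -!scalemxAl -!scalemxAr -!cmxM.
  rewrite zproj_id zproj_zeta zeta_zproj zeta_sq cmxN scalerA ci2 scaleN1r opprK.
  move: (cmx zproj) (ci *: cmx (zeta l)) => A B.
  by apply/matrixP => i j; rewrite !mxE; field.
have := idempotent_rank id0; rewrite {2}E mxtraceZ raddfD /= mxtraceZ.
rewrite /cmx !trace_map_mx trace_zproj trace_zeta rmorph0 mulr0 addr0 rmorph_nat natrM.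
by rewrite mulrA mulVf ?pnatr_eq0 // mul1r => /eqP; rewrite eqr_nat => /eqP ->.
Qed.

Local Notation e := (e_last : 'cV[R]_(n + n)).

Lemma e_last_delta : exists j : 'I_n, j = n.-1 :> nat /\ e = delta_mx (lshift n j) 0.
Proof.
have nn : (n.-1 < n)%N by rewrite prednK // n_gt0.
exists (Ordinal nn); split=> //; apply/matrixP => a b; rewrite !mxE ord1 andbT.
by congr (_%:R); apply/eqP/eqP => [H|->//]; exact/val_inj.
Qed.

Lemma e_last_unit : e^T *m e = 1%:M.
Proof.
have [j [_ ->]] := e_last_delta; rewrite trmx_delta mul_delta_mx.
by apply/matrixP => a b; rewrite !ord1 !mxE.
Qed.

Lemma zproj_e : zproj *m e = 0.
Proof.
have [j [jn ->]] := e_last_delta.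
rewrite -colE; apply/matrixP => a b; rewrite mxE [RHS]mxE /zproj.
rewrite -(fintype.splitK a); case: (fintype.split a) => a' /=.
  rewrite block_mxEul mxE; have [aj|//] := eqVneq (a' : nat) j.
  rewrite aj jn; case/andP: l_range => _; rewrite leqNgt => /negbTE ->; by [].
by rewrite block_mxEdl mxE.
Qed.

Lemma eT_zproj : e^T *m zproj = 0.
Proof. by rewrite -[zproj]zprojT -trmx_mul zproj_e trmx0. Qed.

(** The projection onto the fixed space of the involution below; its image
    becomes, after an isometry, the constant subspace of dimension 2l + 1. *)
Definition fix_proj : 'M[R]_(n + n) := e *m e^T + zproj.
(** The involution exp(pi zeta) s_0, by which sigma_(rho,l) is conjugation. *)
Definition twist_mx : 'M[R]_(n + n) := 2 *: fix_proj - 1%:M.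

Let J : 'M[R]_(n + n) := exp_pi_zeta l.

Lemma eeT_id : (e *m e^T) *m (e *m e^T) = e *m e^T.
Proof. by rewrite mulmxA -(mulmxA e) e_last_unit mulmx1. Qed.

Lemma fix_proj_id : fix_proj *m fix_proj = fix_proj.
Proof.
rewrite mulmxDl !mulmxDr eeT_id zproj_id -(mulmxA e) eT_zproj mulmx0.
by rewrite (mulmxA zproj) zproj_e mul0mx addr0 add0r.
Qed.

Lemma fix_projT : fix_proj^T = fix_proj.
Proof. by rewrite linearD /= zprojT trmx_mul trmxK. Qed.

Lemma trace_fix_proj : \tr fix_proj = (2 * l + 1)%:R.
Proof.
by rewrite raddfD /= trace_zproj mxtrace_mulC e_last_unit mxtrace1 -natrD addnC.
Qed.

Lemma reflection_sq (A : 'M[R]_(n + n)) : A *m A = A ->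
  (2 *: A - 1%:M) *m (2 *: A - 1%:M) = 1%:M.
Proof.
move=> AA; rewrite mulmxBl !mulmxBr -!scalemxAl -!scalemxAr AA !mulmx1 mul1mx.
by apply/matrixP => i j; rewrite !mxE; ring.
Qed.

Lemma twist_mx_sq : twist_mx *m twist_mx = 1%:M.
Proof. exact/reflection_sq/fix_proj_id. Qed.

Lemma twist_mxT : twist_mx^T = twist_mx.
Proof. by rewrite /twist_mx linearB /= linearZ /= fix_projT trmx1. Qed.

Lemma trace_twist_mx : \tr twist_mx = (4 * l)%:R + 2 - (n + n)%:R.
Proof.
rewrite /twist_mx raddfB /= mxtraceZ trace_fix_proj mxtrace1 -natrM mulnDr mulnA natrD.
by rewrite muln1.
Qed.

Lemma s0E : s0 = 2 *: (e *m e^T) - 1%:M.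
Proof. by rewrite /s0 /piV0 opprB addrA -mulr2n scaler_nat. Qed.

Lemma s0s0 : s0 *m s0 = 1%:M :> 'M[R]_(n + n).
Proof. by rewrite s0E; exact/reflection_sq/eeT_id. Qed.

Lemma exp_pi_zeta_reflection : J = - (2 *: zproj - 1%:M).
Proof. by rewrite /J exp_pi_zetaE opprB. Qed.

Lemma exp_pi_zeta_sq : J *m J = 1%:M.
Proof. by rewrite exp_pi_zeta_reflection mulNmx mulmxN opprK; exact/reflection_sq/zproj_id. Qed.

Lemma exp_pi_zetaT : J^T = J.
Proof. by rewrite exp_pi_zeta_reflection linearN /= linearB /= linearZ /= zprojT trmx1. Qed.

Lemma exp_pi_zeta_s0 : J *m s0 = twist_mx.
Proof.
rewrite exp_pi_zeta_reflection s0E mulNmx mulmxBl !mulmxBr -scalemxAl -!scalemxAr (mulmxA zproj) zproj_e mul0mx.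
rewrite !mulmx1 mul1mx /twist_mx /fix_proj; move: (e *m e^T) zproj => A B.
by apply/matrixP => i j; rewrite !mxE; ring.
Qed.

Lemma s0_exp_pi_zeta : s0 *m J = twist_mx.
Proof.
rewrite exp_pi_zeta_reflection s0E mulmxN mulmxBl !mulmxBr -scalemxAl -!scalemxAr -(mulmxA e) eT_zproj mulmx0.
rewrite !mulmx1 mul1mx /twist_mx /fix_proj; move: (e *m e^T) zproj => A B.
by apply/matrixP => i j; rewrite !mxE; ring.
Qed.

Lemma involution_inv k (A : 'M[R]_k) : A *m A = 1%:M -> invmx A = A.
Proof.
move=> AA; have [uA _] := mulmx1_unit AA.
by rewrite -[LHS]mulmx1 -AA mulmxA mulVmx // mul1mx.
Qed.

Lemma sigma_rho_lE (g : 'M[R]_(n + n)) : sigma_rho_l l g = twist_mx *m g *m twist_mx.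
Proof.
rewrite /sigma_rho_l /sigma_rho (involution_inv s0s0) -/J (involution_inv exp_pi_zeta_sq).
by rewrite -{1}exp_pi_zeta_s0 -s0_exp_pi_zeta !mulmxA.
Qed.

Lemma SO_inv (g : 'M[R]_(n + n)) : SO g -> g^T *m g = 1%:M /\ invmx g = g^T.
Proof.
move=> [gg _]; have [ug _] := mulmx1_unit gg; split.
  exact: mulmx1C.
by rewrite -[LHS]mulmx1 -gg mulmxA mulVmx // mul1mx.
Qed.

Lemma mxactE (g : 'M[R]_(n + n)) (v : 'cV[R]_(n + n)) : mxact g <[v]> = <[g *m v]>%VS.
Proof. by rewrite /mxact limg_line lfunE. Qed.

(** The Cartan embedding sends the line of v to exp(pi zeta) s_v s_0, where s_v
    is the reflection fixing v. Multiplication by twist_mx leaves the conjugate of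
    s_v by exp(pi zeta), the reflection fixing exp(pi zeta) v. *)
Lemma identifiedE (V : {vspace 'cV[R]_(n + n)}) (M : 'M[R]_(n + n)) : identified l V M ->
  exists v : 'cV[R]_(n + n), [/\ v^T *m v = 1%:M, V = <[v]>%VS &
    M *m twist_mx = 2 *: ((J *m v) *m (J *m v)^T) - 1%:M].
Proof.
move=> [g [gSO -> ->]]; have [gTg gi] := SO_inv gSO.
have [ggT _] := gSO.
exists (g *m e); split.
- by rewrite trmx_mul mulmxA -(mulmxA e^T) gTg mulmx1 e_last_unit.
- by rewrite /V0 mxactE.
rewrite gi /sigma_rho (involution_inv s0s0) -s0_exp_pi_zeta -/J.
have E1 : s0 *m g^T *m s0 *m (s0 *m J) = s0 *m g^T *m J.
  by rewrite mulmxA -(mulmxA _ s0 s0) s0s0 mulmx1.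
rewrite -(mulmxA (J *m g)) E1 s0E mulmxBl mul1mx mulmxBl mulmxBr.
rewrite -!scalemxAl -scalemxAr !trmx_mul exp_pi_zetaT !mulmxA; congr (_ - _).
by rewrite -(mulmxA J) ggT mulmx1 exp_pi_zeta_sq.
Qed.

End LieAlgebra.

(** The parameter is acos x up to sign. *)
Lemma circle_circ {R : realType} (x y : R) : x ^+ 2 + y ^+ 2 = 1 ->
  exists t : R, Complex x y = circ t.
Proof.
move=> xy; have x1 : -1 <= x <= 1.
  by rewrite -ler_norml -(expr_le1 (n := 2)) // real_normK ?num_real // -xy lerDl sqr_ge0.
have cx : cos (acos x) = x by apply: acosK; rewrite in_itv.
have sx : sin (acos x) ^+ 2 = y ^+ 2 by rewrite sin2cos2 cx -xy addrC addKr.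
move/eqP: sx; rewrite eqf_sqr => /orP[] /eqP sx.
  by exists (acos x); rewrite /circ cx sx.
by exists (- acos x); rewrite /circ cosN sinN cx sx opprK.
Qed.

(** * Fourier coefficients of loops in U_zeta *)

Section LoopFourier.
Context {R : realType} {n : nat}.
Local Notation C := R[i].
Local Notation plane := 'rV[R]_2.

Definition zpoint (lam : C) : plane := \row_(j < 2) [:: complex.Re lam; complex.Im lam]`_j.

Lemma zpointK lam : zcoord (zpoint lam) = lam.
Proof. by rewrite /zcoord !mxE /=; case: lam. Qed.

Lemma norm_circ (t : R) : `|circ t| = 1 :> C.
Proof. by rewrite normc_def /= cos2Dsin2 sqrtr1. Qed.

Lemma unit_circ (lam : C) : `|lam| = 1 -> exists t, lam = circ t.
Proof.
move=> l1; have [|t E] := @circle_circ R (complex.Re lam) (complex.Im lam).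
  have /sq_norm_norm : `|zcoord (zpoint lam)| = 1 by rewrite zpointK.
  by rewrite /sq_norm !mxE.
by exists t; rewrite -E; case: lam {l1 E}.
Qed.

Lemma unit_neq0 (lam : C) : `|lam| = 1 -> lam != 0.
Proof. by move=> l1; rewrite -normr_gt0 l1 ltr01. Qed.

Lemma unit_conjV (lam : C) : `|lam| = 1 -> conjc lam = lam^-1.
Proof. by move=> l1; rewrite invc_norm l1 expr1n invr1 mul1r. Qed.

(** Reality makes Q self-reciprocal: if d > 2 is the degree of Q, then
    z^(d-2) Q(z) and z^d conj(Q(1/conj z)) are polynomials that agree on the
    circle, but only the first vanishes at 0. *)
Lemma real_multiple_quadratic (Q : {poly C}) :
  (forall lam : C, `|lam| = 1 -> exists x : R, Q.[lam] = lam * x%:C%C) ->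
  (size Q <= 3)%N.
Proof.
move=> QR; rewrite leqNgt; apply/negP => Q3.
pose d := (size Q).-1; have dE : size Q = d.+1 by rewrite /d prednK // (leq_trans _ Q3).
have d2 : (2 < d)%N by rewrite -ltnS -dE.
pose V : {poly C} := \sum_(k < d.+1) (conjc Q`_k) *: 'X^(d - k).
have EQ : 'X^(d - 2) * Q - V = 0.
  apply: poly_eq0_on_circle => lam l1; have l0 := unit_neq0 l1.
  have [x Qx] := QR _ l1.
  have cQ : conjc Q.[lam] = lam^-1 * x%:C%C.
    rewrite Qx rmorphM; congr (_ * _); first exact: unit_conjV.
    exact: conjc_real.
  have -> : V = \sum_(k < d.+1) (conjc Q`_k) *: 'X^(d - k) by [].
  rewrite hornerD hornerN hornerM hornerXn horner_sum Qx.
  apply/eqP; rewrite subr_eq0; apply/eqP.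
  have -> : lam ^+ (d - 2) * (lam * x%:C%C) = lam ^+ d * conjc Q.[lam].
    rewrite cQ -{2}(subnK (ltnW d2)) exprD expr2; field; exact: l0.
  rewrite horner_coef dE rmorph_sum mulr_sumr; apply: eq_bigr => k _ /=.
  have -> : conjc (Q`_k * lam ^+ k) = conjc Q`_k * lam^-1 ^+ k.
    by rewrite rmorphM rmorphXn; congr (_ * _ ^+ _); exact: unit_conjV.
  rewrite hornerZ hornerXn mulrCA; congr (_ * _).
  by rewrite exprVn -{1}(subnK (ltn_ord k : (k <= d)%N)) exprD mulfK // expf_neq0.
have := congr1 (fun p : {poly C} => p.[0]) EQ.
rewrite hornerD hornerN hornerM hornerXn expr0n subn_eq0 leqNgt d2 mul0r horner0 add0r.
rewrite /V horner_sum big_ord_recr /= subnn big1 => [|k _]; last first.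
  by rewrite hornerZ hornerXn expr0n subn_eq0 leqNgt ltn_ord mulr0.
rewrite add0r hornerZ hornerXn expr0 mulr1 => /eqP; rewrite oppr_eq0 conjc_eq0.
have -> : Q`_d = lead_coef Q by rewrite lead_coefE.
by rewrite lead_coef_eq0 -size_poly_eq0 dE.
Qed.

Lemma extension_disc_algebra (F : C -> 'M[C]_(n + n)) i j :
  (forall i j,
        {within [set p : 'rV[R]_2 | p 0 0 ^+ 2 + p 0 1 ^+ 2 <= 1],
          continuous (fun p => complex.Re (F (zcoord p) i j))} /\
        {within [set p : 'rV[R]_2 | p 0 0 ^+ 2 + p 0 1 ^+ 2 <= 1],
          continuous (fun p => complex.Im (F (zcoord p) i j))}) ->
  holomorphic_on [set p : 'rV[R]_2 | p 0 0 ^+ 2 + p 0 1 ^+ 2 < 1]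
        (fun p => F (zcoord p)) ->
  disc_algebra (fun p => F (zcoord p) i j).
Proof.
move=> cF [/mxcsmoothP sF dF]; have [cr ci'] := cF i j; split=> //.
move=> p op; have := dF p op; rewrite mx_dzbarE => /matrixP/(_ i j).
by rewrite !mxE.
Qed.

Variable l : nat.
Hypothesis l_range : (1 <= l <= n.-1)%N.

Lemma lamgamma_disc_algebra i j : disc_algebra (fun p => @lamgamma R n l (zcoord p) i j).
Proof.
under eq_fun do rewrite !mxE.
have hz := @disc_algebra_z R.
have hX := disc_algebraX 2 hz.
have hc := @disc_algebra_cst R.
apply: disc_algebraD; first apply: disc_algebraD.
- exact: (disc_algebraM hz).
- apply: disc_algebraM => //; apply: disc_algebraZ; exact: disc_algebraD.
- apply: disc_algebraM => //; apply: disc_algebraM => //; apply: disc_algebraZ.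
  exact: disc_algebraD.
Qed.

Lemma mulmx_disc_algebra (F G : C -> 'M[C]_(n + n)) :
  (forall i j, disc_algebra (fun p => F (zcoord p) i j)) ->
  (forall i j, disc_algebra (fun p => G (zcoord p) i j)) ->
  forall i j, disc_algebra (fun p => (F (zcoord p) *m G (zcoord p)) i j).
Proof.
move=> hF hG i j; under eq_fun do rewrite mxE.
by apply: disc_algebra_sum => k; apply: disc_algebraM.
Qed.

(** In h gamma = g g_+ all of h, lambda gamma and g_+ are holomorphic in the
    disc and g_+ is inverse to its transpose, so lambda g extends to the disc as
    h (lambda gamma) g_+^T. Being a Laurent polynomial it is a polynomial, of
    degree at most 2 because g is real, and its value at 0 has at most the rank
    of the value of lambda gamma. *)
Lemma loop_fourier (g : C -> 'M[R]_(n + n)) : OmegaAlgG g -> U_zeta l g ->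
  exists P0 P1 P2 : 'M[C]_(n + n), (\rank P0 <= l)%N /\
    forall lam, `|lam| = 1 -> cmx (g lam) = lam^-1 *: P0 + P1 + lam *: P2.
Proof.
move=> [_ [r [m [A gA]]]] [_ [h [gp [[[_ _ [H [Hh HSO cH hH]]] _] [gpSO _ [G [Ggp _ cG hG]]] fact]]]].
pose F lam := H lam *m lamgamma l lam *m (G lam)^T.
have hF i j : disc_algebra (fun p => F (zcoord p) i j).
  apply: (@mulmx_disc_algebra (fun lam => H lam *m lamgamma l lam) (fun lam => (G lam)^T)).
    apply: mulmx_disc_algebra => a b; first exact: extension_disc_algebra.
    exact: lamgamma_disc_algebra.
  move=> a b; under eq_fun do rewrite mxE; exact: extension_disc_algebra.
have Fg lam : `|lam| = 1 -> F lam = lam *: cmx (g lam).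
  move=> l1; have [t lt] := unit_circ l1.
  rewrite /F Hh // Ggp // lt -(lamgamma_circ l_range) -scalemxAr -scalemxAl fact.
  have [gg _] := gpSO _ (norm_circ t).
  by rewrite -mulmxA gg mulmx1.
have /choice[q qE] : forall ij : 'I_(n + n) * 'I_(n + n), exists Q : {poly C},
    forall p : plane, cdisc p -> F (zcoord p) ij.1 ij.2 = Q.[zcoord p].
  move=> [i j]; apply: (@disc_algebra_laurent R _ (r + 1) m (fun k => A k i j)) => // p /sq_norm_norm p1.
  have z0 := unit_neq0 p1.
  rewrite Fg // gA // mxE /laurent summxE mulr_sumr; apply: eq_bigr => k _.
  by rewrite mxE mulrA -[X in X * _ * _]expr1z -expfzDr // addrA [1 + r]addrC.
have qlam lam i j : `|lam| <= 1 -> F lam i j = (q (i, j)).[lam].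
  by rewrite -{1 2 3}(zpointK lam) => /cdisc_norm /(qE (i, j)).
have q3 ij : (size (q ij) <= 3)%N.
  apply: real_multiple_quadratic => lam l1; exists (g lam ij.1 ij.2).
  by case: ij => i j; rewrite -qlam ?l1 // Fg // !mxE.
exists (\matrix_(i, j) (q (i, j))`_0), (\matrix_(i, j) (q (i, j))`_1), (\matrix_(i, j) (q (i, j))`_2).
split=> [|lam l1].
  rewrite (_ : \matrix_(i, j) _ = F 0).
    apply: leq_trans (mxrankM_maxl _ _) _; apply: leq_trans (mxrankM_maxr _ _) _.
    exact: lamgamma0_rank.
  by apply/matrixP => i j; rewrite mxE qlam ?normr0 // horner_coef0.
have l0 := unit_neq0 l1.
apply: (scalerI l0); rewrite -Fg //; apply/matrixP => i j.
rewrite qlam ?l1 // (horner_coef_wide _ (q3 _)) !big_ord_recl big_ord0 !mxE /=.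
rewrite /bump /= expr0 expr1 mulr1 addr0; field; exact: l0.
Qed.

(** The coefficient of 1/lambda when g has only the powers -1, 0 and 1: the
    average of lambda g(lambda) over the fourth roots of unity, for g(1) = 1. The
    formula makes sense for every loop and depends smoothly on its values. *)
Definition polar_coef (g : C -> 'M[R]_(n + n)) : 'M[C]_(n + n) :=
  4^-1 *: (cmx (1%:M - g (- 1)) + ci *: cmx (g ci - g (- ci))).

Lemma norm_ci : `|ci| = 1 :> C.
Proof. by rewrite normc_def /= expr0n expr1n add0r sqrtr1. Qed.

Lemma loop_coefs (g : C -> 'M[R]_(n + n)) P0 P1 P2 : g 1 = 1%:M ->
  (forall lam, `|lam| = 1 -> cmx (g lam) = lam^-1 *: P0 + P1 + lam *: P2) ->
  [/\ P0 = polar_coef g, P2 = conjmx (polar_coef g) & P1 = 1%:M - polar_coef g - conjmx (polar_coef g)].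
Proof.
move=> g1 gE.
have inv_ci : ci^-1 = - ci :> C by apply: (mulfI (unit_neq0 norm_ci)); rewrite mulfV ?unit_neq0 ?norm_ci // mulrN ci2 opprK.
have e1 := gE _ (normr1 _); have eN1 := gE (-1); have ei := gE _ norm_ci; have eNi := gE (- ci).
rewrite normrN normr1 in eN1; rewrite normrN norm_ci in eNi.
move: e1 (eN1 erefl) ei (eNi erefl) => {eN1 eNi}; rewrite g1 cmx1 invr1 invrN invr1 !invrN inv_ci.
move=> e1 eN1 ei eNi.
have ce : conjc ci = - ci :> C by rewrite /ci; simpc.
have c4 : conjc 4^-1 = 4^-1 :> C by rewrite conjc_inv conjc_nat.
have cP : conjmx (polar_coef g) = 4^-1 *: (cmx (1%:M - g (- 1)) - ci *: cmx (g ci - g (- ci))).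
  by rewrite /polar_coef conjmxZ conjmxD conjmxZ !conj_cmx ce c4 scaleNr.
have i2 : (ci : C) ^+ 2 = - 1 by rewrite expr2 ci2.
have P0E : P0 = polar_coef g.
  rewrite /polar_coef !cmxB cmx1 e1 eN1 ei eNi; apply/matrixP => i j; rewrite !mxE.
  transitivity (4^-1 * (2 * (1 - ci ^+ 2) * P0 i j + 2 * (1 + ci ^+ 2) * P2 i j)).
    by rewrite i2; field.
  by ring.
have P2E : P2 = conjmx (polar_coef g).
  rewrite cP !cmxB cmx1 e1 eN1 ei eNi; apply/matrixP => i j; rewrite !mxE.
  transitivity (4^-1 * (2 * (1 + ci ^+ 2) * P0 i j + 2 * (1 - ci ^+ 2) * P2 i j)).
    by rewrite i2; field.
  by ring.
split=> //; rewrite -P2E -P0E e1 !scale1r.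
by apply/matrixP => i j; rewrite !mxE; ring.
Qed.

End LoopFourier.

(** * Normal form of a twisted loop *)

Section LoopStructure.
Context {R : realType} {n : nat}.
Local Notation C := R[i].

Lemma quartic_eq0_on_circle a b (c : nat -> 'M[C]_(a, b)) :
  (forall lam : C, `|lam| = 1 -> \sum_(k < 5) lam ^+ k *: c k = 0) ->
  forall k, (k < 5)%N -> c k = 0.
Proof.
move=> H k k5; apply/matrixP => i j; rewrite mxE.
have : \poly_(k < 5) c k i j = 0.
  apply: poly_eq0_on_circle => lam l1; rewrite horner_poly.
  have /matrixP/(_ i j) := H _ l1; rewrite summxE mxE => H0; rewrite -[RHS]H0.
  by apply: eq_bigr => m _; rewrite mxE mulrC.
by move=> /(congr1 (fun p : {poly C} => p`_k)); rewrite coef_poly k5 coef0.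
Qed.

(** The extreme coefficient of g g^T = 1 and the middle one of g^T g = 1. *)
Lemma orthogonal_loop_coefs (g : C -> 'M[R]_(n + n)) (P Q : 'M[C]_(n + n)) :
  (forall lam, `|lam| = 1 -> SO (g lam)) ->
  (forall lam, `|lam| = 1 -> cmx (g lam) = lam^-1 *: P + Q + lam *: conjmx P) ->
  P *m P^T = 0 /\ P^T *m conjmx P + Q^T *m Q + (conjmx P)^T *m P = 1%:M.
Proof.
move=> gSO gE.
have lg lam : `|lam| = 1 -> lam *: cmx (g lam) = P + lam *: Q + lam ^+ 2 *: conjmx P.
  move=> l1; rewrite gE // !scalerDr !scalerA mulfV ?unit_neq0 // scale1r -expr2.
  by [].
pose cf (A B D A' B' D' : 'M[C]_(n + n)) := nth 0 [:: A *m A'; A *m B' + B *m A';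
      A *m D' + B *m B' + D *m A' - 1%:M; B *m D' + D *m B'; D *m D'].
have prod (A B D A' B' D' : 'M[C]_(n + n)) (lam : C) :
    (A + lam *: B + lam ^+ 2 *: D) *m (A' + lam *: B' + lam ^+ 2 *: D') - lam ^+ 2 *: 1%:M =
    \sum_(k < 5) lam ^+ k *: cf A B D A' B' D' k.
  rewrite !big_ord_recl big_ord0 /cf /bump /= !mulmxDl !mulmxDr -!scalemxAl -!scalemxAr.
  rewrite !scalerA expr0 scale1r expr1 addr0.
  move: (A *m _) (A *m _) (A *m _) (B *m _) (B *m _) (B *m _) (D *m _) (D *m _) (D *m _).
  move=> M1 M2 M3 M4 M5 M6 M7 M8 M9; apply/matrixP => i j; rewrite !mxE; ring.
split.
  apply: (@quartic_eq0_on_circle _ _ (cf P Q (conjmx P) P^T Q^T (conjmx P)^T) _ 0%N erefl) => lam l1.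
  rewrite -(prod P Q (conjmx P) P^T Q^T (conjmx P)^T).
  have -> : P^T + lam *: Q^T + lam ^+ 2 *: (conjmx P)^T = (lam *: cmx (g lam))^T.
    by rewrite lg // !linearD /= !linearZ.
  rewrite -lg // trmx_scale -scalemxAl -scalemxAr scalerA -cmxT -cmxM.
  by have [-> _] := gSO _ l1; rewrite cmx1 expr2 subrr.
apply/eqP; rewrite -subr_eq0; apply/eqP.
apply: (@quartic_eq0_on_circle _ _ (cf P^T Q^T (conjmx P)^T P Q (conjmx P)) _ 2%N erefl) => lam l1.
rewrite -(prod P^T Q^T (conjmx P)^T P Q (conjmx P)).
have -> : P^T + lam *: Q^T + lam ^+ 2 *: (conjmx P)^T = (lam *: cmx (g lam))^T.
  by rewrite lg // !linearD /= !linearZ.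
rewrite -lg // trmx_scale -scalemxAl -scalemxAr scalerA -cmxT -cmxM.
by have [-> _] := SO_inv (gSO _ l1); rewrite cmx1 expr2 subrr.
Qed.

Variable l : nat.
Hypothesis l_range : (1 <= l <= n.-1)%N.
Local Notation S := (@twist_mx R n l).

(** The conclusions of the rigidity argument. They are closed conditions on
    the values of g, so that they survive a limit. *)
Definition loop_normal_form (g : C -> 'M[R]_(n + n)) : Prop :=
  let P := polar_coef g in
  [/\ forall lam, `|lam| = 1 ->
        cmx (g lam) = lam^-1 *: P + (1%:M - P - conjmx P) + lam *: conjmx P,
      (conjmx P)^T = P, P *m P = P, cmx S *m P = P &
      P *m conjmx P = 0].

Lemma loop_has_normal_form (g : C -> 'M[R]_(n + n)) V :
  OmegaAlgG g -> U_zeta_sigma l g -> identified l V (g (- 1)) -> loop_normal_form g.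
Proof.
move=> gA [gU [[gSO g1 _] gT]] /(identifiedE l_range)[v [v1 _ sE]].
have [P0 [P1 [P2 [rP gE']]]] := loop_fourier l_range gA gU.
have [PE P2E P1E] := loop_coefs g1 gE'.
set P := polar_coef g in PE P2E P1E; rewrite PE in rP.
have gE lam : `|lam| = 1 ->
    cmx (g lam) = lam^-1 *: P + (1%:M - P - conjmx P) + lam *: conjmx P.
  by move=> l1; rewrite gE' // PE P2E P1E.
pose J := exp_pi_zeta l : 'M[R]_(n + n); pose w := J *m v.
pose s := g (- 1) *m S; rewrite -/s -/J -/w in sE.
have SS : S *m S = 1%:M by exact: twist_mx_sq.
have N1 : `|- 1 : C| = 1 by rewrite normrN normr1.
have w1 : w^T *m w = 1%:M.
  by rewrite trmx_mul mulmxA -(mulmxA v^T) (exp_pi_zetaT l_range) (exp_pi_zeta_sq l_range) mulmx1.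
have ww : (w *m w^T) *m (w *m w^T) = w *m w^T by rewrite mulmxA -(mulmxA w) w1 mulmx1.
have ss : s *m s = 1%:M by rewrite sE; exact: reflection_sq.
have gN1 : g (- 1) = s *m S by rewrite /s -mulmxA SS mulmx1.
have gV : invmx (g (- 1)) = S *m s.
  have [ug _] := mulmx1_unit (gSO _ N1).1.
  rewrite -[RHS]mulmx1 -(mulmxV ug) mulmxA {2}gN1.
  by rewrite -(mulmxA S) (mulmxA s) ss mul1mx SS mul1mx.
have [PPt cons] := orthogonal_loop_coefs gSO gE.
have twist (X K A B D : 'M[C]_(n + n)) a b :
    X *m ((- a *: A + B + - b *: D) *m K) =
    a *: - (X *m A *m K) + X *m B *m K + b *: - (X *m D *m K).
  rewrite mulmxA mulmxDr mulmxDr mulmxDl mulmxDl.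
  by rewrite -!scalemxAr -!scalemxAl !scaleNr !scalerN.
have sym : P = - (cmx S *m P *m (cmx S *m (cmx s *m cmx S))).
  have gE2 lam : `|lam| = 1 -> cmx (g lam) =
      lam^-1 *: - (cmx S *m P *m cmx (S *m (s *m S))) +
      cmx S *m (1%:M - P - conjmx P) *m cmx (S *m (s *m S)) +
      lam *: - (cmx S *m conjmx P *m cmx (S *m (s *m S))).
    move=> l1; rewrite -(gT lam l1) /T_tau sigma_rho_lE // gV.
    have [Sx ->] : exists Sx, S = Sx by exists S.
    rewrite -mulmxA -(mulmxA (g _)) -(mulmxA Sx s) cmxM (cmxM (g _)).
    rewrite gE ?normrN // invrN; exact: twist.
  have [E _ _] := loop_coefs g1 gE2; rewrite -/P (cmxM S) (cmxM s) in E.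
  exact: esym E.
have [|||||||||||H1 H2 H3 H4 _] := @symmetric_loop_rigidity R (n + n) l P (1%:M - P - conjmx P) (cmx S) (cmx s).
- exact: conj_cmx.
- by rewrite -cmxT twist_mxT.
- by rewrite -cmxM SS cmx1.
- by rewrite -cmxM ss cmx1.
- by rewrite [P + _]addrC -addrA [P + _]addrC addrA !subrK.
- rewrite -cmxM -gN1 gE // invrN invr1 !scaleN1r.
  by rewrite [- P + _]addrC.
- exact: PPt.
- have -> : conjmx (1%:M - P - conjmx P) = 1%:M - P - conjmx P.
    by rewrite conjmxB conjmxB conjmx1 conjmxK addrAC.
  rewrite -[RHS]cons; move: (1%:M - _ - _) => Q0.
  by rewrite [RHS]addrC [in RHS](addrC (P^T *m _)) addrA.
- exact: sym.
- exact: rP.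
- rewrite /cmx !trace_map_mx -rmorphB sE trace_twist_mx // [\tr (2 *: _ - _)]raddfB /= mxtraceZ.
  rewrite mxtrace_mulC w1 mxtrace1 mxtrace1 mulr1.
  rewrite [X in X%:C%C](_ : _ = (4 * l)%:R); last by ring.
  by rewrite rmorph_nat.
by split.
Qed.

End LoopStructure.

(** * Normal form at every point of the sphere *)

Section Charts.
Context {R : realType}.
Local Notation C := R[i].
Local Notation plane := 'rV[R]_2.

Lemma row2P (p q : plane) : p 0 0 = q 0 0 -> p 0 1 = q 0 1 -> p = q.
Proof.
move=> p0 p1; apply/matrixP => i j; rewrite ord1.
by have [->|->] : j = 0 \/ j = 1 by case: j => [[|[|//]] jj]; [left|right]; exact/val_inj.
Qed.

(** The pole missed by the first chart is the origin of the second one. *)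
Lemma chart_surj (z : S2 R) : exists b p, chart b p = z.
Proof.
case: z => x x1; have := x1; rewrite !big_ord_recl big_ord0 addr0 => /eqP.
set i1 := lift _ _; set i2 := lift _ _ => xE.
have E3 (y : 'rV[R]_3) : y 0 0 = x 0 0 -> y 0 i1 = x 0 i1 -> y 0 i2 = x 0 i2 -> y = x.
  move=> h0 h1 h2; apply/matrixP => i j; rewrite ord1.
  case: j => [[|[|[|//]]] jj].
  - by rewrite (_ : Ordinal jj = 0) //; exact/val_inj.
  - by rewrite (_ : Ordinal jj = i1) //; exact/val_inj.
  - by rewrite (_ : Ordinal jj = i2) //; exact/val_inj.
have {}xE : x 0 0 ^+ 2 + (x 0 i1 ^+ 2 + x 0 i2 ^+ 2) = 1 := xE.
have sq : x 0 0 ^+ 2 + x 0 i1 ^+ 2 = (1 - x 0 i2) * (1 + x 0 i2).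
  by transitivity (1 - x 0 i2 ^+ 2); [rewrite -xE; ring|ring].
have [x2|x2] := eqVneq (x 0 i2) 1.
  have /eqP : x 0 0 ^+ 2 + x 0 i1 ^+ 2 = 0 by rewrite sq x2 subrr mul0r.
  rewrite paddr_eq0 ?sqr_ge0 // !sqrf_eq0 => /andP[/eqP x00 /eqP x01].
  exists true, 0; apply: val_inj; apply: E3; rewrite /= !mxE /= ?x00 ?x01 ?x2.
  - by rewrite mulr0 mul0r.
  - by rewrite !mulr0 mul0r.
  - by rewrite expr1 !expr0n /= !addr0 sub0r mulrNN mul1r divr1.
have d0 : 1 - x 0 i2 != 0 by rewrite subr_eq0 eq_sym.
have e0 : 1 + ((x 0 0 / (1 - x 0 i2)) ^+ 2 + (x 0 i1 / (1 - x 0 i2)) ^+ 2)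
    = 2 / (1 - x 0 i2).
  rewrite !expr_div_n -mulrDl sq; field; exact: d0.
exists false, (\row_(j < 2) ([:: x 0 0; x 0 i1]`_j / (1 - x 0 i2))).
apply: val_inj; apply: E3; rewrite /= !mxE /= ?expr0 e0.
- by field; rewrite d0.
- by field; rewrite d0.
- rewrite mul1r -[X in X - 1](addKr 1) e0.
  by field; rewrite d0.
Qed.

Lemma stereo_vec_inj b : injective (@stereo_vec R b).
Proof.
move=> p q E; have e k := congr1 (fun x : 'rV[R]_3 => x 0 k) E.
have sg : (-1) ^+ b != 0 :> R by rewrite signr_eq0.
pose N (p : plane) := 1 + (p 0 0 ^+ 2 + p 0 1 ^+ 2).
have N0 r : N r != 0 by rewrite gt_eqF // ltr_pwDl // addr_ge0 ?sqr_ge0.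
have := e (inord 2); have := e (inord 1); have := e (inord 0).
rewrite !mxE !inordK //= -!/(N _) => e0 e1 e2.
have NE : N p = N q.
  move: e2; rewrite -!mulrA => /(mulfI sg).
  have h (r : plane) : (r 0 0 ^+ 2 + r 0 1 ^+ 2 - 1) / N r = 1 - 2 / N r.
    by rewrite /N; field; exact: N0.
  rewrite !h => /addrI /oppr_inj /mulfI; rewrite pnatr_eq0 => /(_ isT).
  exact: invr_inj.
have NV : (N q)^-1 != 0 by rewrite invr_eq0.
have two : (2 : R) != 0 by rewrite pnatr_eq0.
apply: row2P.
  by move: e0; rewrite NE => /(mulIf NV) /(mulfI two).
by move: e1; rewrite NE => /(mulIf NV) /(mulfI sg) /(mulfI two).
Qed.

Lemma stereo_vec_continuous b : continuous (@stereo_vec R b).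
Proof.
move=> p; apply: (cvg_mxP (F := nbhs p) (nbhs_filter p)) => i j; rewrite ord1.
have oT : open [set: plane] by exact: openT.
suff s : smooth_on setT (fun q : plane => stereo_vec b q 0 j).
  exact: differentiable_continuous (smooth_on_differentiable s (I : setT p)).
have sc k : smooth_on setT (fun q : plane => q 0 k) by exact: smooth_on_coord.
have cst c : smooth_on setT (fun q : plane => c) by exact: smooth_on_cst.
have sr : smooth_on setT (fun q : plane => q 0 0 ^+ 2 + q 0 1 ^+ 2).
  by under eq_fun do rewrite !expr2; apply: smooth_onD => //; apply: smooth_onM.
under eq_fun do rewrite mxE.
apply: smooth_onM => //; last first.
  apply: smooth_onV => //; last exact: smooth_onD.
  by move=> q _; rewrite gt_eqF // ltr_pwDl // addr_ge0 ?sqr_ge0.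
case: j => [[|[|[|//]]] jj] /=.
- exact: smooth_onM.
- by apply: smooth_onM => //; apply: smooth_onM.
- by apply: smooth_onM => //; apply: smooth_onB.
Qed.

Lemma discrete_punctured (D : set (S2 R)) b p : discrete_in_S2 D -> D (chart b p) ->
  \forall q \near p, q <> p -> ~ D (chart b q).
Proof.
move=> dD Dp; have [_ [V nV VD]] := dD _ Dp.
have : \forall q \near p, V (stereo_vec b q) by apply: stereo_vec_continuous.
apply: filterS => q Vq qp Dq; apply: qp; apply: (@stereo_vec_inj b).
have : (V `&` [set val w | w in D]) (stereo_vec b q) by split=> //; exists (chart b q).
by rewrite VD.
Qed.

Lemma mxcsmooth_punctured a b (F : plane -> 'M[C]_(a, b)) p : mxcsmooth setT F ->
  (\forall q \near p, q <> p -> F q = 0) -> F p = 0.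
Proof.
move=> sF F0; apply/matrixP => i j; rewrite mxE.
have [dr di] := csmooth_cdiff (sF i j) (I : [set: plane] p).
apply: complex_eqP.
  apply: (@eq0_of_punctured R (fun q => complex.Re (F q i j))).
    exact: differentiable_continuous.
  by apply: filterS F0 => q Fq qp; rewrite Fq // mxE.
apply: (@eq0_of_punctured R (fun q => complex.Im (F q i j))).
  exact: differentiable_continuous.
by apply: filterS F0 => q Fq qp; rewrite Fq // mxE.
Qed.

Lemma mxcsmooth_conj a b U (F : plane -> 'M[C]_(a, b)) : open U -> mxcsmooth U F ->
  mxcsmooth U (fun q => conjmx (F q)).
Proof.
move=> oU sF i j; have [sr si] := sF i j; under eq_fun do rewrite mxE.
split.
  by rewrite (_ : (fun q => _) = (fun q => complex.Re (F q i j))) //; apply/funext => q; case: (F q i j).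
rewrite (_ : (fun q => _) = (fun q => - complex.Im (F q i j))); first exact: smooth_onN.
by apply/funext => q; case: (F q i j).
Qed.

Lemma mxcsmooth_tr a b U (F : plane -> 'M[C]_(a, b)) : mxcsmooth U F ->
  mxcsmooth U (fun q => (F q)^T).
Proof. by move=> sF i j; under eq_fun do rewrite mxE. Qed.

Lemma mxcsmooth_cmx a b U (F : plane -> 'M[R]_(a, b)) : mx_smooth_on U F ->
  mxcsmooth U (fun q => cmx (F q)).
Proof.
move=> sF i j; under eq_fun do rewrite mxE; split; first exact: sF.
exact: smooth_on_cst.
Qed.

End Charts.

Section NormalFormEverywhere.
Context {R : realType} {n : nat}.
Local Notation C := R[i].
Local Notation plane := 'rV[R]_2.
Variable Phi : S2 R -> C -> 'M[R]_(n + n).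
Hypothesis Phi_ext : extended_solution Phi.

Lemma extended_solution_smooth b lam : `|lam| = 1 ->
  mx_smooth_on setT (fun p : plane => Phi (chart b p) lam).
Proof.
move=> /unit_circ[t ->] i j; have [_ sPhi _] := Phi_ext.
pose M : 'M[R]_(2, 3) := \matrix_(i, j) (i == j :> nat)%:R.
pose c : 'rV[R]_3 := \row_j (t * (j == ord_max)%:R).
have := @smooth_on_affine R 1 2 setT setT M c _ (fun _ _ => I) (sPhi b i j).
congr (smooth_on _ _); apply/funext => p; congr (Phi (chart b _) (circ _) i j).
  have e k : (p *m M + c) 0 (widen_ord (leqnSn 2) k) = p 0 k.
    rewrite !mxE (bigD1 k) //= big1 => [|m mk]; last first.
      by rewrite !mxE /= (_ : (m == k :> nat) = false) ?mulr0 //; apply/negbTE.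
    rewrite !mxE /= eqxx mulr1 addr0.
    rewrite (_ : (widen_ord _ k == ord_max) = false) ?mulr0 ?addr0 //.
    by apply/eqP => /(congr1 val) /=; case: k => [[|[|//]] kk].
  by apply/matrixP => a k; rewrite ord1 mxE e.
rewrite !mxE big1 => [|m _]; first by rewrite eqxx mulr1 add0r.
by rewrite !mxE /= (_ : (m == 2 :> nat) = false) ?mulr0 //; case: m => [[|[|//]] mm].
Qed.

Lemma polar_coef_smooth b : mxcsmooth setT (fun p : plane => polar_coef (Phi (chart b p))).
Proof.
have oT : open [set: plane] by exact: openT.
have cs := @csmooth_cst R setT.
have sB (F G : plane -> 'M[R]_(n + n)) : mx_smooth_on setT F -> mx_smooth_on setT G ->
    mxcsmooth setT (fun p => cmx (F p - G p)).
  move=> sF sG; apply: mxcsmooth_cmx => i j.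
  by under eq_fun do rewrite !mxE; apply: smooth_onB.
apply: mxcsmoothZ => //; apply: mxcsmoothD => //.
  apply: sB; first by move=> i j; exact: smooth_on_cst.
  by apply: extended_solution_smooth; rewrite normrN normr1.
apply: mxcsmoothZ => //; apply: sB; apply: extended_solution_smooth; rewrite ?normrN norm_ci //.
Qed.

Variable l : nat.
Hypothesis l_range : (1 <= l <= n.-1)%N.

(** D is discrete, so a point of D is a limit of points outside D in a chart. *)
Lemma normal_form_everywhere (D : set (S2 R)) : discrete_in_S2 D ->
  (forall z, ~ D z -> loop_normal_form l (Phi z)) ->
  forall z, loop_normal_form l (Phi z).
Proof.
move=> dD nf z; have [Dz|/nf //] := pselect (D z).
have [b [p zE]] := chart_surj z; rewrite -zE in Dz *.
have oT : open [set: plane] by exact: openT.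
have near_nf : \forall q \near p, q <> p -> loop_normal_form l (Phi (chart b q)).
  by apply: filterS (discrete_punctured dD Dz) => q H qp; apply: nf; exact: H.
pose P q := polar_coef (Phi (chart b q)).
have sP : mxcsmooth setT P by exact: polar_coef_smooth.
have sPc : mxcsmooth setT (fun q => conjmx (P q)) by exact: mxcsmooth_conj.
have sN (F : plane -> 'M[C]_(n + n)) : mxcsmooth setT F -> mxcsmooth setT (fun q => - F q).
  move=> sF; apply: (mxcsmooth_ext oT (F := fun q => (- 1) *: F q)).
    by move=> q _; rewrite scaleN1r.
  by apply: mxcsmoothZ => //; exact: csmooth_cst.
have close (F G : plane -> 'M[C]_(n + n)) : mxcsmooth setT F -> mxcsmooth setT G ->
    (forall q, loop_normal_form l (Phi (chart b q)) -> F q = G q) -> F p = G p.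
  move=> sF sG FG; apply/eqP; rewrite -subr_eq0; apply/eqP.
  apply: (@mxcsmooth_punctured R _ _ (fun q => F q - G q)).
    by apply: mxcsmoothD => //; exact: sN.
  by apply: filterS near_nf => q H qp; rewrite (FG q (H qp)) subrr.
have cst (A : 'M[C]_(n + n)) : mxcsmooth setT (fun _ : plane => A) by exact: mxcsmooth_cst.
have cc (c : C) : csmooth setT (fun _ : plane => c) by exact: csmooth_cst.
split.
- move=> lam l1; apply: (close (fun q => cmx (Phi (chart b q) lam))
    (fun q => lam^-1 *: P q + (1%:M - P q - conjmx (P q)) + lam *: conjmx (P q))).
  + exact/mxcsmooth_cmx/extended_solution_smooth.
  + have s0 := mxcsmoothD oT (mxcsmoothD oT (cst 1%:M) (sN _ sP)) (sN _ sPc).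
    exact: (mxcsmoothD oT (mxcsmoothD oT (mxcsmoothZ oT (cc lam^-1) sP) s0)
      (mxcsmoothZ oT (cc lam) sPc)).
  + by move=> q [H _ _ _ _]; exact: H.
- apply: (close (fun q => (conjmx (P q))^T) P) => //; first exact: mxcsmooth_tr.
  by move=> q [].
- apply: (close (fun q => P q *m P q) P) => //; first exact: mxcsmoothM.
  by move=> q [].
- apply: (close (fun q => cmx (twist_mx l) *m P q) P) => //; first exact: mxcsmoothM.
  by move=> q [].
- apply: (close (fun q => P q *m conjmx (P q)) (fun=> 0)) => //; first exact: mxcsmoothM.
  by move=> q [].
Qed.

End NormalFormEverywhere.

Lemma corresponding_normal_form {R : realType} {n : nat} l (phi : S2 R -> RP R n) Phi :
  (1 <= l <= n.-1)%N -> corresponding l phi Phi ->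
  forall z, loop_normal_form l (Phi z).
Proof.
move=> l_range [ext alg [D [dD DU]] [k [_ idk]]].
apply: (normal_form_everywhere ext dD) => z Dz.
exact: (loop_has_normal_form l_range (alg z) (DU z Dz) (idk z)).
Qed.

(** * Holomorphic frames and the extended solution equation *)

Section ImageSpaces.
Context {F : fieldType} {N : nat}.
Implicit Types (A : 'M[F]_N).

Definition mximg A : {vspace 'cV[F]_N} := limg (linfun (mulmx A : 'cV[F]_N -> 'cV[F]_N)).

Lemma mem_mximg A v : A *m A = A -> (v \in mximg A) = (A *m v == v).
Proof.
move=> AA; apply/memv_imgP/eqP => [[u _ ->]|<-]; first by rewrite lfunE /= mulmxA AA.
by exists v; rewrite ?memvf // lfunE.
Qed.

Lemma idempotent_factor_rank A l : A *m A = A -> \rank A = l ->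
  exists (X : 'M[F]_(N, l)) (Y : 'M[F]_(l, N)), A = X *m Y /\ Y *m X = 1%:M.
Proof.
move=> AA <-; exists (col_base A), (row_base A); rewrite mulmx_base.
by split=> //; exact: idempotent_factor.
Qed.

(** X has the rank of A and its columns lie in the image of A, so they span it. *)
Lemma idempotent_through_frame A l (X : 'M[F]_(N, l)) (Y : 'M[F]_(l, N)) :
  \rank A = l -> A *m X = X -> Y *m X = 1%:M -> exists Z, A = X *m Z.
Proof.
move=> rA AX YX.
have rX : \rank X^T = l.
  rewrite mxrank_tr; apply/eqP; rewrite eqn_leq rank_leq_col /=.
  by have := mxrankM_maxr Y X; rewrite YX mxrank1.
have sub : (X^T <= A^T)%MS by rewrite -{1}AX trmx_mul submxMl.
have /submxP[D AD] : (A^T <= X^T)%MS.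
  by have /leqifP := mxrank_leqif_sup sub; rewrite rX mxrank_tr rA; case: ifP => // _; rewrite ltnn.
by exists D^T; rewrite -[LHS]trmxK AD trmx_mul trmxK.
Qed.

Lemma mximg_frame A l (X : 'M[F]_(N, l)) (Y : 'M[F]_(l, N)) :
  A *m A = A -> \rank A = l -> A *m X = X -> Y *m X = 1%:M ->
  mximg A = <<[seq col k X | k : 'I_l]>>%VS /\ \dim (mximg A) = l.
Proof.
move=> AA rA AX YX; have [Z AZ] := idempotent_through_frame rA AX YX.
have E : mximg A = <<[seq col k X | k : 'I_l]>>%VS.
  apply/vspaceP => v; apply/idP/idP => [|/coord_span ->].
    rewrite mem_mximg // => /eqP <-; rewrite AZ -mulmxA.
    rewrite [X *m _](_ : _ = \sum_k (Z *m v) k 0 *: col k X).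
      by apply: rpred_sum => k _; apply/rpredZ/memv_span/map_f; rewrite mem_enum.
    apply/matrixP => i j; rewrite ord1 mxE summxE; apply: eq_bigr => k _.
    by rewrite !mxE mulrC.
  apply: rpred_sum => k _; apply: rpredZ.
  have : [tuple of [seq col k X | k : 'I_l]]`_k \in [seq col k X | k : 'I_l].
    by apply: mem_nth; rewrite size_tuple.
  by move=> /mapP[m _ ->]; rewrite mem_mximg // colE mulmxA AX.
split=> //; rewrite E.
have fr : free [seq col k X | k : 'I_l].
  pose b : l.-tuple 'cV[F]_N := [tuple col k X | k < l].
  suff : free b by rewrite /= /image_mem.
  apply/freeP => c c0 k.
  have cX : X *m (\col_k c k) = 0.
    rewrite -[RHS]c0; apply/matrixP => i j; rewrite ord1 mxE summxE; apply: eq_bigr => m _.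
    by rewrite (nth_map m) ?size_enum_ord // nth_ord_enum !mxE mulrC.
  have : Y *m (X *m (\col_k c k)) = 0 by rewrite cX mulmx0.
  by rewrite mulmxA YX mul1mx => /matrixP/(_ k 0); rewrite !mxE.
by move/eqP: fr; rewrite size_map size_enum_ord.
Qed.

End ImageSpaces.

Section HolomorphicImage.
Context {R : realType}.
Local Notation C := R[i].
Local Notation plane := 'rV[R]_2.

Lemma mxcsmooth_col a k (U : set plane) (F : plane -> 'M[C]_(a, k)) j :
  mxcsmooth U F -> mxcsmooth U (fun q => col j (F q)).
Proof. by move=> sF i m; under eq_fun do rewrite mxE; exact: sF. Qed.

Lemma open_unit_locus k (F : plane -> 'M[C]_k) : mxcsmooth setT F ->
  open [set q | F q \in unitmx].
Proof.
move=> sF; have oT : open [set: plane] by exact: openT.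
have [sr si] := csmooth_det oT sF.
pose h q := complex.Re (\det (F q)) * complex.Re (\det (F q)) +
            complex.Im (\det (F q)) * complex.Im (\det (F q)).
have hE q : (F q \in unitmx) = (h q != 0).
  rewrite unitmxE unitfE /h; case: (\det (F q)) => x y /=.
  by rewrite -!expr2 paddr_eq0 ?sqr_ge0 // !sqrf_eq0 eq_complex.
have -> : [set q | F q \in unitmx] = h @^-1` [set x | x != 0].
  by apply/seteqP; split=> q /=; rewrite hE.
have sh : smooth_on setT h by apply: smooth_onD => //; apply: smooth_onM.
apply: open_comp; last exact: open_neq.
by move=> q _; exact: differentiable_continuous (smooth_on_differentiable sh (I : setT q)).
Qed.

(** Let X span the image at p, let Y X = 1, and let s be the frame P X
    normalised by Y s = 1. From s = P s and P dbar P = dbar P, the derivative dbar s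
    lies in the image of P, hence is a combination of the columns of s; its
    coefficients are Y dbar s = dbar (Y s) = 0. No differential equation has to be
    solved. *)
Lemma projection_holomorphic_frame N l (P : plane -> 'M[C]_N) (p : plane) :
  mxcsmooth setT P -> (forall q, P q *m P q = P q) -> (forall q, \rank (P q) = l) ->
  (forall q, P q *m mxwirt ci P q = mxwirt ci P q) ->
  exists (U : set plane) (s : 'I_l -> plane -> 'cV[C]_N),
    [/\ open U, U p, forall k, holomorphic_on U (s k)
      & forall q, U q -> mximg (P q) = <<[seq s k q | k : 'I_l]>>%VS].
Proof.
move=> sP PP rP dP; have oT : open [set: plane] by exact: openT.
have [X [Y [PXY YX]]] := idempotent_factor_rank (PP p) (rP p).
pose M q := Y *m P q *m X.
have sM : mxcsmooth setT M.
  apply: mxcsmoothM => //; last exact: mxcsmooth_cst.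
  by apply: mxcsmoothM => //; exact: mxcsmooth_cst.
pose U := [set q | M q \in unitmx]; have oU : open U by exact: open_unit_locus.
have Up : U p.
  by rewrite /U /= /M PXY mulmxA YX mul1mx YX unitmx1.
pose s q := P q *m X *m invmx (M q).
have sPX U' : open U' -> mxcsmooth U' (fun q => P q *m X).
  move=> oU'; apply: mxcsmoothM => //; last exact: mxcsmooth_cst.
  by move=> i j; apply: csmoothS (sP i j).
have ss : mxcsmooth U s.
  apply: mxcsmoothM => //; first exact: sPX.
  by apply: mxcsmooth_invmx => // i j; apply: csmoothS (sM i j).
have Ys q : U q -> Y *m s q = 1%:M by move=> Uq; rewrite /s !mulmxA mulmxV.
have Ps q : P q *m s q = s q by rewrite /s !mulmxA PP.
have ds q : U q -> mxwirt ci s q = 0.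
  move=> Uq; have nU : nbhs q U by apply: open_nbhs_nbhs.
  have dfP : mxcdiff P q by exact: mxcsmooth_diff sP (I : setT q).
  have dfs : mxcdiff s q by exact: mxcsmooth_diff ss Uq.
  have E1 : mxwirt ci s q = P q *m mxwirt ci s q.
    have PsE : (fun q => P q *m s q) = s by exact: funext Ps.
    have E := mxwirtM ci dfP dfs; rewrite PsE in E.
    by rewrite {2}E mulmxDr (mulmxA (P q) (mxwirt ci P q)) (mulmxA (P q) (P q)) dP PP -E.
  have E2 : Y *m mxwirt ci s q = 0.
    have <- : mxwirt ci (fun q => Y *m s q) q = Y *m mxwirt ci s q.
      by rewrite (mxwirtM ci (mxcdiff_cst Y q) dfs) mxwirt_cst mul0mx add0r.
    rewrite -(mxwirt_cst ci (1%:M : 'M[C]_l) q); apply: mxwirt_ext.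
    by apply: filterS nU => q' Uq'; exact: Ys.
  have [Z PZ] := idempotent_through_frame (rP q) (Ps q) (Ys q Uq).
  rewrite E1 PZ -(mulmxA (s q)); have : Y *m (P q *m mxwirt ci s q) = 0 by rewrite -E1.
  by rewrite PZ -(mulmxA (s q)) (mulmxA Y (s q)) Ys // mul1mx => ->; rewrite mulmx0.
exists U, (fun k q => col k (s q)); split=> // [k|q Uq].
  split; first by apply/mxcsmoothP; exact: mxcsmooth_col.
  move=> q Uq; rewrite mx_dzbarE; apply/matrixP => i j; rewrite mxE [RHS]mxE.
  have -> : (fun q' => col k (s q') i j) = (fun q' => s q' i k).
    by apply/funext => q'; rewrite mxE.
  by have /matrixP/(_ i k) := ds q Uq; rewrite mxE [RHS]mxE.
by have [] := mximg_frame (PP q) (rP q) (Ps q) (Ys q Uq).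
Qed.

End HolomorphicImage.

Section FourthRoots.
Context {R : realType} {N : nat}.
Local Notation C := R[i].

Lemma mxwirt_affine3 (c d : C) (F1 F2 F3 : 'rV[R]_2 -> 'M[C]_N) q :
  mxcdiff F1 q -> mxcdiff F2 q -> mxcdiff F3 q ->
  mxwirt c (fun q => d *: (1%:M + (-1) *: F1 q + (ci *: F2 q + (- ci) *: F3 q))) q =
  d *: (- mxwirt c F1 q + (ci *: mxwirt c F2 q - ci *: mxwirt c F3 q)).
Proof.
move=> d1 d2 d3; have d0 : mxcdiff (fun=> 1%:M : 'M[C]_N) q by exact: mxcdiff_cst.
have e1 := mxcdiffZ (-1) d1; have e2 := mxcdiffZ ci d2; have e3 := mxcdiffZ (- ci) d3.
rewrite (mxwirtZ c d (mxcdiffD (mxcdiffD d0 e1) (mxcdiffD e2 e3))).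
rewrite (mxwirtD c (mxcdiffD d0 e1) (mxcdiffD e2 e3)) (mxwirtD c d0 e1) (mxwirtD c e2 e3).
rewrite mxwirt_cst (mxwirtZ c _ d1) (mxwirtZ c _ d2) (mxwirtZ c _ d3).
by rewrite add0r scaleN1r scaleNr.
Qed.

Lemma inv_ci : ci^-1 = - ci :> C.
Proof.
apply: (mulfI (unit_neq0 (@norm_ci R))).
by rewrite mulfV ?unit_neq0 ?norm_ci // mulrN ci2 opprK.
Qed.

Lemma mulmx_comb3 (d a b c e f : C) (X Y Z A : 'M[C]_N) :
  d *: (- (a *: (X *m A)) + (b *: (c *: (Y *m A)) - e *: (f *: (Z *m A)))) =
  (d *: (- (a *: X) + (b *: (c *: Y) - e *: (f *: Z)))) *m A.
Proof. by rewrite -scalemxAl mulmxDl mulmxBl mulNmx -!scalemxAl. Qed.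

(** Average over the fourth roots of unity which extracts the coefficient of
    1/lambda in (1 - lambda) F(lambda)/2; only P/2 contributes. *)
Lemma fourth_roots_dbar (P Pc W A : 'M[C]_N) (k := fun lam : C => 2^-1 * (1 - lam))
    (F := fun lam : C => lam^-1 *: P + W + lam *: Pc) :
  4^-1 *: (- (k (-1) *: (F (-1) *m A)) + (ci *: (k ci *: (F ci *m A))
     - ci *: (k (- ci) *: (F (- ci) *m A)))) = 2^-1 *: (P *m A).
Proof.
have i2 : (ci : C) ^+ 2 = - 1 by rewrite expr2 ci2.
rewrite mulmx_comb3; transitivity ((2^-1 *: P) *m A); last by rewrite -scalemxAl.
congr (_ *m _).
rewrite /F /k invrN invr1 invrN inv_ci; apply/matrixP => i j; rewrite !mxE.
transitivity (4^-1 * ((1 - ci ^+ 2) * P i j + (1 + ci ^+ 2) * Pc i j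
   + (- 1 - ci ^+ 2) * W i j)); last by rewrite i2; field.
by field.
Qed.

(** The same for (1 - 1/lambda) F(lambda)/2, to which P and W contribute. *)
Lemma fourth_roots_d (P Pc W A : 'M[C]_N) (k := fun lam : C => 2^-1 * (1 - lam^-1))
    (F := fun lam : C => lam^-1 *: P + W + lam *: Pc) :
  4^-1 *: (- (k (-1) *: (F (-1) *m A)) + (ci *: (k ci *: (F ci *m A))
     - ci *: (k (- ci) *: (F (- ci) *m A)))) = 2^-1 *: ((P - W) *m A).
Proof.
have i2 : (ci : C) ^+ 2 = - 1 by rewrite expr2 ci2.
rewrite mulmx_comb3; transitivity ((2^-1 *: (P - W)) *m A); last by rewrite -scalemxAl.
congr (_ *m _).
rewrite /F /k invrN invr1 invrN inv_ci; apply/matrixP => i j; rewrite !mxE.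
transitivity (4^-1 * ((1 - ci ^+ 2) * P i j + (1 + ci ^+ 2) * Pc i j
   + (- 1 + ci ^+ 2) * W i j)); last by rewrite i2; field.
by field.
Qed.

End FourthRoots.

Section FlatnessConsequences.
Context {R : realType} {n : nat}.
Local Notation C := R[i].
Local Notation plane := 'rV[R]_2.
Variables (l : nat) (Phi : S2 R -> C -> 'M[R]_(n + n)).
Hypothesis Phi_ext : extended_solution Phi.
Hypothesis Phi_nf : forall z, loop_normal_form l (Phi z).

Let P b (q : plane) := polar_coef (Phi (chart b q)).

Lemma extended_solution_diff b lam q : `|lam| = 1 ->
  mxcdiff (fun q : plane => cmx (Phi (chart b q) lam)) q.
Proof.
move=> l1; apply: (@mxcsmooth_diff R _ _ setT) => //.
exact/mxcsmooth_cmx/extended_solution_smooth.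
Qed.

Lemma polar_coef_wirt c b q (k : C -> C) (A : 'M[C]_(n + n)) :
  (forall lam, `|lam| = 1 -> mxwirt c (fun q => cmx (Phi (chart b q) lam)) q =
     k lam *: (cmx (Phi (chart b q) lam) *m A)) ->
  mxwirt c (P b) q = 4^-1 *: (- (k (-1) *: (cmx (Phi (chart b q) (-1)) *m A))
    + (ci *: (k ci *: (cmx (Phi (chart b q) ci) *m A))
    - ci *: (k (- ci) *: (cmx (Phi (chart b q) (- ci)) *m A)))).
Proof.
move=> H.
pose F lam q := cmx (Phi (chart b q) lam).
have N1 : `|- 1 : C| = 1 by rewrite normrN normr1.
have Ni : `|- ci : C| = 1 by rewrite normrN norm_ci.
have PE : P b = fun q => 4^-1 *: (1%:M + (-1) *: F (-1) q + (ci *: F ci q + (- ci) *: F (- ci) q)).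
  apply/funext => q'; rewrite /P /polar_coef !cmxB cmx1 scaleN1r scalerBr scaleNr.
  by [].
have := mxwirt_affine3 c 4^-1 (extended_solution_diff b q N1)
  (extended_solution_diff b q norm_ci) (extended_solution_diff b q Ni).
by rewrite (H _ N1) (H _ norm_ci) (H _ Ni) PE.
Qed.

Lemma extended_solution_wirt b q : exists A1 A2 : 'M[C]_(n + n),
  forall lam, `|lam| = 1 ->
   mxwirt (- ci) (fun q => cmx (Phi (chart b q) lam)) q =
     (2^-1 * (1 - lam^-1)) *: (cmx (Phi (chart b q) lam) *m A1) /\
   mxwirt ci (fun q => cmx (Phi (chart b q) lam)) q =
     (2^-1 * (1 - lam)) *: (cmx (Phi (chart b q) lam) *m A2).
Proof.
have [om _ flat] := Phi_ext; have [ax [ay [_ H]]] := flat b.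
exists (2^-1 *: (cmx (ax q) - ci *: cmx (ay q))), (2^-1 *: (cmx (ax q) + ci *: cmx (ay q))).
move=> lam l1; have [] := H lam q l1.
have uF : cmx (Phi (chart b q) lam) \in unitmx.
  have [gSO _ _] := om (chart b q); have [gg _] := gSO lam l1.
  have : cmx (Phi (chart b q) lam) *m cmx (Phi (chart b q) lam)^T = 1%:M.
    by rewrite -cmxM gg cmx1.
  by case/mulmx1_unit.
rewrite mx_dzE mx_dzbarE => E1 E2.
split; rewrite scalemxAr.
  by rewrite -E1 mulmxA mulmxV // mul1mx.
by rewrite -E2 mulmxA mulmxV // mul1mx.
Qed.

(** Averaging the equation over the fourth roots of unity gives
    dbar P = 1/2 P A2 and d P = 1/2 (P - Q) A1 with Q = 1 - P - conj P; in addition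
    P^T = conj P annihilates both P and Q. *)
Lemma polar_coef_flat b q : P b q *m mxwirt ci (P b) q = mxwirt ci (P b) q /\
  (P b q)^T *m mxwirt (- ci) (P b) q = 0.
Proof.
have [A1 [A2 H]] := extended_solution_wirt b q.
have [gE PH PP _ PPc] := Phi_nf (chart b q).
rewrite -/(P b q) in gE PH PP PPc.
have N1 : `|- 1 : C| = 1 by rewrite normrN normr1.
have Ni : `|- ci : C| = 1 by rewrite normrN norm_ci.
have Pc : (P b q)^T = conjmx (P b q) by rewrite -{1}PH trmxK.
have PcP : conjmx (P b q) *m P b q = 0 by rewrite -[P b q in X in _ *m X]conjmxK -conjmxM PPc conjmx0.
have PcPc : conjmx (P b q) *m conjmx (P b q) = conjmx (P b q) by rewrite -conjmxM PP.
split.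
  have -> : mxwirt ci (P b) q = 2^-1 *: (P b q *m A2).
    rewrite (@polar_coef_wirt ci b q (fun lam => 2^-1 * (1 - lam)) A2); last by move=> lam /H[].
    rewrite (gE _ N1) (gE _ norm_ci) (gE _ Ni); exact: fourth_roots_dbar.
  by rewrite -scalemxAr mulmxA PP.
have -> : mxwirt (- ci) (P b) q = 2^-1 *: ((P b q - (1%:M - P b q - conjmx (P b q))) *m A1).
  rewrite (@polar_coef_wirt (- ci) b q (fun lam => 2^-1 * (1 - lam^-1)) A1); last by move=> lam /H[].
  rewrite (gE _ N1) (gE _ norm_ci) (gE _ Ni); exact: fourth_roots_d.
by rewrite Pc -scalemxAr mulmxA !mulmxBr mulmx1 PcP PcPc subr0 subrr subr0 mul0mx scaler0.
Qed.

End FlatnessConsequences.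

(** * The isotropic bundle and the line it determines *)

Section Geometry.
Context {R : realType} {n : nat}.
Local Notation C := R[i].
Local Notation N := (n + n)%N.

Lemma orthogonal_conj_mul (F : comNzRingType) (O A A' : 'M[F]_N) : O^T *m O = 1%:M ->
  (O *m A *m O^T) *m (O *m A' *m O^T) = O *m (A *m A') *m O^T.
Proof. by move=> OO; rewrite -!mulmxA (mulmxA O^T) OO mul1mx. Qed.

(** w w^T is the projection of the image of B off im Pi and its conjugate. *)
Lemma twistor_line (B : 'M[R]_N) (Pi : 'M[C]_N) (w : 'cV[R]_N) :
  B *m B = B -> B^T = B -> (conjmx Pi)^T = Pi -> Pi *m Pi = Pi -> Pi *m conjmx Pi = 0 ->
  cmx B *m Pi = Pi -> w^T *m w = 1%:M ->
  cmx (w *m w^T) = cmx B - Pi - conjmx Pi ->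
  [set` <[w]>%VS] =
    [set v : 'cV[R]_N | v \in mximg B /\
      hperp (sum_set [set` mximg Pi] (conj_set [set` mximg Pi])) (cmx v)].
Proof.
move=> BB BT PH PP PPc BP w1 ww.
have PcP : conjmx Pi *m Pi = 0 by rewrite -{2}[Pi]conjmxK -conjmxM PPc conjmx0.
have PcT : (conjmx Pi)^T = Pi by [].
have PT : Pi^T = conjmx Pi by rewrite -{1}PH trmxK.
have BPc : cmx B *m conjmx Pi = conjmx Pi by rewrite -{1}(conj_cmx B) -conjmxM BP.
have PB : Pi *m cmx B = Pi by rewrite -{1}PcT -(trmxK (cmx B)) -trmx_mul -cmxT BT BPc.
have www : w *m w^T *m w = w by rewrite -mulmxA w1 mulmx1.
have Pw : Pi *m cmx w = 0.
  rewrite -www cmxM ww mulmxA !mulmxBr PB PP PPc subrr subr0 mul0mx; done.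
have Pcw : conjmx Pi *m cmx w = 0 by rewrite -(conj_cmx w) -conjmxM Pw conjmx0.
apply/seteqP; split=> [v /= /vlineP[c ->]|v /= [vB vperp]].
  split.
    apply: rpredZ; rewrite mem_mximg //; apply/eqP; apply: cmx_inj.
    rewrite cmxM -{1}www cmxM ww mulmxA !mulmxBr BP BPc -cmxM BB.
    by rewrite -ww -cmxM www.
  move=> _ [a /= aA [_ [a' /= a'A <-]] <-].
  move: aA a'A; rewrite !mem_mximg // => /eqP aA /eqP a'A.
  rewrite /herm /bil conjmxD conjmxK mulmxDr mxE.
  have -> : (cmx (c *: w))^T *m conjmx a = 0.
    rewrite -aA conjmxM mulmxA -PT -trmx_mul cmxZ -scalemxAr Pw scaler0 trmx0 mul0mx.
    by [].
  have -> : (cmx (c *: w))^T *m a' = 0.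
    by rewrite -a'A mulmxA -{1}PcT -trmx_mul cmxZ -scalemxAr Pcw scaler0 trmx0 mul0mx.
  by rewrite mxE addr0.
have img (u : 'cV[C]_N) : Pi *m u \in mximg Pi by rewrite mem_mximg // mulmxA PP.
have zero (x : 'cV[C]_N) (M : 'M[C]_N) : (forall u, (x^T *m (M *m u)) 0 0 = 0) -> M^T *m x = 0.
  move=> H; apply: trmx_inj; rewrite trmx_mul trmxK trmx0; apply/matrixP => a i.
  rewrite ord1 [RHS]mxE -[RHS](H (delta_mx i 0)) mulmxA [RHS]mxE (bigD1 i) //= big1.
    by rewrite !mxE !eqxx mulr1 addr0.
  by move=> m mi; rewrite [delta_mx _ _ _ _]mxE (negbTE mi) mulr0.
have Pv : Pi *m cmx v = 0.
  rewrite -PcT; apply: zero => u.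
  have := vperp (Pi *m conjmx u + conjmx 0); rewrite /herm /bil conjmxD conjmxM !conjmxK addr0.
  apply; exists (Pi *m conjmx u); first exact: img.
  by exists (conjmx 0) => //; exists 0; rewrite //= mem0v.
have Pcv : conjmx Pi *m cmx v = 0 by rewrite -(conj_cmx v) -conjmxM Pv conjmx0.
apply/vlineP; exists ((w^T *m v) 0 0).
have E : w *m w^T *m v = v.
  apply: cmx_inj; rewrite cmxM ww !mulmxBl Pv Pcv !subr0 -cmxM.
  by move: vB; rewrite mem_mximg // => /eqP ->.
by rewrite -{1}E -mulmxA {1}[w^T *m v]mx11_scalar mul_mx_scalar.
Qed.

(** Pi is Hermitian, so Pi and conj Pi have the same trace, which is the rank. *)
Lemma rank_of_traces l (B : 'M[R]_N) (Pi : 'M[C]_N) (w : 'cV[R]_N) :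
  \tr B = (2 * l + 1)%:R -> (conjmx Pi)^T = Pi -> Pi *m Pi = Pi -> w^T *m w = 1%:M ->
  cmx (w *m w^T) = cmx B - Pi - conjmx Pi -> \rank Pi = l.
Proof.
move=> tB PH PP w1 /(congr1 (@mxtrace _ _)).
have tc : \tr (conjmx Pi) = \tr Pi by rewrite -mxtrace_tr PH.
rewrite [\tr (_ - _)]raddfB /= [\tr (_ - _)]raddfB /= tc /cmx !trace_map_mx tB mxtrace_mulC w1.
rewrite mxtrace1 rmorph1 rmorph_nat.
rewrite -(idempotent_rank PP) natrD => E.
have : (2 * \rank Pi)%:R = (2 * l)%:R :> C.
  rewrite !natrM; rewrite natrM in E.
  have -> : 2 * (\rank Pi)%:R = (2 * l%:R + 1 - (\rank Pi)%:R - (\rank Pi)%:R) + 2 * (\rank Pi)%:R - 1 :> C.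
    by rewrite -E; ring.
  by ring.
by move/eqP; rewrite eqr_nat eqn_pmul2l // => /eqP.
Qed.

Lemma uniton_number_two l (Phi : S2 R -> C -> 'M[R]_N) : (1 <= l)%N ->
  (forall z, loop_normal_form l (Phi z)) -> (exists z, \rank (polar_coef (Phi z)) = l) ->
  uniton_number Phi 2.
Proof.
move=> l1 nf [z0 rz0].
pose A (k : nat) (z : S2 R) : 'M[C]_N :=
  [:: polar_coef (Phi z); 1%:M - polar_coef (Phi z) - conjmx (polar_coef (Phi z)); conjmx (polar_coef (Phi z))]`_k.
have P0 : polar_coef (Phi z0) != 0 by rewrite -mxrank_eq0 rz0 -lt0n.
exists (- 1), A; split.
- move=> z lam lam1; have [gE _ _ _ _] := nf z; rewrite gE // /laurent.
  rewrite !big_ord_recl big_ord0 /A /= !addr0 [RHS]addrA.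
  have -> : -1 + (bump 0 0)%:Z = 0 by [].
  have -> : -1 + (bump 0 (bump 0 0))%:Z = 1 by [].
  by rewrite expr0z scale1r expr1z exprN1.
- by exists z0.
- exists z0; rewrite /A /=; apply: contra P0 => /eqP E.
  by rewrite -[polar_coef _]conjmxK E conjmx0.
Qed.

End Geometry.

Section Assembly.
Context {R : realType} {n l : nat}.
Local Notation C := R[i].
Local Notation N := (n + n)%N.
Hypothesis l_range : (1 <= l <= n.-1)%N.
Variables (phi : S2 R -> RP R n) (Phi : S2 R -> C -> 'M[R]_N).
Hypothesis Phi_phi : corresponding l phi Phi.

(** At lambda = -1 the normal form reads s_v = S - 2 (P + conj P), that is
    v v^T = (1 + S)/2 - P - conj P for the unit vector v spanning the line up to the
    isometry k and exp(pi zeta); O undoes this isometry. *)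
Lemma corresponding_projections :
  exists O : 'M[R]_N, O^T *m O = 1%:M /\
  forall z, exists w : 'cV[R]_N, [/\ w^T *m w = 1%:M, line (phi z) = <[w]>%VS &
    cmx (w *m w^T) = cmx (O *m fix_proj l *m O^T)
      - cmx O *m polar_coef (Phi z) *m (cmx O)^T - conjmx (cmx O *m polar_coef (Phi z) *m (cmx O)^T)].
Proof.
have nf := corresponding_normal_form l_range Phi_phi.
have [_ _ _ [k [kk idk]]] := Phi_phi.
have k'k : k^T *m k = 1%:M by apply: mulmx1C.
pose J := exp_pi_zeta l : 'M[R]_N.
have JJ1 : J *m J = 1%:M by exact: exp_pi_zeta_sq l_range.
have JT1 : J^T = J by exact: exp_pi_zetaT l_range.
exists (k^T *m J); split.
  by rewrite trmx_mul JT1 trmxK mulmxA -(mulmxA J) kk mulmx1.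
move=> z; have [gE PH PP SP PPc] := nf z; move: (polar_coef (Phi z)) gE PH PP SP PPc => P gE PH PP SP PPc.
have [v [v1 Vv sE]] := identifiedE l_range (idk z).
exists (k^T *m v); split.
- by rewrite trmx_mul trmxK mulmxA -(mulmxA v^T) kk mulmx1.
- have /eqP d1 := valP (phi z).
  have [f fE] : exists f, line (phi z) = <[f]>%VS.
    exists (vpick (line (phi z))); apply/eqP.
    have f0 : vpick (line (phi z)) != 0 by rewrite vpick0 -dimv_eq0 d1.
    by rewrite eq_sym eqEdim -memvE memv_pick /= d1 dim_vline f0.
  have e : mxact k^T (mxact k (line (phi z))) = line (phi z).
    by rewrite fE !mxactE mulmxA k'k mul1mx.
  by rewrite -e Vv mxactE.
rewrite -/J in sE.
have N1 : `|- 1 : C| = 1 by rewrite normrN normr1.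
have PS : P *m cmx (twist_mx l) = P.
  by rewrite -{1}PH -(trmxK (cmx _)) -trmx_mul -cmxT twist_mxT -{1}(conj_cmx (twist_mx l)) -conjmxM SP.
have PcS : conjmx P *m cmx (twist_mx l) = conjmx P.
  by rewrite -{1}(conj_cmx (twist_mx l)) -conjmxM PS.
have E : cmx ((J *m v) *m (J *m v)^T) = cmx (fix_proj l) - P - conjmx P.
  have G : (-1) *: P + (1%:M - P - conjmx P) + (-1) *: conjmx P = 1%:M - 2 *: (P + conjmx P).
    by move: (conjmx P) => Pc; apply/matrixP => i j; rewrite !mxE; ring.
  have := congr1 (@cmx R N N) sE; rewrite cmxM (gE _ N1) invrN invr1 G.
  rewrite mulmxBl mul1mx -scalemxAl mulmxDl PS PcS /twist_mx !cmxB !cmxZ cmx1.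
  rewrite (rmorph_nat (real_complex R)); move: (cmx (fix_proj l)) (cmx (_ *m _)) => B W H.
  apply: (@scalerI _ _ 2); first by rewrite pnatr_eq0.
  by rewrite -[LHS](subrK 1%:M) -H addrAC subrK -addrA -opprD scalerBr.
rewrite conjmxM conjmxM conj_cmx conjmxT conj_cmx -cmxT.
have wE : k^T *m v = (k^T *m J) *m (J *m v) by rewrite mulmxA -(mulmxA k^T) JJ1 mulmx1.
rewrite wE trmx_mul; move: (k^T *m J) (J *m v) E => O x E.
have -> : O *m x *m (x^T *m O^T) = O *m (x *m x^T) *m O^T by rewrite !mulmxA.
by rewrite !(cmxM _ O^T) !(cmxM O) E !mulmxBr !mulmxBl.
Qed.

Lemma twistor_description :
  (exists (W : {vspace 'cV[R]_N}) (A : S2 R -> {vspace 'cV[C]_N}),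
     [/\ \dim W = (2 * l + 1)%N,
         holomorphic_subbundle l A /\ (forall z, [set` A z] `<=` complexify W),
         isotropic A,
         partial_sub A (fun z => hperp (conj_set [set` A z]))
       & forall z,
           [set` line (phi z)] =
           [set v : 'cV[R]_N | v \in W /\
              hperp (sum_set [set` A z] (conj_set [set` A z])) (cmx v)]]) /\
  uniton_number Phi 2.
Proof.
have nf := corresponding_normal_form l_range Phi_phi.
have [ext _ _ _] := Phi_phi.
have [K [KK lines]] := corresponding_projections.
pose B := K *m fix_proj l *m K^T; pose cK := cmx K.
have cKT : cK^T = cmx K^T by rewrite cmxT.
have cKK : cK^T *m cK = 1%:M by rewrite cKT -cmxM KK cmx1.
have BT : B^T = B by rewrite /B !trmx_mul trmxK fix_projT !mulmxA.
have BB : B *m B = B.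
  by rewrite /B orthogonal_conj_mul // (fix_proj_id l_range).
have tB : \tr B = (2 * l + 1)%:R.
  by rewrite /B mxtrace_mulC mulmxA KK mul1mx (trace_fix_proj l_range).
pose Pi z := cK *m polar_coef (Phi z) *m cK^T.
have ccK : conjmx cK = cK by exact: conj_cmx.
have cPi z : conjmx (Pi z) = cK *m conjmx (polar_coef (Phi z)) *m cK^T.
  by rewrite /Pi !conjmxM conjmxT ccK.
have PiH z : (conjmx (Pi z))^T = Pi z.
  have [_ PH _ _ _] := nf z.
  by rewrite cPi !trmx_mul trmxK PH mulmxA.
have PiPi z : Pi z *m Pi z = Pi z.
  by have [_ _ PP _ _] := nf z; rewrite /Pi (orthogonal_conj_mul _ _ cKK) PP.
have PiPic z : Pi z *m conjmx (Pi z) = 0.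
  by have [_ _ _ _ PPc] := nf z; rewrite cPi /Pi (orthogonal_conj_mul _ _ cKK) PPc mulmx0 mul0mx.
have PicPi z : conjmx (Pi z) *m Pi z = 0.
  by rewrite -[Pi z in X in _ *m X]conjmxK -conjmxM PiPic conjmx0.
have PiT z : (Pi z)^T = conjmx (Pi z) by rewrite -{1}PiH trmxK.
have BPi z : cmx B *m Pi z = Pi z.
  have [_ _ _ SP _] := nf z.
  have BP : cmx (fix_proj l) *m polar_coef (Phi z) = polar_coef (Phi z).
    move: SP; rewrite /twist_mx cmxB cmxZ cmx1 (rmorph_nat (real_complex R)) mulmxBl mul1mx -scalemxAl.
    move/eqP; rewrite subr_eq => /eqP H.
    have two : (2 : C) != 0 by rewrite pnatr_eq0.
    by apply: (scalerI two); rewrite H -mulr2n scaler_nat.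
  by rewrite /B !cmxM -cKT /Pi (orthogonal_conj_mul _ _ cKK) BP.
have linesPi z : exists w : 'cV[R]_N, [/\ w^T *m w = 1%:M, line (phi z) = <[w]>%VS &
    cmx (w *m w^T) = cmx B - Pi z - conjmx (Pi z)] by exact: lines.
have rPi z : \rank (Pi z) = l.
  have [w [w1 _ ww]] := linesPi z.
  exact: (rank_of_traces tB (PiH z) (PiPi z) w1 ww).
have rB : \rank B = (2 * l + 1)%N.
  by have /eqP := idempotent_rank BB; rewrite tB eqr_nat => /eqP.
have sPi b : mxcsmooth setT (fun q => Pi (chart b q)).
  have oT : open [set: 'rV[R]_2] by exact: openT.
  apply: mxcsmoothM => //; last exact: mxcsmooth_cst.
  by apply: mxcsmoothM => //; [exact: mxcsmooth_cst|exact: polar_coef_smooth].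
have dPi c b q : mxwirt c (fun q => Pi (chart b q)) q =
    cK *m mxwirt c (fun q => polar_coef (Phi (chart b q))) q *m cK^T.
  have dP : mxcdiff (fun q => polar_coef (Phi (chart b q))) q.
    exact: (mxcsmooth_diff (polar_coef_smooth ext b) (I : setT q)).
  have dc (A : 'M[C]_N) : mxcdiff (fun _ : 'rV[R]_2 => A) q by exact: mxcdiff_cst.
  rewrite (mxwirtM c (mxcdiffM (dc cK) dP) (dc cK^T)) (mxwirtM c (dc cK) dP) !mxwirt_cst.
  by rewrite mul0mx add0r mulmx0 addr0.
have dbarPi b q : Pi (chart b q) *m mxwirt ci (fun q => Pi (chart b q)) q =
    mxwirt ci (fun q => Pi (chart b q)) q.
  by rewrite dPi (orthogonal_conj_mul _ _ cKK) (polar_coef_flat ext nf b q).1.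
have dPi0 b q : (Pi (chart b q))^T *m mxwirt (- ci) (fun q => Pi (chart b q)) q = 0.
  have -> : (Pi (chart b q))^T = cK *m (polar_coef (Phi (chart b q)))^T *m cK^T.
    by rewrite !trmx_mul trmxK mulmxA.
  rewrite dPi (orthogonal_conj_mul _ _ cKK) (polar_coef_flat ext nf b q).2.
  by rewrite mulmx0 mul0mx.
split; last first.
  apply: (uniton_number_two _ nf); first by case/andP: l_range.
  exists (chart false 0); have [_ _ PP _ _] := nf (chart false 0).
  apply/eqP; rewrite -(eqr_nat C) (idempotent_rank PP) -(rPi (chart false 0)).
  by rewrite (idempotent_rank (PiPi _)) mxtrace_mulC mulmxA cKK mul1mx.
exists (mximg B), (fun z => mximg (Pi z)); split.
- have [X [Y [BXY YX]]] := idempotent_factor_rank BB rB.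
  have BX : B *m X = X by rewrite BXY -mulmxA YX mulmx1.
  by have [] := mximg_frame BB rB BX YX.
- split; last first.
    move=> z v /=; rewrite mem_mximg // => /eqP vE.
    have Bv : cmx B *m v = v by rewrite -vE mulmxA BPi.
    split; rewrite mem_mximg //; apply/eqP.
      rewrite -[in RHS]Bv; apply/matrixP => i j; rewrite !mxE raddf_sum /=.
      by apply: eq_bigr => k _; rewrite !mxE; case: (v k j) => x y /=; rewrite mul0r subr0.
    rewrite -[in RHS]Bv; apply/matrixP => i j; rewrite !mxE raddf_sum /=.
    by apply: eq_bigr => k _; rewrite !mxE; case: (v k j) => x y /=; rewrite mul0r addr0.
  split=> [z|b p].
    have [X [Y [BXY YX]]] := idempotent_factor_rank (PiPi z) (rPi z).
    have BX : Pi z *m X = X by rewrite BXY -mulmxA YX mulmx1.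
    by have [] := mximg_frame (PiPi z) (rPi z) BX YX.
  exact: (projection_holomorphic_frame p (sPi b) (fun q => PiPi _) (fun q => rPi _) (dbarPi b)).
- move=> z v w; rewrite !mem_mximg // => /eqP <- /eqP <-.
  by rewrite /bil trmx_mul PiT -mulmxA (mulmxA (conjmx _)) PicPi mul0mx mulmx0 mxE.
- move=> b U s oU /mxcsmoothP ss sA q Uq _ [a /= + <-].
  rewrite mem_mximg // => /eqP aE.
  rewrite /herm /bil conjmxK mx_dzE.
  have nU : nbhs q U by apply: open_nbhs_nbhs.
  have dP : mxcdiff (fun q => Pi (chart b q)) q by exact: (mxcsmooth_diff (sPi b) (I : setT q)).
  have ds : mxcdiff s q by exact: (mxcsmooth_diff ss Uq).
  have E : mxwirt (- ci) s q = mxwirt (- ci) (fun q => Pi (chart b q) *m s q) q.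
    apply: mxwirt_ext; apply: filterS nU => q' /sA.
    by rewrite mem_mximg // => /eqP.
  have Z : (Pi (chart b q))^T *m mxwirt (- ci) s q = 0.
    rewrite E (mxwirtM (- ci) dP ds) mulmxDr (mulmxA _ _ (s q)) dPi0 mul0mx add0r.
    by rewrite (mulmxA _ (Pi (chart b q))) PiT PicPi mul0mx.
  rewrite -aE mulmxA -[X in X *m a]trmxK trmx_mul trmxK Z.
  by rewrite trmx0 mul0mx mxE.
- move=> z; have [w [w1 -> ww]] := linesPi z.
  exact: (twistor_line BB BT (PiH z) (PiPi z) (PiPic z) (BPi z) w1 ww).
Qed.

End Assembly.

Theorem theorem20 (R : realType) (n l : nat) (n_ge2 : (2 <= n)%N)
    (l_range : (1 <= l <= n.-1)%N) (phi : S2 R -> RP R n)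
    (phi_harmonic : harmonic_map phi) (phi_class : in_class l phi) :
  (exists (W : {vspace 'cV[R]_(n + n)}) (A : S2 R -> {vspace 'cV[R[i]]_(n + n)}),
     [/\ \dim W = (2 * l + 1)%N,
         holomorphic_subbundle l A /\ (forall z, [set` A z] `<=` complexify W),
         isotropic A,
         partial_sub A (fun z => hperp (conj_set [set` A z]))
       & forall z,
           [set` line (phi z)] =
           [set v : 'cV[R]_(n + n) | v \in W /\
              hperp (sum_set [set` A z] (conj_set [set` A z])) (cmx v)]]) /\
  (forall Phi, corresponding l phi Phi -> uniton_number Phi 2).
Proof.
split=> [|Phi Phi_phi]; last exact: (twistor_description l_range Phi_phi).2.
by have [Phi Phi_phi] := phi_class; exact: (twistor_description l_range Phi_phi).1.
Qed.
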